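(* Assume that $f$ admits a continuous fourth-order derivative $f^{(4)}$ on $[0,1]$; that $(\gamma_n)\in\mathcal{GS}(-\alpha)$ with $\alpha\in(\frac12,1]$; that $(m_n)\in\mathcal{GS}(a)$ with $a\in(0,1)$; and that $\lim_{n\to\infty}(n\gamma_n)\in\left(\min\left(2a,\frac{2\alpha-a}{4}\right),\infty\right]$. Put $\xi=\lim_{n\to\infty}(n\gamma_n)^{-1}$, and let $f_n$ be the recursive Bernstein density estimator with stepsize $(\gamma_n)$ and order $(m_n)$. For $x\in(0,1)$, we have: 1. If $a\in(0,\frac29\alpha]$, then $$\mathrm{Bias}[f_n(x)]=-m_n^{-2}\frac{2}{1-2a\xi}\Delta_2(x)+o(m_n^{-2}).\qquad (\mathrm{B})$$ If $a\in(\frac29\alpha,1)$, then $$\mathrm{Bias}[f_n(x)]=o\left(\sqrt{\gamma_n m_n^{1/2}}\right).$$ 2. If $a\in[\frac29\alpha,1)$, then $$\mathrm{Var}[f_n(x)]=C_3\gamma_n m_n^{1/2}\frac{2}{4-(2\alpha-a)\xi}f(x)\psi(x)+o\left(\gamma_n m_n^{1/2}\right).\qquad (\mathrm{V})$$ If $a\in(0,\frac29\alpha)$, then $$\mathrm{Var}[f_n(x)]=o(m_n^{-4}).$$ 3. If $\lim_{n\to\infty}(n\gamma_n)>\max\left(2a,\frac{2\alpha-a}{4}\right)$ (so that $\lim_{n\to\infty}(n\gamma_n)>2a$ and $\lim_{n\to\infty}(n\gamma_n)>\frac{2\alpha-a}{4}$), then $1-2a\xi>0$ and $4-(2\alpha-a)\xi>0$,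 and (B) and (V) hold simultaneously. 4. If $a\in(0,\frac29\alpha)$, then $$\mathrm{MSE}[f_n(x)]=\Delta_2^2(x)m_n^{-4}\frac{4}{(1-2a\xi)^2}+o(m_n^{-4}).$$ If $a=\frac29\alpha$, then $$\mathrm{MSE}[f_n(x)]=\Delta_2^2(x)m_n^{-4}\frac{4}{(1-2a\xi)^2}+C_3f(x)\psi(x)\gamma_n m_n^{1/2}\frac{2}{4-(2\alpha-a)\xi}+o\left(m_n^{-4}+\gamma_n m_n^{1/2}\right).$$ If $a\in(\frac29\alpha,1)$, then $$\mathrm{MSE}[f_n(x)]=C_3f(x)\psi(x)\gamma_n m_n^{1/2}\frac{2}{4-(2\alpha-a)\xi}+o\left(\gamma_n m_n^{1/2}\right).$$
   Context: Class $\mathcal{GS}$: for $\gamma\in\mathbb{R}$, a nonrandom positive sequence $(v_n)_{n\ge1}$ belongs to $\mathcal{GS}(\gamma)$ if $\lim_{n\to\infty}n\left[1-\frac{v_{n-1}}{v_n}\right]=\gamma$. Estimator: $X_1,X_2,\dots$ are i.i.d. random variables with common unknown density $f$ supported on $[0,1]$. Let $b_k(m,x)=\binom mk x^k(1-x)^{m-k}$ be the Bernstein polynomial of order $m$, and set $$T_{n,m}(x)=m\sum_{k=0}^{m-1}\mathbb{I}\left\{\tfrac km<X_n\le\tfrac{k+1}m\right\}b_k(m-1,x).$$ Given a stepsize sequence $(\gamma_n)$ and an order sequence $(m_n)$, put $Z_n(x)=2T_{n,m}(x)-T_{n,m/2}(x)$ with $m=m_n$. The recursive estimator is defined by $f_0(x)=0$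 and, for $n\ge1$, $f_n(x)=(1-\gamma_n)f_{n-1}(x)+\gamma_nZ_n(x)$. Notation: $\mathrm{Bias}[f_n(x)]=\mathbb{E}[f_n(x)]-f(x)$; $\mathrm{MSE}[f_n(x)]=\mathbb{E}[(f_n(x)-f(x))^2]$; $\psi(x)=(4\pi x(1-x))^{-1/2}$; $C_3=\frac1{\sqrt2}+4\left(1-\sqrt{\frac23}\right)$; $$\Delta_2(x)=\tfrac16(1-6x(1-x))f''(x)+\tfrac5{12}x(1-x)(1-2x)f^{(3)}(x)+\tfrac18x^2(1-x)^2f^{(4)}(x).$$ Asymptotic statements are as $n\to\infty$.
   Formalization: No integer sequence lies in GS(a) for 0<a<1, so (m_n) is taken real-valued in GS(a) and the estimator uses as Bernstein orders any positive even integers M_n with M_n/m_n → 1 (M_n = m_n allowed); the conclusions are stated in m_n. *)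

(* Defs.v *)
From HB Require Import structures.
From mathcomp Require Import all_boot all_order all_algebra.
From mathcomp Require Import all_classical all_reals all_analysis.
Set Implicit Arguments.
Unset Strict Implicit.
Unset Printing Implicit Defensive.
Import Order.TTheory GRing.Theory Num.Theory.
Import numFieldNormedType.Exports.
Local Open Scope classical_set_scope.
Local Open Scope ring_scope.

(* All sequences (v_n)_{n >= 1} are functions on nat whose value at 0 is
   irrelevant. *)

Definition GS (R : realType) (c : R) (v : nat -> R) : Prop :=
  (forall n, (0 < n)%N -> 0 < v n) /\
  n%:R * (1 - v n.-1 / v n) @[n --> \oo] --> c.

(* Bernstein orders are integers, and T_{n,m/2} requires them to be even.
   A sequence of integers cannot belong to GS(a) when 0 < a < 1: its increments
   would eventually be at least 1, so m_n >= n + O(1), whereas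
   m_n = n^(a + o(1)).  Hence m ranges over real sequences, and the orders
   actually used are any positive even integers M_n equivalent to m_n, such as
   M_n = 2 * ceil(m_n / 2); the case M_n = m_n is included. *)
Definition bernstein_orders (R : realType) (m : nat -> R) (M : nat -> nat)
    : Prop :=
  (forall n, (0 < n)%N -> (0 < M n)%N /\ ~~ odd (M n)) /\
  (M n)%:R / m n @[n --> \oo] --> (1 : R).

(* Derivative relative to A: one-sided at the end points when A = [0, 1]. *)
Definition derivative_within (R : realType) (A : set R) (g : R -> R) (x l : R)
    : Prop :=
  (g y - g x) / (y - x) @[y --> within A x^'] --> l.

Definition Ck_within (R : realType) (k : nat) (A : set R) (f : R -> R) : Prop :=
  exists d : nat -> R -> R,
    [/\ forall x, A x -> d 0%N x = f x,
        forall j, (j < k)%N -> forall x, A x ->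
          derivative_within A (d j) x (d j.+1 x)
      & {within A, continuous (d k)}].

Section observations.
Context (d : measure_display) (T : measurableType d) (R : realType).
Variable P : probability T R.

(* Mutual independence of (X_n)_{n >= 1}. *)
Definition mutually_independent (X : nat -> {RV P >-> R}) : Prop :=
  forall (s : seq nat) (B : nat -> set R),
    uniq s -> (forall i, i \in s -> (0 < i)%N) ->
    (forall i, measurable (B i)) ->
    P (\bigcap_(i in [set` s]) X i @^-1` B i) =
    (\prod_(i <- s) P (X i @^-1` B i))%E.

Definition has_density (X : {RV P >-> R}) (f : R -> R) : Prop :=
  [/\ measurable_fun setT f,
      forall y, 0 <= f y
    & forall B, measurable B ->
        distribution P X B = (\int[lebesgue_measure]_(y in B) (f y)%:E)%E].

(* (X_n)_{n >= 1} is i.i.d. with common density f supported on [0, 1]. *)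
Definition iid_sample (X : nat -> {RV P >-> R}) (f : R -> R) : Prop :=
  [/\ mutually_independent X,
      forall n, (0 < n)%N -> has_density (X n) f
    & forall y, ~ `[0, 1]%classic y -> f y = 0].

End observations.

Section estimator.
Context (R : realType).

Definition bernstein (k m : nat) (x : R) : R :=
  'C(m, k)%:R * x ^+ k * (1 - x) ^+ (m - k).

(* T_{n,m}(x) as a function of the value y of the observation X_n. *)
Definition bernstein_T (m : nat) (x y : R) : R :=
  m%:R * \sum_(k < m)
    \1_(`]k%:R / m%:R, k.+1%:R / m%:R]%classic) y * bernstein k m.-1 x.

Definition bernstein_Z (m : nat) (x y : R) : R :=
  2 * bernstein_T m x y - bernstein_T m./2 x y.

Fixpoint estimator (U : Type) (gamma : nat -> R) (M : nat -> nat)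
    (X : nat -> U -> R) (x : R) (n : nat) : U -> R :=
  if n is k.+1 then
    fun w => (1 - gamma n) * estimator gamma M X x k w +
             gamma n * bernstein_Z (M n) x (X n w)
  else fun=> 0.

Definition psi (x : R) : R := (Num.sqrt (4 * pi * x * (1 - x)))^-1.

Definition C3 : R := (Num.sqrt 2)^-1 + 4 * (1 - Num.sqrt (2 / 3)).

Definition Delta2 (f : R -> R) (x : R) : R :=
  6^-1 * (1 - 6 * x * (1 - x)) * derive1n 2 f x +
  5 / 12 * x * (1 - x) * (1 - 2 * x) * derive1n 3 f x +
  8^-1 * x ^+ 2 * (1 - x) ^+ 2 * derive1n 4 f x.

End estimator.

Section risk.
Context (d : measure_display) (T : measurableType d) (R : realType).
Variable P : probability T R.

(* Expectations are extended-real valued; those below are finite, because the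
   estimator is bounded. *)
Definition bias (Y : T -> R) (t : R) : R := fine ('E_P[Y])%E - t.
Definition var (Y : T -> R) : R := fine ('V_P[Y])%E.
Definition mse (Y : T -> R) (t : R) : R :=
  fine ('E_P[(fun w => (Y w - t) ^+ 2)%R])%E.

End risk.

(* Main.v *)
(* Averaging the observation over a cell of the grid of mesh 1/m and weighting
   the cells by binomial probabilities, T_m(x) has mean E f((K + U) / m), with K
   binomial (m - 1, x) and U uniform on [0, 1].  Expanding f at x gives
   E T_m(x) = f(x) + c1 / m + Delta_2(x) / m^2 + o(m^-2), the remainder being
   squeezed between polynomials whose means are explicit in the central moments
   of K; the combination 2 T_m - T_{m/2} cancels c1 and leaves -2 Delta_2 / m^2.

   The second moment of Z reduces to probabilities that independent binomial
   variables collide, such as sum_k b_k(m-1, x)^2.  By Fourier inversion these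
   are integrals over [0, pi] of products of characteristic functions, which
   are compared pointwise with a Gaussian (Laplace's method).

   Independence turns the definition of f_n into u_n = (1 - k_n) u_{n-1} +
   gamma_n w_n for the bias (k = gamma) and for the variance
   (k = 1 - (1 - gamma)^2).  Dividing by the claimed order v_n, which varies
   regularly, gives a recursion of the type of Chung's lemma whose limit is read
   off from (1 - v_{n-1} / v_n) / gamma_n. *)

Require Import Defs.
From HB Require Import structures.
From mathcomp Require Import all_boot all_order all_algebra.
From mathcomp Require Import all_classical all_reals all_analysis.
From mathcomp Require Import measurable_realfun complex.
From mathcomp Require Import ring lra zify.
Set Implicit Arguments.
Unset Strict Implicit.
Unset Printing Implicit Defensive.
Import Order.TTheory GRing.Theory Num.Theory.
Import numFieldNormedType.Exports.
Local Open Scope classical_set_scope.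
Local Open Scope ring_scope.

(** * Step-size recursions and regular variation *)

Section sequences.
Context {R : realType}.
Implicit Types (u v w r b g s : nat -> R).

(** The risk scales m_n^-4 and gamma_n m_n^(1/2) vary regularly with exponents - 4 a and - alpha + a
    / 2. These agree exactly at a = 2 alpha / 9, which is also where 2 a = (2 alpha - a) / 4. Hence
    the minimum in the hypothesis on n gamma_n is always the bound required by the dominant scale,
    and the negligible term is treated by running its recursion on that scale with a source of limit
    0. That such a source tends to 0 again follows from the sign of an exponent, by the recursion
    lemma itself.

    The obstacle in the bias is that Taylor's estimate is good only near x, while the binomial law
    charges all of [0, 1]. In place of a tail estimate, the remainder away from x is bounded by C (y
    - x)^6. This is an even power, hence a polynomial without absolute values, and its mean is
    O(m^-3), so C may depend on epsilon without harm. The second moment uses the same device with (y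
    - x)^2, since there f is needed to order zero only. *)

Lemma harmonic_sum_unbounded (N : nat) (A : R) :
  \forall n \near \oo, A <= \sum_(N <= k < n) k.+1%:R^-1.
Proof.
have nd : nondecreasing_seq (series (@harmonic R)).
  by apply/nondecreasing_seqP => n; rewrite /series/= big_nat_recr//= lerDl invr_ge0.
have ubd : ~ has_ubound (range (series (@harmonic R))).
  by move=> h; apply: (@dvg_harmonic R); exact: nondecreasing_is_cvgn.
have [n0 hn0] : exists n, A + series (@harmonic R) N < series (@harmonic R) n.
  apply: contrapT => h; apply: ubd; exists (A + series (@harmonic R) N).
  move=> _ [n _ <-]; rewrite leNgt; apply/negP => hn; apply: h; by exists n.
near=> n.
have nN : (N <= n)%N by near: n; exact: nbhs_infty_ge.
have nn0 : (n0 <= n)%N by near: n; exact: nbhs_infty_ge.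
have := nd _ _ nn0; rewrite /series/= in hn0 *.
rewrite [X in _ <= X -> _](@big_cat_nat _ _ _ N)//=; lra.
Unshelve. all: by end_near. Qed.

(** In place of the product of the factors 1 - h, the bound z_n (1 + c S_n) <= z_N is propagated,
    S_n being the harmonic sum from N: with q = c / (n + 1), one has (1 - q)(1 + c S + q) <= 1 + c
    S. Divergence of S_n concludes. *)
Lemma contraction_small (N : nat) (c e : R) (z h : nat -> R) : 0 < c -> 0 < e ->
  (forall n, (N <= n)%N -> 0 <= z n) ->
  (forall n, (N <= n)%N -> c / n.+1%:R <= h n.+1 <= 1) ->
  (forall n, (N <= n)%N -> z n.+1 <= (1 - h n.+1) * z n) ->
  \forall n \near \oo, z n <= e.
Proof.
move=> c0 e0 z0 hh hz.
have key n : (N <= n)%N -> z n * (1 + c * \sum_(N <= k < n) k.+1%:R^-1) <= z N.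
  elim: n => [|n IH].
    by rewrite leqn0 => /eqP ->; rewrite big_geq// mulr0 addr0 mulr1.
  rewrite leq_eqVlt => /predU1P[<-|]; first by rewrite big_geq// mulr0 addr0 mulr1.
  rewrite ltnS => Nn; have {IH} := IH Nn; rewrite big_nat_recr//=.
  set S := \sum_(_ <= _ < _) _; have S0 : 0 <= S by apply: sumr_ge0 => i _; rewrite invr_ge0.
  have := hz _ Nn; have := z0 _ Nn; have /andP[] := hh _ Nn.
  have : 0 <= c / n.+1%:R by rewrite divr_ge0// ltW.
  rewrite [c * (_ + _)]mulrDr; set q := c / _ ; move=> q0 qh h1 zn hzn zN.
  have hzn' : z n.+1 <= (1 - q) * z n.
    by apply: (le_trans hzn); apply: ler_wpM2r => //; lra.
  have cS : 0 <= c * S by rewrite mulr_ge0// ltW.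
  apply: (le_trans _ zN); apply: (le_trans (ler_wpM2r _ hzn')); first lra.
  rewrite mulrAC mulrC ler_wpM2l//.
  have : 0 <= q * (c * S) by rewrite mulr_ge0.
  have : 0 <= q * q by rewrite mulr_ge0.
  lra.
have [A hA] : exists A, z N <= e * (1 + c * A).
  exists (z N / (e * c)); have -> : e * (1 + c * (z N / (e * c))) = e + z N.
    by field; rewrite !gt_eqF.
  lra.
near=> n.
have nN : (N <= n)%N by near: n; exact: nbhs_infty_ge.
have SA : A <= \sum_(N <= k < n) k.+1%:R^-1.
  by near: n; exact: harmonic_sum_unbounded.
have S0 : 0 <= \sum_(N <= k < n) k.+1%:R^-1 :> R by apply: sumr_ge0 => i _; rewrite invr_ge0.
have := key _ nN; move: SA S0; set S := \sum_(_ <= _ < _) _ => SA S0 hk.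
have cS0 : 0 <= c * S by rewrite mulr_ge0// ltW.
have : z n * (1 + c * S) <= e * (1 + c * S).
  apply: (le_trans hk); apply: (le_trans hA); rewrite ler_pM2l// lerD2l ler_pM2l//.
by rewrite ler_pM2r//; lra.
Unshelve. all: by end_near. Qed.

(** The error r - s0 / b0 is contracted by 1 - b g and perturbed by g (s - b s0 / b0), whose bracket
    tends to 0. The lower bound c / n on the steps makes their sum diverge. *)
Lemma chung_cvg r b g s (c b0 s0 : R) : 0 < c -> 0 < b0 ->
  (\forall n \near \oo, r n = (1 - b n * g n) * r n.-1 + g n * s n) ->
  (\forall n \near \oo, c / n%:R <= g n) ->
  g n @[n --> \oo] --> 0 -> b n @[n --> \oo] --> b0 -> s n @[n --> \oo] --> s0 ->
  r n @[n --> \oo] --> s0 / b0.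
Proof.
move=> c0 b00 hr hg g0 hb hs.
have hsb : s n - b n * (s0 / b0) @[n --> \oo] --> (0 : R).
  have -> : 0 = s0 - b0 * (s0 / b0) by rewrite mulrC divfK ?subrr ?gt_eqF.
  by apply: cvgB => //; apply: cvgM => //; exact: cvg_cst.
apply/cvgrPdist_le => e e0.
have [N _ hN] : \forall n \near \oo,
  [/\ r n = (1 - b n * g n) * r n.-1 + g n * s n, c / n%:R <= g n,
      b0 / 2 <= b n, b n * g n <= 1 & `|s n - b n * (s0 / b0)| <= b0 * e / 4].
  near=> n; split.
  - by near: n.
  - by near: n.
  - near: n; apply: (cvgr_ge b0) => //; lra.
  - near: n; apply: (cvgr_le (b0 * 0)); first exact: cvgM.
    by rewrite mulr0.
  - near: n; move/cvgr0Pnorm_le : hsb; apply.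
    by rewrite divr_gt0 ?mulr_gt0.
(* Excess of the error over e / 2. It contracts without any source: contraction at rate b0 / 2 takes
   b0 e g / 4 off the offset e / 2, which is exactly the bound allowed for the perturbation. *)
pose z n := Num.max 0 (`|r n - s0 / b0| - e / 2).
have hz : \forall n \near \oo, z n <= e / 2.
  apply: (@contraction_small N.+1 (b0 / 2 * c) _ z (fun n => (b0 / 2) * g n)).
  - by rewrite mulr_gt0// divr_gt0.
  - by rewrite divr_gt0.
  - by move=> n _; rewrite le_max lexx.
  - move=> n Nn; have [_ h2 h3 h4 _] := hN n.+1 (leqW (ltnW Nn)).
    have g0' : 0 <= g n.+1 by apply: le_trans h2; rewrite divr_ge0// ltW.
    apply/andP; split; first by rewrite -mulrA ler_wpM2l// divr_ge0// ltW.
    by apply: le_trans h4; rewrite ler_wpM2r.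
  - move=> n Nn; have [h1 h2 h3 h4 h5] := hN n.+1 (leqW (ltnW Nn)).
    have g0' : 0 <= g n.+1 by apply: le_trans h2; rewrite divr_ge0// ltW.
    rewrite /= in h1.
    have bg : b0 / 2 * g n.+1 <= b n.+1 * g n.+1 by rewrite ler_wpM2r.
    have z0 : 0 <= z n by rewrite le_max lexx.
    have zn : `|r n - s0 / b0| - e / 2 <= z n by rewrite le_max lexx orbT.
    have h1' : r n.+1 - s0 / b0 = (1 - b n.+1 * g n.+1) * (r n - s0 / b0)
       + g n.+1 * (s n.+1 - b n.+1 * (s0 / b0)) by rewrite h1; ring.
    have H : `|r n.+1 - s0 / b0| <= (1 - b n.+1 * g n.+1) * (z n + e / 2)
       + g n.+1 * (b0 * e / 4).
      rewrite h1' (le_trans (ler_normD _ _))// !normrM lerD//.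
        rewrite ger0_norm ?subr_ge0// ler_wpM2l ?subr_ge0//; lra.
      by rewrite ger0_norm// ler_wpM2l.
    rewrite /z -/(z n) ge_max; apply/andP; split.
      by rewrite mulr_ge0// subr_ge0 (le_trans bg).
    have H2 : (1 - b n.+1 * g n.+1) * (z n + e / 2) <=
              (1 - b0 / 2 * g n.+1) * (z n + e / 2).
      apply: ler_wpM2r; lra.
    lra.
near=> n.
rewrite distrC; have : z n <= e / 2 by near: n.
by rewrite /z ge_max => /andP[_]; lra.
Unshelve. all: by end_near. Qed.

End sequences.

(** * Calculus of the classes GS and recursions on a regularly varying scale *)

Section regular_variation.
Context {R : realType}.
Implicit Types (u v w : nat -> R) (c : R).

Lemma cvgn_mul (v w : nat -> R) (k l : R) : v n @[n --> \oo] --> k ->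
  w n @[n --> \oo] --> l -> v n * w n @[n --> \oo] --> k * l.
Proof. exact: cvgM. Qed.

Lemma cvgn_add (v w : nat -> R) (k l : R) : v n @[n --> \oo] --> k ->
  w n @[n --> \oo] --> l -> v n + w n @[n --> \oo] --> k + l.
Proof. exact: cvgD. Qed.

Lemma cvgn_cst (k : R) : (fun _ : nat => k) n @[n --> \oo] --> k.
Proof. exact: cvg_cst. Qed.

Lemma cvg_invn : n%:R^-1 @[n --> \oo] --> (0 : R).
Proof. by rewrite -(cvg_shiftS (fun n => n%:R^-1 : R)); exact: cvg_harmonic. Qed.

Lemma GS_ratio_cvg c v : GS c v -> v n.-1 / v n @[n --> \oo] --> (1 : R).
Proof.
move=> [v0 hv].
have h : 1 - n%:R^-1 * (n%:R * (1 - v n.-1 / v n)) @[n --> \oo] --> (1 - 0 * c : R).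
  apply: cvgB; first exact: cvg_cst.
  by apply: cvgM => //; exact: cvg_invn.
move: h; rewrite mul0r subr0; apply: cvg_trans; apply: near_eq_cvg.
near=> n; have n0 : (0 < n)%N by near: n; exact: nbhs_infty_gt.
rewrite mulrA mulVf ?mul1r ?subKr// pnatr_eq0; lia.
Unshelve. all: by end_near. Qed.

Lemma GS_mul c1 c2 v w : GS c1 v -> GS c2 w -> GS (c1 + c2) (fun n => v n * w n).
Proof.
move=> Gv [w0 hw]; have hp := GS_ratio_cvg Gv; case: Gv => v0 hv; split.
  by move=> n n0; rewrite mulr_gt0 ?v0 ?w0.
have h : n%:R * (1 - v n.-1 / v n) + v n.-1 / v n * (n%:R * (1 - w n.-1 / w n))
    @[n --> \oo] --> c1 + 1 * c2 by apply: cvgD => //; exact: cvgM.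
move: h; rewrite mul1r; apply: cvg_trans; apply: near_eq_cvg.
near=> n; have n0 : (0 < n)%N by near: n; exact: nbhs_infty_gt.
by field; rewrite !gt_eqF ?v0 ?w0.
Unshelve. all: by end_near. Qed.

Lemma GS_exp c v k : GS c v -> GS (c *+ k) (fun n => v n ^+ k).
Proof.
move=> Gv; elim: k => [|k IH].
  split=> [n _|]; first by rewrite expr0.
  under eq_fun do rewrite !expr0 divr1 subrr mulr0.
  exact: cvg_cst.
by rewrite mulrS; under eq_fun do rewrite exprS; exact: GS_mul.
Qed.

Lemma GS_inv c v : GS c v -> GS (- c) (fun n => (v n)^-1).
Proof.
move=> Gv; have hp := GS_ratio_cvg Gv; case: Gv => v0 hv; split.
  by move=> n n0; rewrite invr_gt0 v0.
have h : - ((n%:R * (1 - v n.-1 / v n)) * (v n.-1 / v n)^-1)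
    @[n --> \oo] --> - (c * 1^-1).
  by apply: cvgN; apply: cvgM => //; apply: cvgV.
move: h; rewrite invr1 mulr1; apply: cvg_trans; apply: near_eq_cvg.
near=> n; have n0 : (1 < n)%N by near: n; exact: nbhs_infty_gt.
by field; rewrite !gt_eqF ?v0//; lia.
Unshelve. all: by end_near. Qed.

(** With p = v_{n-1} / v_n, 1 - sqrt p = (1 - p) / (1 + sqrt p), and the denominator tends to 2. *)
Lemma GS_sqrt c v : GS c v -> GS (c / 2) (fun n => Num.sqrt (v n)).
Proof.
move=> Gv; have hp := GS_ratio_cvg Gv; case: Gv => v0 hv; split.
  by move=> n n0; rewrite sqrtr_gt0 v0.
have h : n%:R * (1 - v n.-1 / v n) / (1 + Num.sqrt (v n.-1 / v n))
    @[n --> \oo] --> c / (1 + 1).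
  apply: cvgM => //; apply: cvgV; first by rewrite gt_eqF// addr_gt0.
  apply: cvgD; first exact: cvg_cst.
  rewrite -[X in _ --> X]sqrtr1.
  by apply: (continuous_cvg _ _ hp); exact: sqrt_continuous.
move: h; apply: cvg_trans; apply: near_eq_cvg.
near=> n; have n0 : (1 < n)%N by near: n; exact: nbhs_infty_gt.
have a0 : 0 < v n by apply: v0; lia.
have b0 : 0 < v n.-1 by apply: v0; lia.
rewrite -sqrtrV ?ltW// -sqrtrM ?ltW//.
have := @sqr_sqrtr _ (v n.-1 / v n); rewrite divr_ge0 ?ltW// => /(_ isT).
have := sqrtr_ge0 (v n.-1 / v n); move: (Num.sqrt (v n.-1 / v n)) => s s0 <-.
by field; rewrite gt_eqF//; lra.
Unshelve. all: by end_near. Qed.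

(** [v] itself solves v_n = (1 - b_n / n) v_{n-1} with b_n -> - c > 0, a recursion with step 1 / n
    and source 0. *)
Lemma GS_cvg0 c v : c < 0 -> GS c v -> v n @[n --> \oo] --> (0 : R).
Proof.
move=> c0 Gv; have hp := GS_ratio_cvg Gv; case: Gv => v0 hv.
pose b n := - ((n%:R * (1 - v n.-1 / v n)) * (v n.-1 / v n)^-1).
rewrite -(mul0r (- c)^-1).
apply: (@chung_cvg _ v b (fun n => n%:R^-1) (fun=> 0) 1).
- by [].
- by lra.
- near=> n; have n0 : (1 < n)%N by near: n; exact: nbhs_infty_gt.
  rewrite mulr0 addr0 /b; field; rewrite !gt_eqF ?v0 ?ltr0n//; lia.
- by near=> n; rewrite mul1r.
- exact: cvg_invn.
- rewrite -[in - c](mulr1 c) -[in c * 1]invr1.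
  by apply: cvgN; apply: cvgM => //; apply: cvgV.
- exact: cvg_cst.
Unshelve. all: by end_near. Qed.

(** [K] compares the contraction with the step: it is 1 for means and 2 for variances. An infinite
    limit of n gamma_n is covered through xi = 0. *)
Lemma GS_stepsize_cvg gamma kap u w v (c c0 K xi s : R) :
  (forall n, (0 < n)%N -> 0 < gamma n) -> gamma n @[n --> \oo] --> (0 : R) ->
  0 < c0 -> (\forall n \near \oo, c0 <= n%:R * gamma n) ->
  (n%:R * gamma n)^-1 @[n --> \oo] --> xi ->
  kap n / gamma n @[n --> \oo] --> K ->
  GS c v -> 0 < K + c * xi ->
  (forall n, (0 < n)%N -> u n = (1 - kap n) * u n.-1 + gamma n * w n) ->
  w n / v n @[n --> \oo] --> s -> u n / v n @[n --> \oo] --> s / (K + c * xi).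
Proof.
move=> g0 gcvg c00 hc0 hxi hK Gv Kc hu hw.
have hp := GS_ratio_cvg Gv; case: Gv => v0 hv.
(* Chosen so that 1 - b gamma = (1 - kap) v_{n-1} / v_n. The factors n inserted in the second term
   expose the limits c and xi. *)
pose b n := kap n / gamma n * (v n.-1 / v n) +
  n%:R * (1 - v n.-1 / v n) * (n%:R * gamma n)^-1.
apply: (@chung_cvg _ (fun n => u n / v n) b gamma (fun n => w n / v n) c0) => //.
- near=> n; have n0 : (1 < n)%N by near: n; exact: nbhs_infty_gt.
  rewrite hu 1?ltnW// /b; field; rewrite !gt_eqF ?v0 ?g0 ?ltr0n//; lia.
- near=> n; have n0 : (1 < n)%N by near: n; exact: nbhs_infty_gt.
  rewrite ler_pdivrMr ?ltr0n 1?ltnW// mulrC; near: n; exact: hc0.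
- by rewrite -[in K + _](mulr1 K); apply: cvgD; apply: cvgM.
Unshelve. all: by end_near. Qed.

End regular_variation.

(** * Gaussian integrals and Laplace's method *)

Section segment_integral.
Context {R : realType}.
Notation mu := (@lebesgue_measure R).
Implicit Types (f g F : R -> R).

Lemma continuous_integrable_segment (a b : R) f : continuous f ->
  mu.-integrable `[a, b] (EFin \o f).
Proof.
move=> cf; apply: continuous_compact_integrable; first exact: segment_compact.
exact: continuous_subspaceT.
Qed.

Lemma segment_FTC2 (a b : R) f F : a < b -> continuous f ->
  (forall t : R, is_derive t (1 : R) F (f t)) ->
  \int[mu]_(t in `[a, b]) f t = F b - F a.
Proof.
move=> ab cf dF; rewrite /Rintegral.
have cF : continuous F.
  by move=> t; apply/differentiable_continuous/derivable1_diffP; case: (dF t).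
rewrite (@continuous_FTC2 _ f F) //.
- exact: continuous_subspaceT.
- split=> [t _||].
  + by case: (dF t).
  + by apply: cvg_at_right_filter; exact: cF.
  + by apply: cvg_at_left_filter; exact: cF.
- by move=> t _; rewrite derive1E; apply: derive_val.
Qed.

Lemma le_Rintegral_segment (a b : R) f g : continuous f -> continuous g ->
  (forall t, a <= t <= b -> f t <= g t) ->
  \int[mu]_(t in `[a, b]) f t <= \int[mu]_(t in `[a, b]) g t.
Proof.
move=> cf cg fg; apply: le_Rintegral => //; exact: continuous_integrable_segment.
Qed.

End segment_integral.

Section gauss_asymptotics.
Context {R : realType}.
Notation mu := (@lebesgue_measure R).

Lemma continuous_gauss (l : R) : continuous (fun t : R => expR (- (l * t ^+ 2))).
Proof.
move=> t; apply: (@continuous_comp _ _ _ (fun t : R => - (l * t ^+ 2)) expR).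
  apply: cvgN; apply: cvgM; first exact: cvg_cst.
  exact: exprn_continuous.
exact: continuous_expR.
Qed.

(** By symmetry, half the total mass of a centred normal density of variance 1 / (2 l), up to
    normalisation. *)
Lemma integral0y_gauss_scaled (l : R) : 0 < l ->
  (\int[mu]_(t in `[0%R, +oo[) (expR (- (l * t ^+ 2)))%:E)%E =
  (Num.sqrt (pi / l) / 2)%:E.
Proof.
move=> l0; pose s := Num.sqrt (2 * l)^-1.
have s0 : s != 0 by rewrite gt_eqF// sqrtr_gt0 invr_gt0 mulr_gt0.
have s2 : s ^+ 2 = (2 * l)^-1.
  by rewrite sqr_sqrtr// invr_ge0 mulr_ge0// ltW.
have pk : (normal_peak s)^-1 = Num.sqrt (pi / l).
  rewrite /normal_peak invrK s2 -mulr_natr; congr Num.sqrt.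
  by field; rewrite gt_eqF.
have pk0 := normal_peak_gt0 s0.
have -> : (fun t : R => (expR (- (l * t ^+ 2)))%:E) =
    (fun t => (Num.sqrt (pi / l))%:E * (normal_pdf 0 s t)%:E)%E.
  apply/funext => t; rewrite normal_pdfE//= -EFinM -pk mulKf ?gt_eqF//.
  rewrite /normal_fun subr0 s2; congr (expR _)%:E; rewrite -mulr_natr.
  by field; rewrite gt_eqF.
have := @integral_normal_pdf R 0 s.
rewrite ge0_symfun_integralT; last first.
- move=> t /=; rewrite normal_pdfE//= /normal_fun; congr (_ * expR _).
  by rewrite !subr0 sqrrN.
- exact: continuous_normal_pdf.
- exact: normal_pdf_ge0.
have -> : [set x : R | 0 <= x] = `[0%R, +oo[%classic.
  by apply/seteqP; split=> t /=; rewrite in_itv/= andbT.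
rewrite ge0_integralZl//; last 2 first.
- by apply/measurable_EFinP/measurable_funTS; exact: measurable_normal_pdf.
- by move=> t _; rewrite lee_fin normal_pdf_ge0.
move: (integral _ _ _) => [r| |].
- by rewrite -!EFinM => -[h]; congr (_ * _)%:E; lra.
- by rewrite gt0_muley.
- by rewrite gt0_muleNy.
Qed.

(** For t >= pi >= 1, l t^2 >= l / 2 + (l / 2) t^2, so the tail beyond pi is at most exp(- l / 2)
    times the half-line integral with l / 2 in place of l. *)
Lemma gauss_segment (l : R) : 0 < l ->
  `|\int[mu]_(t in `[0, pi]) expR (- (l * t ^+ 2)) - Num.sqrt (pi / l) / 2|
  <= expR (- (l / 2)) * (Num.sqrt (pi / (l / 2)) / 2).
Proof.
move=> l0; set g := fun t => expR (- (l * t ^+ 2)).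
have l20 : 0 < l / 2 by rewrite divr_gt0.
have pi1 : 1 <= pi :> R by rewrite (le_trans _ (@pi_ge2 R))// ler1n.
have mg : measurable_fun setT (EFin \o g).
  by apply/measurable_EFinP; apply: (continuous_measurable_fun (@continuous_gauss _)).
have mg2 : measurable_fun setT (EFin \o (fun t => expR (- (l / 2 * t ^+ 2)))).
  by apply/measurable_EFinP; apply: (continuous_measurable_fun (@continuous_gauss _)).
have := integral0y_gauss_scaled l0.
have -> : `[0%R, +oo[%classic = `[0, pi] `|` `]pi, +oo[ :> set R.
  apply/seteqP; split=> t /=; rewrite !in_itv/= !andbT.
    by move=> t0; case: (leP t pi) => h; [left|right]; rewrite ?t0.
  by case => [/andP[]//|/ltW]; apply: le_trans; exact: pi_ge0.
rewrite ge0_integral_setU//=; last 2 first.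
- exact: measurable_funTS.
- apply/disj_setPS => t []/=; rewrite !in_itv/= andbT => /andP[_ h1] h2.
  by move: (lt_le_trans h2 h1); rewrite ltxx.
set I1 := integral _ _ _; set I2 := integral _ _ _ => hI.
have I20 : (0 <= I2)%E by apply: integral_ge0 => t _; rewrite lee_fin expR_ge0.
have hI2 : (I2 <= (expR (- (l / 2)) * (Num.sqrt (pi / (l / 2)) / 2))%:E)%E.
  apply: (@le_trans _ _ (\int[mu]_(t in `]pi, +oo[)
      ((expR (- (l / 2)))%:E * (expR (- (l / 2 * t ^+ 2)))%:E)))%E.
    apply: ge0_le_integral => //.
    - exact: (measurable_funTS mg).
    - by apply/measurable_funeM; exact: (measurable_funTS mg2).
    - move=> t; rewrite /= in_itv/= andbT => ht; rewrite -EFinM lee_fin -expRD ler_expR.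
      have t1 : 1 <= t ^+ 2 by apply: exprn_ege1; apply: (le_trans pi1); exact: ltW.
      have : l / 2 * 1 <= l / 2 * t ^+ 2 by rewrite ler_wpM2l// ltW.
      lra.
  rewrite ge0_integralZl//; last exact: (measurable_funTS mg2).
  rewrite EFinM lee_wpmul2l ?lee_fin ?expR_ge0// -integral0y_gauss_scaled//.
  apply: ge0_subset_integral => //.
  - exact: (measurable_funTS mg2).
  - move=> t /=; rewrite !in_itv/= !andbT => /ltW; apply: le_trans.
    exact: pi_ge0.
have I10 : (0 <= I1)%E by apply: integral_ge0 => t _; rewrite lee_fin expR_ge0.
rewrite /Rintegral -/I1.
case: I1 I10 hI => [r1| |]//; case: I2 I20 hI2 => [r2| |]//.
rewrite !lee_fin/= => r20 hr2 r10 [<-].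
by rewrite opprD addrA subrr add0r normrN ger0_norm.
Qed.

End gauss_asymptotics.

(** * Laplace's method on [0, pi] *)

Section laplace.
Context {R : realType}.
Notation mu := (@lebesgue_measure R).

(** The integrand has the elementary antiderivative [F], whose value at pi is nonpositive and is
    dropped. *)
Lemma gauss_moments_segment_le (C k m : R) : 0 < m -> 0 <= C -> 0 <= k ->
  \int[mu]_(t in `[0, pi]) (C * (t + k * t ^+ 3) * expR (- (m * t ^+ 2)))
  <= C * ((2 * m)^-1 + k / (2 * m ^+ 2)).
Proof.
move=> m0 C0 k0.
pose F t : R := - (C * ((2 * m)^-1 + k * t ^+ 2 / (2 * m) + k / (2 * m ^+ 2)) *
  expR (- (m * t ^+ 2))).
have dF (t : R) : is_derive t (1 : R) F (C * (t + k * t ^+ 3) * expR (- (m * t ^+ 2))).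
  apply: is_derive_eq.
  rewrite /GRing.scale/=; field; rewrite gt_eqF//.
have cf : continuous (fun t : R => C * (t + k * t ^+ 3) * expR (- (m * t ^+ 2))).
  move=> t; apply: cvgM; last exact: continuous_gauss.
  apply: cvgM; first exact: cvg_cst.
  apply: cvgD; first exact: cvg_id.
  by apply: cvgM; [exact: cvg_cst|exact: exprn_continuous].
rewrite (segment_FTC2 (pi_gt0 R) cf dF).
rewrite /F expr0n/= mulr0 mul0r !addr0 mulr0 oppr0 expR0 mulr1 opprK.
rewrite gerDr oppr_le0 mulr_ge0 ?expR_ge0// mulr_ge0//.
have m0' := ltW m0.
rewrite !addr_ge0//.
- by rewrite invr_ge0 mulr_ge0.
- by rewrite divr_ge0// mulr_ge0 ?sqr_ge0// pi_ge0.
- by rewrite divr_ge0// mulr_ge0 ?sqr_ge0.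
Qed.

Lemma cvg_inv_sqrtn : (Num.sqrt n%:R)^-1 @[n --> \oo] --> (0 : R).
Proof.
rewrite -{1}(@sqrtr0 R) (_ : (fun n => _) = (fun n => Num.sqrt (n%:R^-1 : R))).
  by apply: (continuous_cvg _ _ (@cvg_invn R)); exact: sqrt_continuous.
by apply/funext => n; rewrite sqrtrV.
Qed.

(** The weight lives at t of order n^(-1/2), where t and n t^3 are both of that order. The error
    thus integrates to O(1 / n), smaller by a factor sqrt n than the Gaussian integral. *)
Lemma laplace_cvg (l c C : R) (h : nat -> R -> R) : 0 < l -> 0 < c -> 0 <= C ->
  (forall n, continuous (h n)) ->
  (forall n t, (1 < n)%N -> 0 <= t <= pi ->
    `|h n t - expR (- (l * n%:R * t ^+ 2))| <=
    C * (t + n%:R * t ^+ 3) * expR (- (c * n%:R * t ^+ 2))) ->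
  Num.sqrt n%:R * \int[mu]_(t in `[0, pi]) h n t @[n --> \oo] -->
  Num.sqrt (pi / l) / 2.
Proof.
move=> l0 c0 C0 ch hh.
(* The first term bounds n times the integrated error of the hypothesis. The second accounts for the
   Gaussian mass beyond pi, through exp(- y) <= 1 / y at y = l n / 2. *)
pose K := C * ((2 * c)^-1 + (2 * c ^+ 2)^-1) + (2 / l) * (Num.sqrt (pi / (l / 2)) / 2).
have K0 : 0 <= K.
  have c0' := ltW c0; have l0' := ltW l0.
  rewrite addr_ge0// mulr_ge0//.
  - by rewrite addr_ge0// invr_ge0 mulr_ge0// sqr_ge0.
  by rewrite divr_ge0// sqrtr_ge0.
have cvgs : K * (Num.sqrt n%:R)^-1 @[n --> \oo] --> (0 : R).
  rewrite -(mulr0 K); apply: cvgM; first exact: cvg_cst.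
  exact: cvg_inv_sqrtn.
apply/cvgrPdist_le => e e0; near=> n.
have n1 : (1 < n)%N by near: n; exact: nbhs_infty_gt.
have n0 : 0 < n%:R :> R by rewrite ltr0n ltnW.
apply: (@le_trans _ _ (K * (Num.sqrt n%:R)^-1)); last first.
  have -> : K * (Num.sqrt n%:R)^-1 = `|K * (Num.sqrt n%:R)^-1|.
    by rewrite ger0_norm// mulr_ge0// invr_ge0 sqrtr_ge0.
  by near: n; move/cvgr0Pnorm_le : cvgs; exact.
set s := Num.sqrt n%:R.
have s0 : 0 < s by rewrite sqrtr_gt0.
have ss : s * s = n%:R by rewrite -expr2 sqr_sqrtr// ltW.
have s1 : 1 <= s.
  by rewrite -[leLHS]sqrtr1 ler_wsqrtr// ler1n ltnW.
have ln0 : 0 < l * n%:R by rewrite mulr_gt0.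
have cn0 : 0 < c * n%:R by rewrite mulr_gt0.
have cg := @continuous_gauss R (l * n%:R).
have D1 : `|\int[mu]_(t in `[0, pi]) h n t -
    \int[mu]_(t in `[0, pi]) expR (- (l * n%:R * t ^+ 2))| <=
    C * ((2 * c)^-1 + (2 * c ^+ 2)^-1) / n%:R.
  rewrite -RintegralB//; [|exact: continuous_integrable_segment..].
  apply: (le_trans (le_normr_Rintegral _ _)) => //.
    by apply: continuous_integrable_segment => t; apply: cvgB; [exact: ch|exact: cg].
  apply: (@le_trans _ _ (\int[mu]_(t in `[0, pi])
      (C * (t + n%:R * t ^+ 3) * expR (- (c * n%:R * t ^+ 2))))).
    apply: le_Rintegral_segment.
    - by move=> t; apply: cvg_norm; apply: cvgB; [exact: ch|exact: cg].
    - move=> t; apply: cvgM; last exact: continuous_gauss.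
      apply: cvgM; first exact: cvg_cst.
      apply: cvgD; first exact: cvg_id.
      by apply: cvgM; [exact: cvg_cst|exact: exprn_continuous].
    - by move=> t t0; exact: hh.
  apply: (le_trans (gauss_moments_segment_le _ _ _)) => //.
  rewrite le_eqVlt; apply/orP; left; apply/eqP; field.
  by rewrite !gt_eqF.
have D2 := gauss_segment ln0.
have E1 : s * (Num.sqrt (pi / (l * n%:R)) / 2) = Num.sqrt (pi / l) / 2.
  rewrite mulrA -sqrtrM ?ltW//; congr (Num.sqrt _ / 2); field.
  by rewrite !gt_eqF.
have E2 : s * (Num.sqrt (pi / (l * n%:R / 2)) / 2) = Num.sqrt (pi / (l / 2)) / 2.
  rewrite mulrA -sqrtrM ?ltW//; congr (Num.sqrt _ / 2); field.
  by rewrite !gt_eqF.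
have D3 : expR (- (l * n%:R / 2)) <= 2 / (l * n%:R).
  rewrite expRN -[leRHS]invrK lef_pV2 ?posrE ?expR_gt0 ?invr_gt0 ?divr_gt0//.
  rewrite invf_div; apply: le_trans (expR_ge1Dx _); lra.
rewrite distrC -E1 -mulrBr normrM gtr0_norm//.
set H := Rintegral _ _ _ in D1 *; set G := Rintegral _ _ _ in D1 D2.
set g1 := _ / 2 in D2 *.
have tri : `|H - g1| <= `|H - G| + `|G - g1|.
  by rewrite -[H - g1](subrKA G) ler_normD.
apply: (le_trans (ler_wpM2l (ltW s0) tri)).
rewrite mulrDr /K mulrDl lerD//.
  apply: (le_trans (ler_wpM2l (ltW s0) D1)).
  by rewrite -ss le_eqVlt; apply/orP; left; apply/eqP; field; rewrite !gt_eqF.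
apply: (le_trans (ler_wpM2l (ltW s0) D2)).
rewrite mulrCA E2 [leRHS]mulrAC; apply: ler_wpM2r.
  by rewrite divr_ge0// sqrtr_ge0.
apply: (le_trans D3).
have -> : 2 / (l * n%:R) = 2 / l / s * s^-1.
  by rewrite -ss; field; rewrite !gt_eqF.
by rewrite ler_piMr ?invf_le1// !divr_ge0// ltW.
Unshelve. all: by end_near. Qed.

End laplace.

(** * Characteristic functions of binomial variables *)

Section trigonometric_bounds.
Context {R : realType}.
Implicit Types t u : R.

(** Engine of the bounds below: each difference vanishes at 0 and its derivative is a difference
    already known to be nonnegative. *)
Lemma ge0_of_derive (F f : R -> R) t : F 0 = 0 ->
  (forall u, is_derive u (1 : R) F (f u)) ->
  (forall u, 0 <= u -> 0 <= f u) -> 0 <= t -> 0 <= F t.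
Proof.
move=> F0 dF f0 t0; rewrite -F0.
apply: (@ger0_derive1_ndecry _ F 0) => //.
- move=> u; rewrite in_itv/= andbT => /ltW u0.
  by rewrite derive1E (@derive_val _ _ _ _ _ _ _ (dF u)) f0.
- apply: continuous_subspaceT => u.
  by apply/differentiable_continuous/derivable1_diffP; case: (dF u).
Qed.

Lemma sin_le_id t : 0 <= t -> sin t <= t.
Proof.
move=> t0; rewrite -subr_ge0.
apply: (@ge0_of_derive (fun t => t - sin t) (fun t => 1 - cos t)) => //.
by rewrite sin0 subrr.
Qed.

Lemma onemcos_le_sqr t : 0 <= t -> 1 - cos t <= t ^+ 2 / 2.
Proof.
move=> t0; rewrite -subr_ge0.
apply: (@ge0_of_derive (fun t => t ^+ 2 / 2 - (1 - cos t)) (fun t => t - sin t)) => //.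
- by rewrite cos0 expr0n/= mul0r !subrr.
- by move=> u; apply: is_derive_eq; rewrite /GRing.scale/=; field.
- by move=> u u0; rewrite subr_ge0 sin_le_id.
Qed.

Lemma subr_sin_le t : 0 <= t -> t - sin t <= t ^+ 3 / 6.
Proof.
move=> t0; rewrite -subr_ge0.
apply: (@ge0_of_derive (fun t => t ^+ 3 / 6 - (t - sin t))
  (fun t => t ^+ 2 / 2 - (1 - cos t))) => //.
- by rewrite sin0 expr0n/= mul0r !subrr.
- by move=> u; apply: is_derive_eq; rewrite /GRing.scale/=; field.
- by move=> u u0; rewrite subr_ge0 onemcos_le_sqr.
Qed.

Lemma onemcos_le_id t : 0 <= t -> 1 - cos t <= t.
Proof.
move=> t0; rewrite -subr_ge0.
apply: (@ge0_of_derive (fun t => t - (1 - cos t)) (fun t => 1 - sin t)) => //.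
- by rewrite cos0 !subrr.
- by move=> u; apply: is_derive_eq; rewrite /GRing.scale/=; ring.
Qed.

Lemma subr_sin_le_sqr t : 0 <= t -> t - sin t <= t ^+ 2 / 2.
Proof.
move=> t0; rewrite -subr_ge0.
apply: (@ge0_of_derive (fun t => t ^+ 2 / 2 - (t - sin t))
  (fun t => t - (1 - cos t))) => //.
- by rewrite sin0 expr0n/= mul0r !subrr.
- by move=> u; apply: is_derive_eq; rewrite /GRing.scale/=; field.
- by move=> u u0; rewrite subr_ge0 onemcos_le_id.
Qed.

Lemma cos_taylor2_le t : 0 <= t -> cos t - (1 - t ^+ 2 / 2) <= t ^+ 3 / 6.
Proof.
move=> t0; rewrite -subr_ge0.
apply: (@ge0_of_derive (fun t => t ^+ 3 / 6 - (cos t - (1 - t ^+ 2 / 2)))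
  (fun t => t ^+ 2 / 2 - (t - sin t))) => //.
- by rewrite cos0 !expr0n/= !mul0r; ring.
- by move=> u; apply: is_derive_eq; rewrite /GRing.scale/=; field.
- by move=> u u0; rewrite subr_ge0 subr_sin_le_sqr.
Qed.

Lemma cos_taylor2 t : `|cos t - (1 - t ^+ 2 / 2)| <= `|t| ^+ 3 / 6.
Proof.
have h u : 0 <= u -> `|cos u - (1 - u ^+ 2 / 2)| <= u ^+ 3 / 6.
  move=> u0; have := cos_taylor2_le u0; have := onemcos_le_sqr u0 => h1 h2.
  by rewrite ger0_norm//; lra.
by have := h `|t| (normr_ge0 _); rewrite cos_norm real_normK// num_real.
Qed.

Lemma sin_taylor1 t : `|sin t - t| <= `|t| ^+ 3 / 6.
Proof.
have h u : 0 <= u -> `|sin u - u| <= u ^+ 3 / 6.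
  move=> u0; have := subr_sin_le u0; have := sin_le_id u0 => h1 h2.
  by rewrite distrC ger0_norm//; lra.
have [t0|t0] := leP 0 t; first by rewrite [in leRHS]ger0_norm// h.
have := h (- t); rewrite oppr_ge0 => /(_ (ltW t0)).
by rewrite sinN -opprD normrN (ltr0_norm t0).
Qed.

(** The constant is 48 = 3 * 16: on [0, 1] Taylor gives t^2 / 3, and on [1, pi] monotonicity of cos
    gives 1 - cos 1 >= 1 / 3 while t^2 <= 16. *)
Lemma onemcos_ge t : 0 <= t <= pi -> t ^+ 2 / 48 <= 1 - cos t.
Proof.
move=> /andP[t0 tpi].
have small u : 0 <= u <= 1 -> u ^+ 2 / 3 <= 1 - cos u.
  move=> /andP[u0 u1]; have := cos_taylor2_le u0.
  have : u ^+ 3 <= u ^+ 2 by rewrite exprSr ler_piMr ?sqr_ge0.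
  lra.
have t2 : 0 <= t ^+ 2 by rewrite sqr_ge0.
have [t1|t1] := leP t 1; first by have := small t; rewrite t0 t1 => /(_ isT); lra.
have pi4 : pi <= 4 :> R.
  have := @pihalf_lt2 R; lra.
have : cos t <= cos 1.
  rewrite leNgt; apply/negP; rewrite ltr_cos ?in_itv/= ?t0 ?tpi//.
    by rewrite ltNge ltW.
  by rewrite ler01/= (le_trans (ltW t1)).
have := small 1; rewrite ler01 lexx => /(_ isT).
have : t ^+ 2 <= 16.
  have -> : 16 = 4 ^+ 2 :> R by rewrite -natrX.
  by rewrite lerXn2r ?nnegrE// (le_trans tpi).
rewrite expr1n; lra.
Qed.

(** The upper side comes from exp(- y) <= 1 / (1 + y) = 1 - y + y^2 / (1 + y). *)
Lemma expRN_taylor1 y : 0 <= y -> `|expR (- y) - (1 - y)| <= y ^+ 2 :> R.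
Proof.
move=> y0; have := expR_ge1Dx (- y) => h1.
rewrite ger0_norm; last by rewrite subr_ge0.
suff : expR (- y) <= (1 + y)^-1.
  have -> : (1 + y)^-1 = 1 - y + y ^+ 2 / (1 + y) by field; rewrite gt_eqF//; lra.
  have : y ^+ 2 / (1 + y) <= y ^+ 2.
    by rewrite ler_piMr ?sqr_ge0// invf_le1; lra.
  lra.
by rewrite expRN lef_pV2 ?posrE ?expR_gt0 ?expR_ge1Dx//; lra.
Qed.

End trigonometric_bounds.

Import Normc.

(** * Moduli of complex numbers and points of the unit circle *)

Section complex_modulus.
Context {R : realType}.
Implicit Types z w : R[i].

Lemma normc_ge0 z : 0 <= normc z.
Proof. by case: z => a b; rewrite sqrtr_ge0. Qed.

Lemma ler_normcD z w : normc (z + w) <= normc z + normc w.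
Proof. exact: le_normcD. Qed.

Lemma normcX z n : normc (z ^+ n) = normc z ^+ n.
Proof.
elim: n => [|n IH]; first by rewrite !expr0 normc1.
by rewrite !exprS normcM IH.
Qed.

Lemma normc_le_ReIm z : normc z <= `|complex.Re z| + `|complex.Im z|.
Proof.
case: z => a b /=; rewrite -[leRHS]ger0_norm ?addr_ge0//.
rewrite -sqrtr_sqr ler_wsqrtr// sqrrD !real_normK ?num_real//.
by rewrite -addrA lerD2l lerDr mulrn_wge0// mulr_ge0.
Qed.

Lemma ler_Re_normc z : `|complex.Re z| <= normc z.
Proof.
by case: z => a b /=; rewrite -sqrtr_sqr ler_wsqrtr// lerDl sqr_ge0.
Qed.

Lemma sqr_normc z : normc z ^+ 2 = complex.Re z ^+ 2 + complex.Im z ^+ 2.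
Proof. by case: z => a b /=; rewrite sqr_sqrtr// addr_ge0 ?sqr_ge0. Qed.

Lemma normc_real (r : R) : normc (r%:C)%C = `|r|.
Proof. by rewrite /= expr0n/= addr0 sqrtr_sqr. Qed.

Lemma normc_mul_sub_le z w z' w' : normc z <= 1 -> normc w' <= 1 ->
  normc (z * w - z' * w') <= normc (z - z') + normc (w - w').
Proof.
move=> z1 w1.
have -> : z * w - z' * w' = z * (w - w') + (z - z') * w' by ring.
rewrite (le_trans (ler_normcD _ _))// !normcM addrC lerD//.
  by rewrite ler_piMr ?normc_ge0.
by rewrite ler_piMl ?normc_ge0.
Qed.

(** Telescoping. The power M^n is kept, rather than bounded by 1, because it becomes the Gaussian
    weight of the pointwise comparison. *)
Lemma normc_exp_sub_le z w (M : R) n : normc z <= M -> normc w <= M ->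
  normc (z ^+ n.+1 - w ^+ n.+1) <= n.+1%:R * M ^+ n * normc (z - w).
Proof.
move=> zM wM; have M0 : 0 <= M by apply: le_trans zM; exact: normc_ge0.
elim: n => [|n IH]; first by rewrite !expr1 expr0 mulr1 mul1r.
have -> : z ^+ n.+2 - w ^+ n.+2 =
  z ^+ n.+1 * (z - w) + (z ^+ n.+1 - w ^+ n.+1) * w.
  by rewrite !(exprSr _ n.+1); ring.
rewrite (le_trans (ler_normcD _ _))// !normcM normcX.
have h1 : normc z ^+ n.+1 * normc (z - w) <= M ^+ n.+1 * normc (z - w).
  by rewrite ler_wpM2r ?normc_ge0// lerXn2r ?nnegrE ?normc_ge0.
have h2 : normc (z ^+ n.+1 - w ^+ n.+1) * normc w <=
    n.+1%:R * M ^+ n * normc (z - w) * M.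
  by apply: ler_pM; rewrite ?normc_ge0.
apply: (le_trans (lerD h1 h2)).
by rewrite le_eqVlt; apply/orP; left; apply/eqP; rewrite [in RHS]mulrSr exprSr; ring.
Qed.

Definition cis (t : R) : R[i] := (cos t +i* sin t)%C.

Lemma cis0 : cis 0 = 1.
Proof. by rewrite /cis cos0 sin0. Qed.

Lemma cisD s t : cis (s + t) = cis s * cis t.
Proof.
apply/eqP; rewrite eq_complex/= cosD sinD eqxx/=; apply/eqP; ring.
Qed.

Lemma cisX t n : cis t ^+ n = cis (n%:R * t).
Proof.
elim: n => [|n IH]; first by rewrite mul0r cis0.
by rewrite exprS IH mulrSr mulrDl mul1r addrC cisD.
Qed.

Lemma normc_cis t : normc (cis t) = 1.
Proof. by rewrite /= cos2Dsin2 sqrtr1. Qed.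

Lemma normc_cis_sub1 t : normc (cis t - 1) <= 2 * `|t|.
Proof.
have -> : normc (cis t - 1) = normc (cis `|t| - 1).
  rewrite /= cos_norm; congr (Num.sqrt (_ + _)); rewrite !subr0.
  have [t0|t0] := leP 0 t; first by rewrite ger0_norm.
  by rewrite ltr0_norm// sinN sqrrN.
apply: (le_trans (normc_le_ReIm _)); rewrite /= subr0.
have t0 := normr_ge0 t; move: `|t| t0 => u u0.
have hc : `|cos u - 1| <= u.
  by rewrite distrC ger0_norm ?onemcos_le_id// subr_ge0 cos_le1.
suff hs : `|sin u| <= u by lra.
rewrite ler_norml sin_le_id// andbT.
have [u1|u1] := leP u 1; last first.
  by apply: (le_trans _ (sin_geN1 u)); rewrite lerN2 ltW.
have [->|un0] := eqVneq u 0; first by rewrite sin0 oppr0.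
have : 0 < sin u.
  by apply: sin2_gt0; rewrite lt_neqAle eq_sym un0 u0/= (le_lt_trans u1)// ltr1n.
lra.
Qed.

End complex_modulus.

(** * Characteristic function of a single trial *)

Section bernoulli_characteristic_function.
Context {R : realType}.
Variable x : R.
Hypothesis x01 : 0 < x < 1.
Implicit Types t : R.

Definition bern_cf t : R[i] := ((1 - x)%:C + x%:C * cis t)%C.

(* Characteristic function of the centred Bernoulli variable. *)
Definition cbern_cf t : R[i] :=
  ((1 - x)%:C * cis (- (x * t)) + x%:C * cis ((1 - x) * t))%C.

Lemma bern_cfE t : bern_cf t = cis (x * t) * cbern_cf t.
Proof.
rewrite /bern_cf /cbern_cf mulrDr !(mulrCA (cis _)) -!cisD subrr cis0 mulr1.
by congr (_ + _ * cis _); ring.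
Qed.

Lemma sqr_normc_cbern_cf t :
  normc (cbern_cf t) ^+ 2 = 1 - 2 * (x * (1 - x)) * (1 - cos t).
Proof.
rewrite sqr_normc /= !mul0r !subr0 !addr0 sinN cosN.
have -> : cos t = cos (x * t + (1 - x) * t) by congr cos; ring.
rewrite cosD.
have h1 := cos2Dsin2 (x * t); have h2 := cos2Dsin2 ((1 - x) * t).
move: (cos (x * t)) (sin (x * t)) (cos ((1 - x) * t)) (sin ((1 - x) * t)) h1 h2.
move=> a b c d' h1 h2.
have -> : 1 - 2 * (x * (1 - x)) * (1 - (a * c - b * d')) =
  (1 - x) ^+ 2 * (a ^+ 2 + b ^+ 2) + x ^+ 2 * (c ^+ 2 + d' ^+ 2) +
  2 * (x * (1 - x)) * (a * c - b * d') by rewrite h1 h2; ring.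
ring.
Qed.

Let s2 := x * (1 - x).
Let s20 : 0 < s2.
Proof. by rewrite /s2; case/andP: x01 => ? ?; rewrite mulr_gt0// subr_gt0. Qed.

Lemma normc_cbern_cf_le1 t : normc (cbern_cf t) <= 1.
Proof.
rewrite -(@ler_pXn2r _ 2) ?nnegrE ?normc_ge0// expr1n sqr_normc_cbern_cf -/s2.
have := cos_le1 t => c1.
have : 0 <= s2 * (1 - cos t) by rewrite mulr_ge0 ?(ltW s20)// subr_ge0.
lra.
Qed.

Lemma sqr_normc_cbern_cf_le t : 0 <= t <= pi ->
  normc (cbern_cf t) ^+ 2 <= expR (- (s2 / 24 * t ^+ 2)).
Proof.
move=> /onemcos_ge ht; rewrite sqr_normc_cbern_cf -/s2.
apply: le_trans (expR_ge1Dx _).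
have : s2 * (t ^+ 2 / 48) <= s2 * (1 - cos t) by rewrite ler_wpM2l// ltW.
lra.
Qed.

(** Centring removes the first-order term, so both sides are 1 - s2 t^2 / 2 up to cubic errors. The
    range |t| <= 8 covers - 2 t for t in [0, pi], since pi <= 4; with s2 <= 1 / 4 it turns the
    quartic error of the exponential into a cubic one. *)
Lemma cbern_cf_gauss t : `|t| <= 8 ->
  normc (cbern_cf t - (expR (- (s2 / 2 * t ^+ 2)))%:C%C) <= `|t| ^+ 3.
Proof.
move=> t8; apply: (le_trans (normc_le_ReIm _)).
rewrite /= !mul0r !subr0 !addr0 sinN cosN.
have hc1 := cos_taylor2 (x * t); have hc2 := cos_taylor2 ((1 - x) * t).
have hs1 := sin_taylor1 (x * t); have hs2 := sin_taylor1 ((1 - x) * t).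
have y0 : 0 <= s2 / 2 * t ^+ 2 by rewrite mulr_ge0 ?sqr_ge0// divr_ge0// ltW.
have he := expRN_taylor1 y0.
have [x0 x1] := andP x01.
have sl : s2 <= 1 / 4.
  have : 0 <= (x - 1 / 2) ^+ 2 by rewrite sqr_ge0.
  rewrite /s2; lra.
have T0 := normr_ge0 t.
have e2 : (s2 / 2 * t ^+ 2) ^+ 2 <= `|t| ^+ 3 / 8.
  have -> : t ^+ 2 = `|t| ^+ 2 by rewrite real_normK// num_real.
  have s20' := ltW s20.
  have h1 : s2 ^+ 2 <= 1 / 16.
    have -> : 1 / 16 = (1 / 4) ^+ 2 :> R by field.
    by rewrite lerXn2r ?nnegrE.
  have -> : (s2 / 2 * `|t| ^+ 2) ^+ 2 = s2 ^+ 2 * `|t| * (`|t| ^+ 3 / 4) by field.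
  have -> : `|t| ^+ 3 / 8 = 1 / 16 * 8 * (`|t| ^+ 3 / 4) by field.
  apply: ler_wpM2r; first by rewrite divr_ge0// exprn_ge0.
  by apply: ler_pM => //; exact: sqr_ge0.
have n1 : `|x * t| ^+ 3 <= `|t| ^+ 3.
  by rewrite lerXn2r ?nnegrE// normrM gtr0_norm// ler_piMl// ltW.
have n2 : `|(1 - x) * t| ^+ 3 <= `|t| ^+ 3.
  by rewrite lerXn2r ?nnegrE// normrM gtr0_norm ?subr_gt0// ler_piMl//; lra.
rewrite {}/s2 in sl e2 he *.
set E := expR _ in he *; set T := `|t| ^+ 3 in e2 n1 n2 *.
move: (cos (x * t)) (sin (x * t)) (cos ((1 - x) * t)) (sin ((1 - x) * t)) hc1 hc2 hs1 hs2.
move=> a b c d' h1 h2 h3 h4.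
have b1 : `|(1 - x) * a + x * c - E| <= T / 6 + T / 8.
  have -> : (1 - x) * a + x * c - E =
    ((1 - x) * (a - (1 - (x * t) ^+ 2 / 2)) + x * (c - (1 - ((1 - x) * t) ^+ 2 / 2)))
    - (E - (1 - x * (1 - x) / 2 * t ^+ 2)) by field.
  rewrite (le_trans (ler_normB _ _))// lerD//; last exact: (le_trans he).
  rewrite (le_trans (ler_normD _ _))// !normrM (gtr0_norm x0) (@gtr0_norm _ (1 - x)) ?subr_gt0//.
  have : (1 - x) * `|a - (1 - (x * t) ^+ 2 / 2)| <= (1 - x) * (T / 6).
    by rewrite ler_wpM2l ?subr_ge0 ?(ltW x1)//; lra.
  have : x * `|c - (1 - ((1 - x) * t) ^+ 2 / 2)| <= x * (T / 6).
    by rewrite ler_wpM2l ?(ltW x0)//; lra.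
  lra.
have b2 : `|(1 - x) * - b + x * d'| <= T / 6.
  have -> : (1 - x) * - b + x * d' = x * (d' - (1 - x) * t) - (1 - x) * (b - x * t) by ring.
  rewrite (le_trans (ler_normB _ _))// !normrM (gtr0_norm x0) (@gtr0_norm _ (1 - x)) ?subr_gt0//.
  have : (1 - x) * `|b - x * t| <= (1 - x) * (T / 6).
    by rewrite ler_wpM2l ?subr_ge0 ?(ltW x1)//; lra.
  have : x * `|d' - (1 - x) * t| <= x * (T / 6).
    by rewrite ler_wpM2l ?(ltW x0)//; lra.
  lra.
have T00 : 0 <= T by rewrite exprn_ge0.
lra.
Qed.

Lemma binomial_cf t n :
  bern_cf t ^+ n = \sum_(k < n.+1) (bernstein k n x)%:C%C * cis (k%:R * t).
Proof.
rewrite /bern_cf exprDn; apply: eq_bigr => k _.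
rewrite exprMn cisX -!rmorphXn/= mulrA -rmorphM/= -mulrnAl -rmorphMn/=.
by congr ((_)%:C%C * _); rewrite /bernstein -mulr_natl; ring.
Qed.

End bernoulli_characteristic_function.

(** * From characteristic functions to local limits *)

Section local_limit.
Context {R : realType}.
Notation mu := (@lebesgue_measure R).

Lemma is_derive_bigsum (I : Type) (s : seq I) (F f : I -> R -> R) (t : R) :
  (forall i, is_derive t (1 : R) (F i) (f i t)) ->
  is_derive t (1 : R) (fun u => \sum_(i <- s) F i u) (\sum_(i <- s) f i t).
Proof.
move=> dF; elim: s => [|i s IH].
  rewrite (_ : (fun _ => _) = cst 0) ?big_nil; first exact: is_derive_cst.
  by apply/funext => u; rewrite big_nil.
rewrite (_ : (fun _ => _) = (F i \+ fun u => \sum_(i <- s) F i u)) ?big_cons.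
  exact: is_deriveD.
by apply/funext => u; rewrite big_cons.
Qed.

Lemma sin_natpi n : sin (n%:R * pi) = 0 :> R.
Proof.
elim: n => [|n IH]; first by rewrite mul0r sin0.
by rewrite mulrSr mulrDl mul1r sinDpi IH oppr0.
Qed.

(** Orthogonality on a half period: a cosine of nonzero integer frequency integrates to 0 over
    [0, pi], because sin vanishes at integer multiples of pi. What survives is the total weight of
    the coincidences p = q. *)
Lemma Rintegral_cos_sum (I : finType) (beta : I -> R) (p q : I -> nat) :
  \int[mu]_(t in `[0, pi]) (\sum_i beta i * cos (((p i)%:R - (q i)%:R) * t)) =
  pi * \sum_(i | p i == q i) beta i.
Proof.
pose F i (t : R) := beta i * (if p i == q i then t
   else sin (((p i)%:R - (q i)%:R) * t) / ((p i)%:R - (q i)%:R)).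
have dFi i (t : R) : is_derive t (1 : R) (F i) (beta i * cos (((p i)%:R - (q i)%:R) * t)).
  rewrite /F; case: eqVneq => [->|pq].
    by rewrite subrr mul0r cos0; apply: is_derive_eq; rewrite /GRing.scale/=; ring.
  have pq0 : (p i)%:R - (q i)%:R != 0 :> R by rewrite subr_eq0 eqr_nat.
  by apply: is_derive_eq; rewrite /GRing.scale/=; field.
pose f (t : R) := \sum_i beta i * cos (((p i)%:R - (q i)%:R) * t).
have cf : continuous f.
  apply: continuous_big => [|i _ t]; first exact: add_continuous.
  apply: cvgM; first exact: cvg_cst.
  apply: continuous_comp; last exact: continuous_cos.
  by apply: cvgM; [exact: cvg_cst|exact: cvg_id].
have dF (t : R) : is_derive t (1 : R) (fun u => \sum_i F i u) (f t).
  by apply: (@is_derive_bigsum _ _ F (fun i t => beta i * cos (((p i)%:R - (q i)%:R) * t))).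
rewrite (segment_FTC2 (pi_gt0 R) cf dF) -sumrB mulr_sumr [RHS]big_mkcond; apply: eq_bigr => i _.
rewrite /F; case: ifPn => [_|pq]; first ring.
by rewrite mulr0 sin0 mulrBl sinB !sin_natpi !(mul0r, mulr0, subrr).
Qed.

(** [z] is the characteristic function of one step, and [chi] a factor independent of n for what the
    n steps leave over. Writing z^n chi - w^n = z^n (chi - 1) + (z^n - w^n), with w the Gaussian of
    one step, gives the errors C t and n C t^3 under a Gaussian weight. *)
Lemma llt_cvg (z chi : R -> R[i]) (h : nat -> R -> R) (l c C : R) :
  0 < c -> c <= l -> 0 <= C ->
  (forall n, continuous (h n)) ->
  (forall n t, h n t = complex.Re (z t ^+ n * chi t)) ->
  (forall t, 0 <= t <= pi ->
    [/\ normc (z t) <= expR (- (c * t ^+ 2)),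
        normc (z t - (expR (- (l * t ^+ 2)))%:C%C) <= C * t ^+ 3,
        normc (chi t) <= 1 & normc (chi t - 1) <= C * t]) ->
  Num.sqrt n%:R * \int[mu]_(t in `[0, pi]) h n t @[n --> \oo] -->
  Num.sqrt (pi / l) / 2.
Proof.
move=> c0 cl C0 ch hE hz; have l0 : 0 < l by exact: lt_le_trans cl.
apply: (@laplace_cvg _ l (c / 2) C) => //; first by rewrite divr_gt0.
move=> [//|n] t n1 t0; have [z1 z2 x1 x2] := hz _ t0.
case/andP: t0 => t0 _.
rewrite hE; set w := (expR (- (l * t ^+ 2)))%:C%C in z2.
have -> : expR (- (l * n.+1%:R * t ^+ 2)) = complex.Re (w ^+ n.+1).
  rewrite /w -rmorphXn/= -expRM_natr; congr expR; ring.
have -> : complex.Re (z t ^+ n.+1 * chi t) - complex.Re (w ^+ n.+1) =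
    complex.Re (z t ^+ n.+1 * chi t - w ^+ n.+1).
  by case: (_ * _) => ? ?; case: (_ ^+ _).
apply: (le_trans (ler_Re_normc _)).
have -> : z t ^+ n.+1 * chi t - w ^+ n.+1 =
  z t ^+ n.+1 * (chi t - 1) + (z t ^+ n.+1 - w ^+ n.+1) by ring.
apply: (le_trans (ler_normcD _ _)); rewrite normcM normcX.
set M := expR (- (c * t ^+ 2)) in z1.
have M0 : 0 <= M by exact: expR_ge0.
have wM : normc w <= M.
  rewrite normc_real ger0_norm ?expR_ge0// ler_expR lerN2.
  by apply: ler_wpM2r => //; exact: sqr_ge0.
(* Telescoping loses one factor out of n + 1. Since n + 1 <= 2 n, half of the exponent remains,
   whence the rate c / 2. *)
have Mn : M ^+ n <= expR (- (c / 2 * n.+1%:R * t ^+ 2)).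
  rewrite -expRM_natr ler_expR.
  have n2 : n.+1%:R <= n%:R * 2 :> R by rewrite -natrM ler_nat; lia.
  have ct : 0 <= c * t ^+ 2 by rewrite mulr_ge0 ?sqr_ge0// ltW.
  have : c * t ^+ 2 * n.+1%:R <= c * t ^+ 2 * (n%:R * 2) by rewrite ler_wpM2l.
  lra.
have MSn : M ^+ n.+1 <= expR (- (c / 2 * n.+1%:R * t ^+ 2)).
  apply: le_trans Mn; rewrite exprSr ler_piMr ?exprn_ge0//.
  by rewrite -expR0 ler_expR oppr_le0 mulr_ge0 ?sqr_ge0// ltW.
set E := expR _ in Mn MSn *; have E0 : 0 <= E by exact: expR_ge0.
have h1 : normc (z t) ^+ n.+1 * normc (chi t - 1) <= E * (C * t).
  apply: ler_pM; rewrite ?exprn_ge0 ?normc_ge0//.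
  by apply: le_trans MSn; rewrite lerXn2r ?nnegrE ?normc_ge0.
have h2 : normc (z t ^+ n.+1 - w ^+ n.+1) <= n.+1%:R * E * (C * t ^+ 3).
  apply: (le_trans (normc_exp_sub_le _ z1 wM)).
  by apply: ler_pM; rewrite ?mulr_ge0 ?exprn_ge0 ?normc_ge0// ler_wpM2l.
apply: (le_trans (lerD h1 h2)); lra.
Qed.

Lemma Re_sum (I : finType) (g : I -> R[i]) :
  complex.Re (\sum_i g i) = \sum_i complex.Re (g i).
Proof.
apply: (big_morph (@complex.Re R)) => //.
by move=> [a b] [a' b'].
Qed.

(** The factor 1 / pi comes from Fourier inversion. The Gaussian exponent x (1 - x) is half the
    variance of the difference of two independent trials. *)
Lemma psi_sqrtE (x : R) : 0 < x < 1 ->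
  pi^-1 * (Num.sqrt (pi / (x * (1 - x))) / 2) = psi x.
Proof.
move=> /andP[x0 x1]; have s0 : 0 < x * (1 - x) by rewrite mulr_gt0// subr_gt0.
have pi0 := @pi_gt0 R.
move: s0; have -> : psi x = (Num.sqrt (2 ^+ 2 * (pi * (x * (1 - x)))))^-1.
  by rewrite /psi; congr (Num.sqrt _)^-1; ring.
move: (x * (1 - x)) => s s0.
have -> : Num.sqrt (2 ^+ 2 * (pi * s)) = 2 * Num.sqrt (pi * s).
  by rewrite sqrtrM ?sqr_ge0// sqrtr_sqr gtr0_norm.
move: (@pi R) pi0 => p pi0.
have K : p^-1 * Num.sqrt (p / s) = (Num.sqrt (p * s))^-1.
  rewrite -[p^-1]gtr0_norm ?invr_gt0// -sqrtr_sqr -sqrtrM ?sqr_ge0//.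
  rewrite -sqrtrV ?mulr_ge0 ?(ltW pi0) ?(ltW s0)//; congr Num.sqrt; field.
  by rewrite !gt_eqF.
by rewrite mulrA K invfM mulrC.
Qed.

End local_limit.

(** * Collision probabilities of independent binomial variables *)

Section binomial_collisions.
Context {R : realType}.
Notation mu := (@lebesgue_measure R).
Variable x : R.
Hypothesis x01 : 0 < x < 1.
Let s2 := x * (1 - x).
Let s20 : 0 < s2.
Proof. by rewrite /s2; case/andP: x01 => ? ?; rewrite mulr_gt0// subr_gt0. Qed.

Lemma continuous_cos_sum (I : finType) (beta d : I -> R) :
  continuous (fun t : R => \sum_i beta i * cos (d i * t)).
Proof.
apply: continuous_big => [|i _ t]; first exact: add_continuous.
apply: cvgM; first exact: cvg_cst.
apply: continuous_comp; last exact: continuous_cos.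
by apply: cvgM; [exact: cvg_cst|exact: cvg_id].
Qed.

Let cos_sumE (I J : finType) (b : I -> R) (b' : J -> R) (p : I -> R) (q : J -> R) (t : R) :
  complex.Re ((\sum_i (b i)%:C%C * cis (p i * t)) * (\sum_j (b' j)%:C%C * cis (q j * t))) =
  \sum_(k : I * J) b k.1 * b' k.2 * cos ((p k.1 + q k.2) * t).
Proof.
rewrite big_distrlr/= pair_big/= Re_sum; apply: eq_bigr => -[i j] _ /=.
by rewrite [(p i + q j) * t]mulrDl cosD; ring.
Qed.

Let sum_pairs (I J : finType) (b : I -> R) (b' : J -> R) (p : I -> J) (P : I -> J -> bool) :
  (forall i j, P i j = (j == p i)) ->
  \sum_(k : I * J | P k.1 k.2) b k.1 * b' k.2 = \sum_i b i * b' (p i).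
Proof.
move=> hP; rewrite -(pair_big_dep xpredT P (fun i j => b i * b' j))/=.
apply: eq_bigr => i _; rewrite (eq_bigl (pred1 (p i))); last by move=> j; rewrite hP.
by rewrite big_pred1_eq.
Qed.

Let normc_bern_cf_le1 (t : R) : normc (bern_cf x t) <= 1.
Proof.
by rewrite bern_cfE normcM normc_cis mul1r; apply: normc_cbern_cf_le1.
Qed.

Let cf_gauss (a t : R) : `|a| <= 2 -> 0 <= t <= pi ->
  normc (cbern_cf x (a * t) - (expR (- (s2 / 2 * (a * t) ^+ 2)))%:C%C) <= 8 * t ^+ 3.
Proof.
move=> a2 /andP[t0 tpi].
have t4 : t <= 4 by have := @pihalf_lt2 R; lra.
have at2 : `|a * t| <= 2 * t by rewrite normrM (ger0_norm t0) ler_wpM2r.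
apply: (le_trans (cbern_cf_gauss _ _)) => //; first lra.
have -> : 8 * t ^+ 3 = (2 * t) ^+ 3 by ring.
by rewrite lerXn2r ?nnegrE// mulr_ge0.
Qed.

Let normc_gauss_le1 (y : R) : 0 <= y -> normc ((expR (- y))%:C%C : R[i]) <= 1.
Proof.
by move=> y0; rewrite normc_real ger0_norm ?expR_ge0// -expR0 ler_expR oppr_le0.
Qed.

Let expE2 (a b y : R) : a + b = y ->
  (expR (- y))%:C%C = (expR (- a))%:C%C * (expR (- b))%:C%C :> R[i].
Proof. by move=> <-; rewrite -rmorphM/= -expRD opprD. Qed.

(** The sum is the probability that two independent binomial (n, x) variables agree. In the
    characteristic function of their difference the drifts [cis (x * t)] and [cis (- (x * t))]
    cancel, which lets the centred functions take over. The constant 16 is 8 for each of the two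
    factors. *)
Lemma sum_sqr_bernstein_cvg :
  Num.sqrt n%:R * \sum_(k < n.+1) bernstein k n x ^+ 2 @[n --> \oo] --> psi x.
Proof.
pose h n (t : R) := \sum_(k : 'I_n.+1 * 'I_n.+1)
  bernstein k.1 n x * bernstein k.2 n x * cos ((k.1%:R - k.2%:R) * t).
have -> : (fun n => Num.sqrt n%:R * \sum_(k < n.+1) bernstein k n x ^+ 2) =
    (fun n => pi^-1 * (Num.sqrt n%:R * \int[mu]_(t in `[0, pi]) h n t)).
  apply/funext => n; rewrite mulrCA; congr (_ * _).
  rewrite (@Rintegral_cos_sum _ _ _ (fun k => nat_of_ord k.1) (fun k => nat_of_ord k.2)).
  rewrite mulKf ?gt_eqF ?pi_gt0//.
  rewrite (sum_pairs (fun k : 'I_n.+1 => bernstein k n x) (fun k : 'I_n.+1 => bernstein k n x)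
     (p := id) (P := fun i j => nat_of_ord i == j)).
    by apply: eq_bigr => k _; rewrite expr2.
  by move=> i j; rewrite eq_sym.
rewrite -psi_sqrtE//; apply: cvgM; first exact: cvg_cst.
apply: (@llt_cvg _ (fun t => cbern_cf x t * cbern_cf x (- t)) (fun=> 1) _ _
  (s2 / 24) 16) => //.
- by rewrite divr_gt0.
- by rewrite -/s2; have := s20; lra.
- by move=> n; exact: continuous_cos_sum.
- move=> n t; have -> : cbern_cf x t * cbern_cf x (- t) = bern_cf x t * bern_cf x (- t).
    rewrite !bern_cfE mulrACA -cisD mulrN subrr cis0 mul1r //.
  rewrite mulr1 exprMn !binomial_cf -/s2.
  under [X in _ * X]eq_bigr do rewrite mulrN -mulNr.
  by rewrite cos_sumE; apply: eq_bigr.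
- move=> t t0; split.
  + rewrite normcM; apply: le_trans (sqr_normc_cbern_cf_le x01 t0).
    suff -> : normc (cbern_cf x (- t)) = normc (cbern_cf x t) by rewrite expr2.
    apply/eqP; rewrite -(@eqrXn2 _ 2) ?normc_ge0//.
    by rewrite !sqr_normc_cbern_cf cosN.
  + rewrite -/s2 (@expE2 (s2 / 2 * (1 * t) ^+ 2) (s2 / 2 * (- 1 * t) ^+ 2)); last by field.
    have h1 := @cf_gauss 1 t; have h2 := @cf_gauss (- 1) t.
    rewrite ?normrN normr1 ler1n mulN1r mul1r in h1 h2 *.
    rewrite (le_trans (normc_mul_sub_le _ _ _ _))//.
    * exact: normc_cbern_cf_le1.
    * by apply: normc_gauss_le1; rewrite mulr_ge0 ?sqr_ge0// divr_ge0// ltW.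
    * by have := h1 isT t0; have := h2 isT t0; lra.
  + by rewrite normc1.
  + by rewrite subrr normc0 mulr_ge0//; case/andP: t0.
Qed.

(** The sum is the probability that K = 2 J + e for independent K binomial (2 n + 1, x) and J
    binomial (n, x). One step pairs two trials of K with one of J scaled by - 2: the variance is (2
    + 4) s2 and the Gaussian exponent 3 s2, hence sqrt 3, and the drifts cancel because 1 + 1 - 2 =
    0. The remaining trial of K and the parity e form [chi], so the limit is the same for both
    parities. The constant 24 is 8 for each of the three factors. *)
Lemma sum_bernstein_half_cvg (e : bool) :
  Num.sqrt n%:R * \sum_(j < n.+1) bernstein j n x * bernstein (j.*2 + e) n.*2.+1 x
    @[n --> \oo] --> psi x / Num.sqrt 3.
Proof.
pose h n (t : R) := \sum_(k : 'I_n.+1 * 'I_n.*2.+2)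
  bernstein k.1 n x * bernstein k.2 n.*2.+1 x * cos ((k.2%:R - (k.1.*2 + e)%:R) * t).
have -> : (fun n => Num.sqrt n%:R * \sum_(j < n.+1) bernstein j n x * bernstein (j.*2 + e) n.*2.+1 x) =
    (fun n => pi^-1 * (Num.sqrt n%:R * \int[mu]_(t in `[0, pi]) h n t)).
  apply/funext => n; rewrite mulrCA; congr (_ * _).
  rewrite (@Rintegral_cos_sum _ _ _ (fun k => nat_of_ord k.2)
    (fun k : 'I_n.+1 * 'I_n.*2.+2 => (k.1.*2 + e)%N)).
  rewrite mulKf ?gt_eqF ?pi_gt0//.
  have hp (j : 'I_n.+1) : (j.*2 + e < n.*2.+2)%N by have := ltn_ord j; have := leq_b1 e; lia.
  rewrite (sum_pairs (fun k : 'I_n.+1 => bernstein k n x) (fun k : 'I_n.*2.+2 => bernstein k n.*2.+1 x)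
     (p := fun j => Ordinal (hp j)) (P := fun i j => nat_of_ord j == i.*2 + e)%N)//.
have -> : psi x / Num.sqrt 3 = pi^-1 * (Num.sqrt (pi / (3 * s2)) / 2).
  rewrite -psi_sqrtE// -/s2 -!mulrA; congr (_ * _).
  rewrite [RHS]mulrC [LHS]mulrC -mulrA; congr (_ * _).
  rewrite -sqrtrV// -sqrtrM ?invr_ge0//; congr Num.sqrt.
  by rewrite [in RHS]invfM mulrCA.
apply: cvgM; first exact: cvg_cst.
apply: (@llt_cvg _ (fun t => (cbern_cf x t * cbern_cf x t) * cbern_cf x (- 2 * t))
  (fun t => bern_cf x t * cis (- e%:R * t)) _ _ (s2 / 24) 24) => //.
- by rewrite divr_gt0.
- by have := s20; lra.
- by move=> n; exact: continuous_cos_sum.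
- move=> n t.
  have -> : cbern_cf x t * cbern_cf x t * cbern_cf x (- 2 * t) =
      bern_cf x t * bern_cf x t * bern_cf x (- 2 * t).
    rewrite !bern_cfE.
    have h0 : cis (x * t) * cis (x * t) * cis (x * (- 2 * t)) = 1.
      by rewrite -!cisD -[RHS](@cis0 R); congr cis; ring.
    by rewrite -[LHS]mul1r -h0; ring.
  have -> : (bern_cf x t * bern_cf x t * bern_cf x (- 2 * t)) ^+ n *
      (bern_cf x t * cis (- e%:R * t)) =
    (bern_cf x (- 2 * t) ^+ n * cis (- e%:R * t)) * bern_cf x t ^+ n.*2.+1.
    by rewrite !exprMn exprS -addnn exprD; ring.
  rewrite !binomial_cf mulr_suml.
  under [X in X * _]eq_bigr => j _ do rewrite -mulrA -cisD mulrA -mulrDl.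
  rewrite cos_sumE; apply: eq_bigr => -[j k] _ /=; congr (_ * cos (_ * t)).
  have -> : (j.*2 + e)%:R = 2 * j%:R + e%:R :> R by rewrite natrD -mul2n natrM.
  by ring.
- move=> t t01; have /andP[t0 _] := t01; split.
  + rewrite normcM normcM -expr2.
    apply: le_trans (sqr_normc_cbern_cf_le x01 t01).
    by rewrite ler_piMr ?sqr_ge0// normc_cbern_cf_le1.
  + rewrite (@expE2 (s2 / 2 * (1 * t) ^+ 2 + s2 / 2 * (1 * t) ^+ 2) (s2 / 2 * (- 2 * t) ^+ 2));
      last by field.
    rewrite (@expE2 (s2 / 2 * (1 * t) ^+ 2) (s2 / 2 * (1 * t) ^+ 2)) //.
    have h1 := @cf_gauss 1 t; have h2 := @cf_gauss (- 2) t.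
    rewrite normrN normr_nat lexx in h2; rewrite normr1 ler1n mul1r in h1 *.
    have g1 y : normc (expR (- (s2 / 2 * y ^+ 2)))%:C%C <= 1.
      by apply: normc_gauss_le1; rewrite mulr_ge0 ?sqr_ge0// divr_ge0// ltW.
    rewrite (le_trans (normc_mul_sub_le _ _ _ _))//.
    * by rewrite normcM mulr_ile1 ?normc_ge0 ?normc_cbern_cf_le1.
    * have := h1 isT t01; have := h2 isT t01.
      have := normc_mul_sub_le (cbern_cf x t) ((expR (- (s2 / 2 * t ^+ 2)))%:C%C)
        (normc_cbern_cf_le1 x01 t) (g1 t).
      lra.
  + by rewrite normcM normc_cis mulr1.
  + have -> : bern_cf x t * cis (- e%:R * t) - 1 =
      (bern_cf x t - 1) * cis (- e%:R * t) + (cis (- e%:R * t) - 1) by ring.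
    apply: (le_trans (ler_normcD _ _)); rewrite normcM normc_cis mulr1.
    have h1 := normc_cis_sub1 (- e%:R * t); have h2 := normc_cis_sub1 t.
    have e1 : `|- e%:R * t| <= t.
      by rewrite normrM normrN normr_nat (ger0_norm t0) ler_piMl// lern1; case: (e).
    have -> : bern_cf x t - 1 = (x%:C)%C * (cis t - 1).
      by rewrite /bern_cf rmorphB/=; ring.
    rewrite normcM normc_real; have [x0 x1] := andP x01.
    rewrite (gtr0_norm x0) (ger0_norm t0) in h2 *.
    have : x * normc (cis t - 1) <= 1 * (2 * t).
      by apply: ler_pM; rewrite ?normc_ge0 ?(ltW x0) ?(ltW x1).
    lra.
Qed.

End binomial_collisions.

(** * Binomial moments and cell masses *)

Section binomial_moments.
Context {R : realType}.
Variable x : R.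

Lemma bernsteinSS k n : (k <= n)%N ->
  bernstein k.+1 n.+1 x = (1 - x) * bernstein k.+1 n x + x * bernstein k n x.
Proof.
rewrite leq_eqVlt /bernstein => /predU1P[->|kn].
  by rewrite !binn bin_small// !subnn !expr0 exprS; ring.
rewrite subSS binS natrD -(subnSK kn) !exprS; ring.
Qed.

Lemma bernstein0S n : bernstein 0 n.+1 x = (1 - x) * bernstein 0 n x.
Proof. by rewrite /bernstein !bin0 !subn0 exprS; ring. Qed.

Lemma bernstein_small k n : (n < k)%N -> bernstein k n x = 0.
Proof. by move=> nk; rewrite /bernstein bin_small// !mul0r. Qed.

(** Conditioning on the last trial. *)
Lemma bernstein_sumS n (g : nat -> R) :
  \sum_(k < n.+2) bernstein k n.+1 x * g k =
  \sum_(k < n.+1) bernstein k n x * ((1 - x) * g k + x * g k.+1).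
Proof.
rewrite big_ord_recl bernstein0S/=.
under eq_bigr => k _ do rewrite /bump /= add1n bernsteinSS ?(leq_ord k)// mulrDl.
rewrite big_split/= addrA.
under [RHS]eq_bigr do rewrite mulrDr.
rewrite [RHS]big_split/=; congr (_ + _); last by apply: eq_bigr => k _; ring.
rewrite [RHS]big_ord_recl/=; congr (_ + _); first ring.
rewrite big_ord_recr/= bernstein_small// mulr0 mul0r addr0.
by apply: eq_bigr => k _; rewrite /bump/= add1n; ring.
Qed.

Definition bern_cmom s n : R := \sum_(k < n.+1) bernstein k n x * (k%:R - n%:R * x) ^+ s.

(** A further trial adds an independent centred variable with values - x and 1 - x, whose i-th
    moment is (1 - x)(- x)^i + x (1 - x)^i. The closed forms below follow by induction on n, each
    order using the lower ones. *)
Lemma bern_cmomS s n : bern_cmom s n.+1 =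
  \sum_(i < s.+1) 'C(s, i)%:R * bern_cmom (s - i) n *
    ((1 - x) * (- x) ^+ i + x * (1 - x) ^+ i).
Proof.
rewrite /bern_cmom (bernstein_sumS _ (fun k => (k%:R - n.+1%:R * x) ^+ s)).
rewrite (eq_bigr (fun k : 'I_n.+1 => \sum_(i < s.+1) 'C(s, i)%:R *
   (bernstein k n x * (k%:R - n%:R * x) ^+ (s - i)) *
   ((1 - x) * (- x) ^+ i + x * (1 - x) ^+ i))).
  rewrite exchange_big/=; apply: eq_bigr => i _.
  by rewrite -mulr_suml -mulr_sumr.
move=> k _.
have -> : k%:R - n.+1%:R * x = (k%:R - n%:R * x) + - x by rewrite -natr1; ring.
have -> : k.+1%:R - n.+1%:R * x = (k%:R - n%:R * x) + (1 - x).
  by rewrite -!natr1; ring.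
rewrite !exprDn !mulr_sumr -big_split/= mulr_sumr; apply: eq_bigr => i _.
by rewrite -[(_ * (- x) ^+ i) *+ _]mulr_natl -[(_ * (1 - x) ^+ i) *+ _]mulr_natl; ring.
Qed.

Lemma bern_cmom0 s : bern_cmom s 0 = (s == 0%N)%:R.
Proof.
rewrite /bern_cmom big_ord1 /bernstein !expr0 bin0 mul0r subrr expr0n !mul1r//.
Qed.

Let s2 := x * (1 - x).
Let u := 1 - 2 * x.

Ltac cmom_step := rewrite bern_cmomS !big_ord_recl big_ord0 /= /bump /=.

Lemma bern_cmomE_0 n : bern_cmom 0 n = 1.
Proof.
elim: n => [|n IH]; first by rewrite bern_cmom0.
by cmom_step; rewrite !IH !expr0 bin0; ring.
Qed.

Lemma bern_cmomE_1 n : bern_cmom 1 n = 0.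
Proof.
elim: n => [|n IH]; first by rewrite bern_cmom0.
by cmom_step; rewrite !addn0 ?subn0 ?subnn IH bern_cmomE_0 !bin0 !binn; ring.
Qed.

Lemma bern_cmomE_2 n : bern_cmom 2 n = n%:R * s2.
Proof.
elim: n => [|n IH]; first by rewrite bern_cmom0 mul0r.
cmom_step; rewrite !subSS !subn0 IH bern_cmomE_1 bern_cmomE_0 /s2 -natr1.
by rewrite /binomial/=; ring.
Qed.

Lemma bern_cmomE_3 n : bern_cmom 3 n = n%:R * (s2 * u).
Proof.
elim: n => [|n IH]; first by rewrite bern_cmom0 mul0r.
cmom_step; rewrite !subSS !subn0 IH bern_cmomE_2 bern_cmomE_1 bern_cmomE_0 /s2 /u -natr1.
by rewrite /binomial/=; ring.
Qed.

Lemma bern_cmomE_4 n :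
  bern_cmom 4 n = 3 * s2 ^+ 2 * n%:R ^+ 2 + s2 * (1 - 6 * s2) * n%:R.
Proof.
elim: n => [|n IH]; first by rewrite bern_cmom0/=; ring.
cmom_step; rewrite !subSS !subn0 IH bern_cmomE_3 bern_cmomE_2 bern_cmomE_1 bern_cmomE_0.
by rewrite /s2 /u -natr1 /binomial/=; ring.
Qed.

Lemma bern_cmomE_5 n :
  bern_cmom 5 n = u * (10 * s2 ^+ 2 * n%:R ^+ 2 + s2 * (1 - 12 * s2) * n%:R).
Proof.
elim: n => [|n IH]; first by rewrite bern_cmom0/=; ring.
cmom_step; rewrite !subSS !subn0 IH bern_cmomE_4 bern_cmomE_3 bern_cmomE_2 bern_cmomE_1 bern_cmomE_0.
by rewrite /s2 /u -natr1 /binomial/=; ring.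
Qed.

Lemma bern_cmomE_6 n :
  bern_cmom 6 n = 15 * s2 ^+ 3 * n%:R ^+ 3 + 5 * s2 ^+ 2 * (5 - 26 * s2) * n%:R ^+ 2 +
   s2 * (1 - 30 * s2 * (1 - 4 * s2)) * n%:R.
Proof.
elim: n => [|n IH]; first by rewrite bern_cmom0/=; ring.
cmom_step; rewrite !subSS !subn0 IH bern_cmomE_5 bern_cmomE_4 bern_cmomE_3.
rewrite bern_cmomE_2 bern_cmomE_1 bern_cmomE_0.
by rewrite /s2 /u -natr1 /binomial/=; ring.
Qed.

End binomial_moments.

(** * Moments of a binomial point smoothed over one cell *)

Section bernstein_cells.
Context {R : realType}.
Variable x : R.
Let s2 := x * (1 - x).
Let u := 1 - 2 * x.
(** For i > 0, [k_ i / i] is the mean of (U - x)^(i - 1) with U uniform on [0, 1]. *)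
Let k_ i := (1 - x) ^+ i - (- x) ^+ i.

(* [bern_cell j n / n.+1%:R ^+ j] is the expectation of ((K + U) / n.+1 - x)^j
   for K binomial (n, x) and U uniform on [0, 1], independent of K. *)
Definition bern_cell j n : R := j.+1%:R^-1 *
  \sum_(k < n.+1) bernstein k n x *
    ((k.+1%:R - n.+1%:R * x) ^+ j.+1 - (k%:R - n.+1%:R * x) ^+ j.+1).

(** Binomial expansion around k - n x. As [k_ 0] vanishes, the central moment of order j + 1 drops
    out, which is why the closed forms above stop at order 6. *)
Lemma bern_cellE j n : bern_cell j n = j.+1%:R^-1 *
  \sum_(i < j.+2) 'C(j.+1, i)%:R * bern_cmom x (j.+1 - i) n * k_ i.
Proof.
rewrite /bern_cell; congr (_ * _).
rewrite (eq_bigr (fun k : 'I_n.+1 => \sum_(i < j.+2) 'C(j.+1, i)%:R *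
   (bernstein k n x * (k%:R - n%:R * x) ^+ (j.+1 - i)) * k_ i)).
  rewrite exchange_big/=; apply: eq_bigr => i _.
  by rewrite -mulr_suml -mulr_sumr.
move=> k _.
have -> : k%:R - n.+1%:R * x = (k%:R - n%:R * x) + - x by rewrite -natr1; ring.
have -> : k.+1%:R - n.+1%:R * x = (k%:R - n%:R * x) + (1 - x).
  by rewrite -!natr1; ring.
rewrite !exprDn -sumrB mulr_sumr; apply: eq_bigr => i _.
by rewrite /k_ -[(_ * (- x) ^+ i) *+ _]mulr_natl -[(_ * (1 - x) ^+ i) *+ _]mulr_natl; ring.
Qed.

Ltac cell_expand := rewrite bern_cellE !big_ord_recl big_ord0 /= /bump /=
  ?subSS ?subn0 ?addn0 ?add1n ?subnn ?bern_cmomE_6 ?bern_cmomE_5 ?bern_cmomE_4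
  ?bern_cmomE_3 ?bern_cmomE_2 ?bern_cmomE_1 ?bern_cmomE_0 /k_ /s2 /u /binomial /=.

Lemma bern_cellE_0 n : bern_cell 0 n = 1.
Proof. by cell_expand; rewrite invr1; ring. Qed.

Lemma bern_cellE_1 n : bern_cell 1 n = 2^-1 - x.
Proof. by cell_expand; field. Qed.

Lemma bern_cellE_2 n : bern_cell 2 n = s2 * n%:R + (1 - 3 * x + 3 * x ^+ 2) / 3.
Proof. by cell_expand; field. Qed.

Lemma bern_cellE_3 n : bern_cell 3 n = 5 / 2 * s2 * u * n%:R + k_ 4 / 4.
Proof. by cell_expand; field. Qed.

Lemma bern_cellE_4 n : bern_cell 4 n = 3 * s2 ^+ 2 * n%:R ^+ 2 +
  (s2 * (1 - 6 * s2) + 2 * s2 * u ^+ 2 + 2 * s2 * k_ 3) * n%:R + k_ 5 / 5.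
Proof. by cell_expand; field. Qed.

(** What matters is the degree 3 in n: against (n + 1)^6 it leaves a contribution of order n^-3. *)
Lemma bern_cellE_6 : exists p q : R * R,
  forall n, bern_cell 6 n = p.1 * n%:R ^+ 3 + p.2 * n%:R ^+ 2 + q.1 * n%:R + q.2.
Proof.
exists (15 * s2 ^+ 3, 5 * s2 ^+ 2 * (5 - 26 * s2) + 30 * s2 ^+ 2 * u * u + 15 * s2 ^+ 2 * k_ 3).
exists (s2 * (1 - 30 * s2 * (1 - 4 * s2)) + 3 * u * u * (s2 * (1 - 12 * s2)) +
  5 * s2 * (1 - 6 * s2) * k_ 3 + 5 * s2 * u * k_ 4 + 3 * s2 * k_ 5, k_ 7 / 7).
by move=> n; cell_expand; field.
Qed.

End bernstein_cells.

(* The law of an observation enters only through the masses it gives to cells: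
   [cell a b] stands for the integral of [f] over ]a, b]. *)
Definition cell_integral (R : realType) (f : R -> R) (cell : R -> R -> R) :=
  forall (a b : R) (g G : R -> R), a < b -> 0 <= a -> b <= 1 ->
    continuous g -> (forall y : R, is_derive y (1 : R) G (g y)) ->
    ((forall y, a <= y <= b -> f y <= g y) -> cell a b <= G b - G a) /\
    ((forall y, a <= y <= b -> g y <= f y) -> G b - G a <= cell a b).

(** * Mean of T_m up to second order *)

Section cell_mean.
Context {R : realType}.
Variables (x : R) (f : R -> R) (cell : R -> R -> R).
Hypothesis x01 : 0 < x < 1.
Hypothesis hcell : cell_integral f cell.

Definition cell_mean m : R := m%:R *
  \sum_(k < m) cell (k%:R / m%:R) (k.+1%:R / m%:R) * bernstein k m.-1 x.

Let s2 := x * (1 - x).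
Let u := 1 - 2 * x.

Lemma bernstein_ge0 k n : 0 <= bernstein k n x.
Proof.
case/andP: x01 => x0 x1; rewrite /bernstein mulr_ge0 ?exprn_ge0 ?subr_ge0 ?(ltW x1)//.
by rewrite mulr_ge0 ?exprn_ge0// ltW.
Qed.

(** Mean of [cell_poly_fun c] at the point (K + U) / (n + 1), with K and U as in [bern_cell]. *)
Definition cell_poly (c : nat -> R) (n : nat) : R :=
  \sum_(j < 7) c j * (bern_cell x j n / n.+1%:R ^+ j).

Definition cell_poly_fun (c : nat -> R) (y : R) := \sum_(j < 7) c j * (y - x) ^+ j.

Let P := cell_poly_fun.
Let G (c : nat -> R) (y : R) := \sum_(j < 7) c j * ((y - x) ^+ j.+1 / j.+1%:R).

Let cP c : continuous (P c).
Proof.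
apply: continuous_big => [|i _ t]; first exact: add_continuous.
apply: cvgM; first exact: cvg_cst.
apply: (@continuous_comp _ _ _ (fun y : R => y - x) (fun z => z ^+ i)).
  by apply: cvgB; [exact: cvg_id|exact: cvg_cst].
exact: exprn_continuous.
Qed.

Let dG c (y : R) : is_derive y (1 : R) (G c) (P c y).
Proof.
apply: (@is_derive_bigsum _ _ _ (fun (j : 'I_7) y => c j * ((y - x) ^+ j.+1 / j.+1%:R))
  (fun (j : 'I_7) y => c j * (y - x) ^+ j)) => j.
move: (nat_of_ord j) => i {j}.
have d1 : is_derive y (1 : R) (fun y0 : R => y0 - x) 1.
  by apply: is_derive_eq; rewrite subr0.
have d2 : is_derive y (1 : R) (fun y0 : R => (y0 - x) ^+ i.+1) (i.+1%:R * (y - x) ^+ i).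
  by have := is_deriveX i.+1 d1; rewrite exprfctE [_ *: _]mulr1.
apply: is_derive_eq; rewrite /GRing.scale/=; field.
by rewrite ?nat1r ?natr1 pnatr_eq0.
Qed.

Let cell_polyE c n : n.+1%:R * \sum_(k < n.+1)
  (G c (k.+1%:R / n.+1%:R) - G c (k%:R / n.+1%:R)) * bernstein k n x = cell_poly c n.
Proof.
have n0 : n.+1%:R != 0 :> R by rewrite pnatr_eq0.
rewrite /G /cell_poly.
under eq_bigr => k _ do rewrite -sumrB mulr_suml.
rewrite exchange_big/= mulr_sumr; apply: eq_bigr => j _.
rewrite /bern_cell !mulr_sumr mulr_suml mulr_sumr; apply: eq_bigr => k _.
have E (t : R) : t / n.+1%:R - x = (t - n.+1%:R * x) / n.+1%:R by field.
rewrite !E !exprMn !exprVn [n.+1%:R ^+ j.+1]exprS.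
have j0 : j.+1%:R != 0 :> R by rewrite pnatr_eq0.
have nj : n.+1%:R ^+ j != 0 :> R by rewrite expf_neq0.
move: (n.+1%:R : R) (n.+1%:R ^+ j) (j.+1%:R) nj j0 n0 => m a b nj j0 n0.
by field; rewrite n0 j0 nj.
Qed.

Let cell_range n (k : 'I_n.+1) : [/\ k%:R / n.+1%:R < k.+1%:R / n.+1%:R :> R,
  0 <= k%:R / n.+1%:R :> R & k.+1%:R / n.+1%:R <= 1 :> R].
Proof.
split.
- by rewrite ltr_pM2r ?invr_gt0 ?ltr0n// ltr_nat.
- by rewrite divr_ge0.
- by rewrite ler_pdivrMr ?ltr0n// mul1r ler_nat.
Qed.

Lemma cell_mean_le c n : (forall y, 0 <= y <= 1 -> f y <= P c y) ->
  cell_mean n.+1 <= cell_poly c n.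
Proof.
move=> fP; rewrite -cell_polyE /cell_mean ler_wpM2l//; apply: ler_sum => k _.
have [h1 h2 h3] := cell_range k; apply: ler_wpM2r; first exact: bernstein_ge0.
apply: (hcell h1 h2 h3 (@cP c) (@dG c)).1 => y /andP[y1 y2]; apply: fP.
by rewrite (le_trans h2 y1) (le_trans y2 h3).
Qed.

Lemma cell_mean_ge c n : (forall y, 0 <= y <= 1 -> P c y <= f y) ->
  cell_poly c n <= cell_mean n.+1.
Proof.
move=> fP; rewrite -cell_polyE /cell_mean ler_wpM2l//; apply: ler_sum => k _.
have [h1 h2 h3] := cell_range k; apply: ler_wpM2r; first exact: bernstein_ge0.
apply: (hcell h1 h2 h3 (@cP c) (@dG c)).2 => y /andP[y1 y2]; apply: fP.
by rewrite (le_trans h2 y1) (le_trans y2 h3).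
Qed.

(** Coefficient of m^-2, for m = n + 1, in the mean of a polynomial with coefficients c_j in powers
    of y - x. The term - s2 comes from s2 n = s2 m - s2 in the second moment. At c_j = f^(j)(x) / j!
    the formula becomes Delta_2. *)
Definition second_order (c2 c3 c4 : R) : R :=
  c2 * ((1 - 3 * x + 3 * x ^+ 2) / 3 - s2) + c3 * (5 / 2 * s2 * u) + c4 * (3 * s2 ^+ 2).

Definition first_order (c1 c2 : R) : R := c1 * (2^-1 - x) + c2 * s2.

Lemma cvg_ratioSn : n%:R / n.+1%:R @[n --> \oo] --> (1 : R).
Proof.
have h : 1 - n.+1%:R^-1 @[n --> \oo] --> (1 - 0 : R).
  by apply: cvgB; [exact: cvg_cst|exact: cvg_harmonic].
move: h; rewrite subr0; apply: cvg_trans; apply: near_eq_cvg.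
by near=> n; rewrite -natr1; field; rewrite natr1 pnatr_eq0.
Unshelve. all: by end_near. Qed.

(** The bounding polynomials have no fifth power, and the sixth contributes O(1 / n) after scaling,
    so [c 6] does not enter the limit. *)
Lemma cell_poly_cvg (c : nat -> R) : c 5 = 0 ->
  n.+1%:R ^+ 2 * (cell_poly c n - c 0%N - first_order (c 1%N) (c 2) / n.+1%:R)
    @[n --> \oo] --> second_order (c 2) (c 3) (c 4).
Proof.
move=> c5; have [p [q h6]] := bern_cellE_6 x.
pose r n : R := n%:R / n.+1%:R; pose e n : R := n.+1%:R^-1.
have hr : r n @[n --> \oo] --> (1 : R) by exact: cvg_ratioSn.
have he : e n @[n --> \oo] --> (0 : R) by exact: cvg_harmonic.
set k3 := (1 - x) ^+ 3 - (- x) ^+ 3; set k4 := (1 - x) ^+ 4 - (- x) ^+ 4.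
set k5 := (1 - x) ^+ 5 - (- x) ^+ 5.
pose b := (s2 * (1 - 6 * s2) + 2 * s2 * u ^+ 2 + 2 * s2 * k3).
(* The limit is displayed as the value at r = 1, e = 0 of the polynomial in r = n / (n + 1) and e =
   1 / (n + 1) to which the sequence is reduced next. *)
have -> : second_order (c 2) (c 3) (c 4) =
  c 2 * ((1 - 3 * x + 3 * x ^+ 2) / 3 - s2) +
  c 3 * (5 / 2 * s2 * u * 1 + k4 / 4 * 0) +
  c 4 * (3 * s2 ^+ 2 * (1 * 1) + b * (1 * 0) + k5 / 5 * (0 * 0)) +
  c 6 * ((p.1 * (1 * 1 * 1) + p.2 * (1 * 1 * 0) + q.1 * (1 * 0 * 0) + q.2 * (0 * 0 * 0)) * 0).
  by rewrite /second_order; ring.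
have -> : (fun n => n.+1%:R ^+ 2 * (cell_poly c n - c 0%N - first_order (c 1%N) (c 2) / n.+1%:R)) =
  (fun n => c 2 * ((1 - 3 * x + 3 * x ^+ 2) / 3 - s2) +
  c 3 * (5 / 2 * s2 * u * r n + k4 / 4 * e n) +
  c 4 * (3 * s2 ^+ 2 * (r n * r n) + b * (r n * e n) + k5 / 5 * (e n * e n)) +
  c 6 * ((p.1 * (r n * r n * r n) + p.2 * (r n * r n * e n) + q.1 * (r n * e n * e n)
     + q.2 * (e n * e n * e n)) * e n)).
  apply/funext => n; rewrite /cell_poly !big_ord_recl big_ord0 /bump/= c5.
  have := bern_cellE_2 x n; have := bern_cellE_3 x n; have := bern_cellE_4 x n.
  rewrite bern_cellE_0 bern_cellE_1 h6 -/s2 -/u -/k3 -/k4 -/k5 -/b /first_order.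
  move: (bern_cell x 2 n) (bern_cell x 3 n) (bern_cell x 4 n) (bern_cell x 5 n).
  move=> W2 W3 W4 W5 w4 w3 w2.
  set W6 := p.1 * _ + _ + _ + _.
  have N0 : n.+1%:R != 0 :> R by rewrite pnatr_eq0.
  transitivity (c 2 * (W2 - s2 * n.+1%:R) + c 3 * (W3 * e n) + c 4 * (W4 * (e n * e n))
     + c 6 * (W6 * (e n * e n * e n) * e n)).
    rewrite /e; clear - N0; clearbody W6.
    move: (n.+1%:R : R) N0 (c 0%N) (c 1%N) (c 2) (c 3) (c 4) (c 6) => N N0 c0 c1 c2 c3 c4 c6.
    by field.
  rewrite w2 w3 w4 /W6 /r -[n.+1%:R^-1]/(e n) -natr1.
  by ring.
have cZ k (l : R) (v : nat -> R) : v n @[n --> \oo] --> l -> k * v n @[n --> \oo] --> k * l.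
  by apply: cvgn_mul; exact: cvgn_cst.
have hrr := cvgn_mul hr hr; have hre := cvgn_mul hr he; have hee := cvgn_mul he he.
have h3 := cZ (c 3) _ _ (cvgn_add (cZ (5 / 2 * s2 * u) _ _ hr) (cZ (k4 / 4) _ _ he)).
have h4 := cZ (c 4) _ _ (cvgn_add (cvgn_add (cZ (3 * s2 ^+ 2) _ _ hrr) (cZ b _ _ hre))
  (cZ (k5 / 5) _ _ hee)).
have h6' := cZ (c 6) _ _ (cvgn_mul (cvgn_add (cvgn_add (cvgn_add
  (cZ p.1 _ _ (cvgn_mul hrr hr)) (cZ p.2 _ _ (cvgn_mul hrr he)))
  (cZ q.1 _ _ (cvgn_mul hre he))) (cZ q.2 _ _ (cvgn_mul hee he))) he).
have h0 := @cvgn_cst R (c 2 * ((1 - 3 * x + 3 * x ^+ 2) / 3 - s2)).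
exact: (cvgn_add (cvgn_add (cvgn_add h0 h3) h4) h6').
Qed.

Lemma cell_mean_cvg (q : nat -> R) :
  (forall e, 0 < e -> exists2 C, 0 <= C & forall y, 0 <= y <= 1 ->
     `|f y - \sum_(j < 5) q j * (y - x) ^+ j| <= e * (y - x) ^+ 4 + C * (y - x) ^+ 6) ->
  n.+1%:R ^+ 2 * (cell_mean n.+1 - q 0%N - first_order (q 1%N) (q 2) / n.+1%:R)
    @[n --> \oo] --> second_order (q 2) (q 3) (q 4).
Proof.
move=> hf; apply/cvgrPdist_le => e e0.
have s21 : 3 * s2 ^+ 2 <= 1.
  have [x0 x1] := andP x01; have s20 : 0 <= s2 by rewrite mulr_ge0 ?subr_ge0 ?(ltW x0) ?(ltW x1).
  have : 0 <= (x - 1 / 2) ^+ 2 by exact: sqr_ge0.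
  have : s2 ^+ 2 <= (1 / 4) ^+ 2.
    have : 0 <= (x - 1 / 2) ^+ 2 by exact: sqr_ge0.
    by move=> h; rewrite lerXn2r ?nnegrE// /s2; lra.
  rewrite expr2; lra.
have [C C0 hC] := hf (e / 2) (divr_gt0 e0 (ltr0n _ 2)).
(* The upper and lower polynomials are [c 1] and [c (- 1)]. Only the change in the fourth
   coefficient reaches the limit, where it amounts to e / 2 * 3 s2^2 <= e / 2. *)
pose c (s : R) (j : nat) : R := match j with
  | 4 => q 4 + s * (e / 2) | 5 => 0 | 6 => s * C | _ => q j end.
have cE s y : P (c s) y = \sum_(j < 5) q j * (y - x) ^+ j +
    s * (e / 2 * (y - x) ^+ 4 + C * (y - x) ^+ 6).
  by rewrite /P /cell_poly_fun !big_ord_recl !big_ord0 /bump/=; ring.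
have hup n : cell_mean n.+1 <= cell_poly (c 1) n.
  by apply: cell_mean_le => y /hC; rewrite cE ler_norml; lra.
have hlo n : cell_poly (c (- 1)) n <= cell_mean n.+1.
  by apply: cell_mean_ge => y /hC; rewrite cE ler_norml; lra.
have lup := @cell_poly_cvg (c 1) erefl; have llo := @cell_poly_cvg (c (- 1)) erefl.
rewrite /= in lup llo.
have E1 : second_order (q 2) (q 3) (q 4 + 1 * (e / 2)) <= second_order (q 2) (q 3) (q 4) + e / 2.
  rewrite /second_order; have : e / 2 * (3 * s2 ^+ 2) <= e / 2 * 1 by rewrite ler_wpM2l// ltW// divr_gt0.
  lra.
have E2 : second_order (q 2) (q 3) (q 4) - e / 2 <= second_order (q 2) (q 3) (q 4 + - 1 * (e / 2)).
  rewrite /second_order; have : e / 2 * (3 * s2 ^+ 2) <= e / 2 * 1 by rewrite ler_wpM2l// ltW// divr_gt0.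
  lra.
set S := second_order (q 2) (q 3) (q 4) in E1 E2 *.
near=> n.
have U : n.+1%:R ^+ 2 * (cell_poly (c 1) n - q 0%N - first_order (q 1%N) (q 2) / n.+1%:R) <= S + e.
  near: n; apply: (cvgr_le _ lup); lra.
have D : S - e <= n.+1%:R ^+ 2 * (cell_poly (c (- 1)) n - q 0%N - first_order (q 1%N) (q 2) / n.+1%:R).
  near: n; apply: (cvgr_ge _ llo); lra.
set F := first_order _ _ / _ in U D *.
set N := n.+1%:R ^+ 2 in U D *; have N0 : 0 <= N :> R by exact: sqr_ge0.
have U' : N * (cell_mean n.+1 - q 0%N - F) <= N * (cell_poly (c 1) n - q 0%N - F).
  by rewrite ler_wpM2l// lerD2r lerD2r.
have D' : N * (cell_poly (c (- 1)) n - q 0%N - F) <= N * (cell_mean n.+1 - q 0%N - F).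
  by rewrite ler_wpM2l// lerD2r lerD2r.
rewrite ler_norml; lra.
Unshelve. all: by end_near. Qed.

End cell_mean.

(** * Products of Bernstein weights summed against cell masses *)

Section cell_second_moment.
Context {R : realType}.
Variables (x : R) (f : R -> R) (cell : R -> R -> R).
Hypothesis x01 : 0 < x < 1.
Hypothesis hcell : cell_integral f cell.
Variable q0 : R.
Hypothesis hf : forall e, 0 < e -> exists2 C, 0 <= C & forall y, 0 <= y <= 1 ->
  `|f y - q0| <= e + C * (y - x) ^+ 2.

Lemma bernstein_sum1 n : \sum_(k < n.+1) bernstein k n x = 1.
Proof.
rewrite -(bern_cmomE_0 x n) /bern_cmom.
by apply: eq_bigr => k _; rewrite expr0 mulr1.
Qed.

Lemma bernstein_le1 k n : bernstein k n x <= 1.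
Proof.
have [kn|nk] := leqP k n; last by rewrite bernstein_small.
have := bernstein_sum1 n; rewrite (bigD1 (Ordinal (kn : (k < n.+1)%N)))//= => <-.
by rewrite lerDl; apply: sumr_ge0 => i _; exact: bernstein_ge0.
Qed.

Lemma bernstein_dist_sum n :
  \sum_(k < n.+1) bernstein k n x * (k%:R - n.+1%:R * x) ^+ 2 <= 2 * n.+1%:R.
Proof.
have [x0 x1] := andP x01.
apply: (@le_trans _ _ (2 * bern_cmom x 2 n + 2 * x ^+ 2 * bern_cmom x 0 n)).
  rewrite /bern_cmom !mulr_sumr -big_split/=; apply: ler_sum => k _.
  have b0 := bernstein_ge0 x01 k n.
  have : (k%:R - n.+1%:R * x) ^+ 2 <= 2 * (k%:R - n%:R * x) ^+ 2 + 2 * x ^+ 2.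
    have : 0 <= ((k%:R - n%:R * x) + x) ^+ 2 by exact: sqr_ge0.
    rewrite -natr1; lra.
  move/(ler_wpM2l b0); rewrite expr0; lra.
rewrite bern_cmomE_2 bern_cmomE_0 mulr1 -natr1.
have : x ^+ 2 <= 1 by rewrite expr_le1 ?ltW.
have : 0 <= (x - 1 / 2) ^+ 2 by exact: sqr_ge0.
have n0 : 0 <= n%:R :> R by [].
move=> h1; have h2 : x * (1 - x) <= 1 by lra.
have : n%:R * (x * (1 - x)) <= n%:R * 1 by rewrite ler_wpM2l.
lra.
Qed.

(** With N = n + 1, on the cell (y - x)^2 <= 2 (k / N - x)^2 + 2 / N^2. The resulting bound on f
    passes to the mass of the cell by comparison with constants. *)
Lemma cell_approx (e C : R) n (k : 'I_n.+1) : 0 <= C ->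
  (forall y, 0 <= y <= 1 -> `|f y - q0| <= e + C * (y - x) ^+ 2) ->
  `|n.+1%:R * cell (k%:R / n.+1%:R) (k.+1%:R / n.+1%:R) - q0| <=
    e + 2 * C * (k%:R - n.+1%:R * x) ^+ 2 / n.+1%:R ^+ 2 + 2 * C / n.+1%:R ^+ 2.
Proof.
move=> C0 hC.
have N0 : 0 < n.+1%:R :> R by [].
have NN : n.+1%:R != 0 :> R by rewrite gt_eqF.
set N := n.+1%:R : R.
have ab : k%:R / N < k.+1%:R / N :> R by rewrite ltr_pM2r ?invr_gt0// ltr_nat.
have a0 : 0 <= k%:R / N :> R by rewrite divr_ge0.
have b1 : k.+1%:R / N <= 1 by rewrite ler_pdivrMr// mul1r ler_nat.
set D := e + _ + _.
have hD y : k%:R / N <= y <= k.+1%:R / N -> `|f y - q0| <= D.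
  move=> /andP[y1 y2]; have y01 : 0 <= y <= 1 by rewrite (le_trans a0 y1) (le_trans y2 b1).
  apply: (le_trans (hC _ y01)); rewrite /D -addrA lerD2l.
  suff : (y - x) ^+ 2 <= 2 * ((k%:R - N * x) ^+ 2 / N ^+ 2) + 2 * (N ^+ 2)^-1.
    rewrite (_ : 2 * C * _ / _ + _ = C * (2 * ((k%:R - N * x) ^+ 2 / N ^+ 2) + 2 * (N ^+ 2)^-1));
      last by field.
    exact: ler_wpM2l.
  have -> : (k%:R - N * x) ^+ 2 / N ^+ 2 = (k%:R / N - x) ^+ 2 by field.
  have -> : (N ^+ 2)^-1 = N^-1 ^+ 2 by rewrite exprVn.
  have yk : 0 <= y - k%:R / N <= N^-1.
    by rewrite subr_ge0 y1/= lerBlDl (le_trans y2)// -[k.+1%:R]natr1 mulrDl mul1r.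
  have : (y - k%:R / N) ^+ 2 <= N^-1 ^+ 2.
    by case/andP: yk => h1 h2; rewrite lerXn2r ?nnegrE// invr_ge0 ltW.
  have : 0 <= ((y - k%:R / N) - (k%:R / N - x)) ^+ 2 by exact: sqr_ge0.
  move: (k%:R / N) (N^-1 ^+ 2) => t v; lra.
have cc (c : R) : continuous (fun _ : R => c) by move=> y; exact: cvg_cst.
have dc (c y : R) : is_derive y (1 : R) (fun y => c * y) c.
  by apply: is_derive_eq; rewrite /GRing.scale/= mulr1.
have [hu _] := hcell ab a0 b1 (cc (q0 + D)) (dc (q0 + D)).
have [_ hl] := hcell ab a0 b1 (cc (q0 - D)) (dc (q0 - D)).
have len : N * (k.+1%:R / N - k%:R / N) = 1 by rewrite -natr1; field.
have {}hu : cell (k%:R / N) (k.+1%:R / N) <= (q0 + D) * (k.+1%:R / N) - (q0 + D) * (k%:R / N).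
  by apply: hu => y /hD; rewrite ler_norml; lra.
have {}hl : (q0 - D) * (k.+1%:R / N) - (q0 - D) * (k%:R / N) <= cell (k%:R / N) (k.+1%:R / N).
  by apply: hl => y /hD; rewrite ler_norml; lra.
move: hu hl; rewrite -!mulrBr => /(ler_wpM2l (ltW N0)); rewrite mulrCA len mulr1 => hu.
move=> /(ler_wpM2l (ltW N0)); rewrite mulrCA len mulr1 => hl.
rewrite ler_norml; lra.
Qed.

(** [beta] is the second Bernstein factor of a product. Bounding it by 1 in the terms with C leaves
    the total mass and the second moment of the first factor, hence 4 C + 2 C / N <= 6 C with N = n
    + 1. This is negligible against a main term of order sqrt N. *)
Lemma cell_sum_approx (e C : R) n (beta : nat -> R) : 0 <= C ->
  (forall y, 0 <= y <= 1 -> `|f y - q0| <= e + C * (y - x) ^+ 2) ->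
  (forall k, 0 <= beta k <= 1) ->
  `|n.+1%:R ^+ 2 * (\sum_(k < n.+1) cell (k%:R / n.+1%:R) (k.+1%:R / n.+1%:R) *
      (bernstein k n x * beta k))
    - q0 * (n.+1%:R * \sum_(k < n.+1) bernstein k n x * beta k)| <=
  e * (n.+1%:R * \sum_(k < n.+1) bernstein k n x * beta k) + 6 * C.
Proof.
move=> C0 hC hb; have N0 : 0 < n.+1%:R :> R by [].
have NN : n.+1%:R != 0 :> R by rewrite gt_eqF.
set B := \sum_(k < n.+1) _ * beta k.
have -> : n.+1%:R ^+ 2 * (\sum_(k < n.+1) cell (k%:R / n.+1%:R) (k.+1%:R / n.+1%:R) *
      (bernstein k n x * beta k)) - q0 * (n.+1%:R * B) =
  n.+1%:R * \sum_(k < n.+1) (n.+1%:R * cell (k%:R / n.+1%:R) (k.+1%:R / n.+1%:R) - q0) *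
    (bernstein k n x * beta k).
  rewrite expr2 -mulrA [q0 * _]mulrCA -mulrBr; congr (_ * _).
  by rewrite !mulr_sumr -sumrB; apply: eq_bigr => k _; ring.
rewrite normrM gtr0_norm//.
have S1 : `|\sum_(k < n.+1) (n.+1%:R * cell (k%:R / n.+1%:R) (k.+1%:R / n.+1%:R) - q0) *
    (bernstein k n x * beta k)| <=
  e * B + (2 * C / n.+1%:R ^+ 2) * \sum_(k < n.+1) bernstein k n x * (k%:R - n.+1%:R * x) ^+ 2 +
  (2 * C / n.+1%:R ^+ 2) * \sum_(k < n.+1) bernstein k n x.
  apply: (le_trans (ler_norm_sum _ _ _)).
  rewrite !mulr_sumr -!big_split/=; apply: ler_sum => k _.
  have b0 := bernstein_ge0 x01 k n; have /andP[be0 be1] := hb k.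
  have bb0 : 0 <= bernstein k n x * beta k by rewrite mulr_ge0.
  rewrite normrM (ger0_norm bb0).
  apply: (le_trans (ler_wpM2r bb0 (cell_approx k C0 hC))).
  have c1 : 0 <= 2 * C / n.+1%:R ^+ 2 by rewrite divr_ge0 ?mulr_ge0 ?exprn_ge0.
  have bb1 : bernstein k n x * beta k <= bernstein k n x by rewrite ler_piMr.
  rewrite (_ : 2 * C * _ / _ = 2 * C / n.+1%:R ^+ 2 * (k%:R - n.+1%:R * x) ^+ 2); last by field.
  have := sqr_ge0 (k%:R - n.+1%:R * x); move: (_ - _ * _) (2 * C / _) c1 => y D D0.
  move: (y ^+ 2) => Q Q0.
  have := ler_wpM2l D0 bb1; have := ler_wpM2l (mulr_ge0 D0 Q0) bb1.
  move: (bernstein k n x * beta k) => w; lra.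
rewrite bernstein_sum1 mulr1 in S1.
have c1 : 0 <= 2 * C / n.+1%:R ^+ 2 by rewrite divr_ge0 ?mulr_ge0 ?exprn_ge0.
have S2 := ler_wpM2l c1 (bernstein_dist_sum n).
have S3 := ler_wpM2l (ltW N0) (le_trans S1 (lerD (lerD (lexx _) S2) (lexx _))).
apply: (le_trans S3).
rewrite -addrA mulrDr mulrCA lerD2l.
have -> : n.+1%:R * (2 * C / n.+1%:R ^+ 2 * (2 * n.+1%:R) + 2 * C / n.+1%:R ^+ 2) =
  4 * C + 2 * C * n.+1%:R^-1 by field.
have : n.+1%:R^-1 <= 1 :> R by rewrite invf_le1// ler1n.
have C2 : 0 <= 2 * C by rewrite mulr_ge0.
move: (n.+1%:R^-1) => v /(ler_wpM2l C2); lra.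
Qed.

(** [nu] lists the degrees, so that the fine grid (degree 2 i + 1) and the coarse grid (degree i)
    are treated alike. *)
Lemma cell_sum_cvg (nu : nat -> nat) (beta : nat -> nat -> R) (l : R) :
  (Num.sqrt (nu i).+1%:R)^-1 @[i --> \oo] --> (0 : R) ->
  (forall i k, 0 <= beta i k <= 1) ->
  Num.sqrt (nu i).+1%:R * \sum_(k < (nu i).+1) bernstein k (nu i) x * beta i k
    @[i --> \oo] --> l ->
  (Num.sqrt (nu i).+1%:R)^-1 * ((nu i).+1%:R ^+ 2 *
    (\sum_(k < (nu i).+1) cell (k%:R / (nu i).+1%:R) (k.+1%:R / (nu i).+1%:R) *
      (bernstein k (nu i) x * beta i k))) @[i --> \oo] --> q0 * l.
Proof.
move=> hnu hb hl.
pose S i := Num.sqrt (nu i).+1%:R * \sum_(k < (nu i).+1) bernstein k (nu i) x * beta i k.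
pose T i := (Num.sqrt (nu i).+1%:R)^-1 * ((nu i).+1%:R ^+ 2 *
    (\sum_(k < (nu i).+1) cell (k%:R / (nu i).+1%:R) (k.+1%:R / (nu i).+1%:R) *
      (bernstein k (nu i) x * beta i k))).
have hT : T i - q0 * S i @[i --> \oo] --> (0 : R).
  apply/cvgr0Pnorm_le => e e0.
  have l1 : 0 < `|l| + 1 by rewrite ltr_wpDl.
  have [C C0 hC] := hf (divr_gt0 e0 (mulr_gt0 (ltr0n R 2) l1)).
  near=> i.
  have Sl : S i <= `|l| + 1.
    near: i; apply: (cvgr_le _ hl); rewrite (le_lt_trans (ler_norm l))// ltrDl//.
  have rC : 6 * C * (Num.sqrt (nu i).+1%:R)^-1 <= e / 2.
    near: i; apply: (cvgr_le (6 * C * 0)).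
      by apply: cvgM => //; exact: cvg_cst.
    by rewrite mulr0 divr_gt0.
  have sN : 0 < Num.sqrt (nu i).+1%:R :> R by rewrite sqrtr_gt0.
  have K0 (a b s n : R) : 0 < s -> n = s * s -> s^-1 * (a * (n * b)) = a * (s * b).
    by move=> s0 ->; field; rewrite gt_eqF.
  have NsN : (nu i).+1%:R = Num.sqrt (nu i).+1%:R * Num.sqrt (nu i).+1%:R :> R.
    by rewrite -expr2 sqr_sqrtr.
  have K a b := K0 a b _ _ sN NsN.
  have r0 : 0 < (Num.sqrt (nu i).+1%:R)^-1 :> R by rewrite invr_gt0.
  have := ler_wpM2l (ltW r0) (cell_sum_approx (nu i) C0 hC (hb i)).
  rewrite -{1}(gtr0_norm r0) -normrM mulrBr mulrDr.
  have -> : (Num.sqrt (nu i).+1%:R)^-1 * (q0 * ((nu i).+1%:R *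
    \sum_(k < (nu i).+1) bernstein k (nu i) x * beta i k)) = q0 * S i.
    exact: K.
  rewrite -/(T i) => /le_trans; apply.
  have -> : (Num.sqrt (nu i).+1%:R)^-1 * (e / (2 * (`|l| + 1)) * ((nu i).+1%:R *
    \sum_(k < (nu i).+1) bernstein k (nu i) x * beta i k)) = e / (2 * (`|l| + 1)) * S i.
    exact: K.
  have : e / (2 * (`|l| + 1)) * S i <= e / (2 * (`|l| + 1)) * (`|l| + 1).
    by rewrite ler_wpM2l// ltW// divr_gt0// mulr_gt0.
  have -> : e / (2 * (`|l| + 1)) * (`|l| + 1) = e / 2 by field; rewrite gt_eqF.
  lra.
rewrite -[q0 * l]add0r; have -> : (fun i => (Num.sqrt (nu i).+1%:R)^-1 * ((nu i).+1%:R ^+ 2 *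
    (\sum_(k < (nu i).+1) cell (k%:R / (nu i).+1%:R) (k.+1%:R / (nu i).+1%:R) *
      (bernstein k (nu i) x * beta i k)))) = (fun i => (T i - q0 * S i) + q0 * S i).
  by apply/funext => i; rewrite subrK.
by apply: cvgD => //; apply: cvgM => //; exact: cvg_cst.
Unshelve. all: by end_near. Qed.

End cell_second_moment.

(** * Limit of the second moment of Z and origin of C_3 *)

Section second_moment.
Context {R : realType}.

Lemma cvg_subsequence (u : nat -> R) (nu : nat -> nat) (l : R) :
  (forall i, (i <= nu i)%N) -> u n @[n --> \oo] --> l -> u (nu i) @[i --> \oo] --> l.
Proof.
move=> hnu; apply: cvg_comp; apply/cvgnyPge => A; near=> i.
by apply: leq_trans (hnu i); near: i; exact: nbhs_infty_ge.
Unshelve. all: by end_near. Qed.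

Lemma cvg_sqrtSn (u : nat -> R) (l : R) : Num.sqrt n%:R * u n @[n --> \oo] --> l ->
  Num.sqrt n.+1%:R * u n @[n --> \oo] --> l.
Proof.
move=> hu.
have hr : Num.sqrt (n.+1%:R / n%:R : R) @[n --> \oo] --> (1 : R).
  suff h : n.+1%:R / n%:R @[n --> \oo] --> (1 : R).
    rewrite -[X in _ --> X]sqrtr1.
    by apply: (continuous_cvg _ _ h); exact: sqrt_continuous.
  have h : 1 + n%:R^-1 @[n --> \oo] --> (1 + 0 : R).
    by apply: cvgD; [exact: cvg_cst|exact: cvg_invn].
  move: h; rewrite addr0; apply: cvg_trans; apply: near_eq_cvg.
  near=> n; have n0 : (n%:R != 0 :> R).
    by rewrite pnatr_eq0 -lt0n; near: n; exact: nbhs_infty_gt.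
  by rewrite -natr1; field.
have := cvgn_mul hr hu; rewrite mul1r; apply: cvg_trans; apply: near_eq_cvg.
near=> n; have n0 : 0 < n%:R :> R.
  by rewrite ltr0n; near: n; exact: nbhs_infty_gt.
rewrite /= mulrA -sqrtrM ?divr_ge0// divfK// gt_eqF//.
Unshelve. all: by end_near. Qed.

Variables (x : R) (f : R -> R) (cell : R -> R -> R).
Hypothesis x01 : 0 < x < 1.
Hypothesis hcell : cell_integral f cell.
Hypothesis cellD : forall a b c, 0 <= a -> a < b -> b < c -> c <= 1 ->
  cell a c = cell a b + cell b c.
Variable q0 : R.
Hypothesis hf : forall e, 0 < e -> exists2 C, 0 <= C & forall y, 0 <= y <= 1 ->
  `|f y - q0| <= e + C * (y - x) ^+ 2.

(** Second moment of Z for m = 2 (i + 1): the fine cell k lies in the coarse cell of index [k./2],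
    where T_{m/2} is (i + 1) times the Bernstein weight of that index. *)
Definition cell_sqr_mean i : R := \sum_(k < i.*2.+2)
  cell (k%:R / i.*2.+2%:R) (k.+1%:R / i.*2.+2%:R) *
  (2 * (i.*2.+2%:R * bernstein k i.*2.+1 x) - i.+1%:R * bernstein k./2 i x) ^+ 2.

Lemma big_pairs (V : nmodType) n (F : nat -> V) :
  \sum_(k < n.*2) F k = \sum_(j < n) (F j.*2 + F j.*2.+1).
Proof.
elim: n => [|n IH]; first by rewrite !big_ord0.
by rewrite doubleS !big_ord_recr/= IH addrA.
Qed.

Let coarse i (j : nat) : (j <= i)%N ->
  cell (j%:R / i.+1%:R) (j.+1%:R / i.+1%:R) =
  cell (j.*2%:R / i.*2.+2%:R) (j.*2.+1%:R / i.*2.+2%:R) +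
  cell (j.*2.+1%:R / i.*2.+2%:R) (j.*2.+2%:R / i.*2.+2%:R).
Proof.
move=> ji.
have E (a : nat) : a%:R / i.+1%:R = a.*2%:R / i.*2.+2%:R :> R.
  rewrite -doubleS -!muln2 !natrM; field.
  by rewrite nat1r pnatr_eq0.
rewrite !E; apply: cellD.
- by rewrite divr_ge0.
- by rewrite ltr_pM2r ?invr_gt0// ltr_nat.
- by rewrite ltr_pM2r ?invr_gt0// ltr_nat; lia.
- by rewrite ler_pdivrMr// mul1r ler_nat; lia.
Qed.

Let sqr_cvg : Num.sqrt n.+1%:R * \sum_(k < n.+1) bernstein k n x * bernstein k n x
  @[n --> \oo] --> psi x.
Proof.
apply: cvg_sqrtSn; have := sum_sqr_bernstein_cvg x01; apply: cvg_trans.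
by apply: near_eq_cvg; near=> n; congr (_ * _); apply: eq_bigr => k _; rewrite expr2.
Unshelve. all: by end_near. Qed.

Let cross_cvg : Num.sqrt i.*2.+2%:R *
    \sum_(k < i.*2.+2) bernstein k i.*2.+1 x * bernstein k./2 i x
  @[i --> \oo] --> Num.sqrt 2 * (psi x / Num.sqrt 3 + psi x / Num.sqrt 3).
Proof.
have h0 := sum_bernstein_half_cvg x01 false; have h1 := sum_bernstein_half_cvg x01 true.
have := cvgn_mul (@cvgn_cst _ (Num.sqrt 2)) (cvgn_add (cvg_sqrtSn h0) (cvg_sqrtSn h1)).
apply: cvg_trans; apply: near_eq_cvg; near=> i.
(* Even and odd k give the two parities of [sum_bernstein_half_cvg]. *)
rewrite -doubleS (big_pairs _ (fun k => bernstein k i.*2.+1 x * bernstein k./2 i x)) /=.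
have -> : i.+1.*2%:R = 2 * i.+1%:R :> R by rewrite -mul2n natrM.
rewrite sqrtrM// -mulrA -mulrDr -big_split/=.
congr (_ * (_ * _)); apply: eq_bigr => j _.
by rewrite addn0 addn1 doubleK uphalf_double; ring.
Unshelve. all: by end_near. Qed.

Let bern01 k n : 0 <= bernstein k n x <= 1.
Proof. by rewrite bernstein_ge0// bernstein_le1. Qed.

Lemma cvg_inv_sqrtSn : (Num.sqrt n.+1%:R)^-1 @[n --> \oo] --> (0 : R).
Proof. exact: (cvg_subsequence leqnSn (@cvg_inv_sqrtn R)). Qed.

(** With m = 2 i + 2 and b, b' the fine and coarse weights, the square is 4 m^2 b b - 2 m^2 b b' +
    (m / 2)^2 b' b'. After division by sqrt m the three sums contribute 4, - 2 * 2 sqrt(2 / 3) and 1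
    / sqrt 2 in units of q0 psi(x), and their total is C_3. The last term is constant on coarse
    cells, so it becomes a sum over the coarse grid, whose order m / 2 accounts for 1 / sqrt 2. *)
Lemma cell_sqr_mean_cvg :
  (Num.sqrt i.*2.+2%:R)^-1 * cell_sqr_mean i @[i --> \oo] --> C3 R * q0 * psi x.
Proof.
have nu_ge i : (i <= i.*2.+1)%N by lia.
have nucvg : (Num.sqrt i.*2.+2%:R)^-1 @[i --> \oo] --> (0 : R).
  exact: (cvg_subsequence nu_ge cvg_inv_sqrtSn).
have t1 := cell_sum_cvg x01 hcell hf nucvg (fun i k => bern01 k i.*2.+1)
  (cvg_subsequence nu_ge sqr_cvg).
have t2 := cell_sum_cvg x01 hcell hf nucvg (fun i k => bern01 k./2 i) cross_cvg.
have t3 := @cell_sum_cvg _ _ _ _ x01 hcell _ hf id _ _ cvg_inv_sqrtSn (fun i k => bern01 k i) sqr_cvg.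
have := cvgn_add (cvgn_add (cvgn_mul (@cvgn_cst _ 4) t1) (cvgn_mul (@cvgn_cst _ (- 2)) t2))
  (cvgn_mul (@cvgn_cst _ (Num.sqrt 2)^-1) t3).
have -> : 4 * (q0 * psi x) + - 2 * (q0 * (Num.sqrt 2 * (psi x / Num.sqrt 3 + psi x / Num.sqrt 3)))
   + (Num.sqrt 2)^-1 * (q0 * psi x) = C3 R * q0 * psi x.
  by rewrite /C3 sqrtrM// sqrtrV//; ring.
apply: cvg_trans; apply: near_eq_cvg; near=> i.
rewrite /cell_sqr_mean /=.
have -> : \sum_(k < i.*2.+2) cell (k%:R / i.*2.+2%:R) (k.+1%:R / i.*2.+2%:R) *
   (2 * (i.*2.+2%:R * bernstein k i.*2.+1 x) - i.+1%:R * bernstein k./2 i x) ^+ 2 =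
  4 * (i.*2.+2%:R ^+ 2 * \sum_(k < i.*2.+2) cell (k%:R / i.*2.+2%:R) (k.+1%:R / i.*2.+2%:R) *
    (bernstein k i.*2.+1 x * bernstein k i.*2.+1 x)) +
  - 2 * (i.*2.+2%:R ^+ 2 * \sum_(k < i.*2.+2) cell (k%:R / i.*2.+2%:R) (k.+1%:R / i.*2.+2%:R) *
    (bernstein k i.*2.+1 x * bernstein k./2 i x)) +
  i.+1%:R ^+ 2 * \sum_(k < i.*2.+2) cell (k%:R / i.*2.+2%:R) (k.+1%:R / i.*2.+2%:R) *
    (bernstein k./2 i x * bernstein k./2 i x).
  rewrite !mulr_sumr -!big_split/=; apply: eq_bigr => k _.
  have -> : i.*2.+2%:R = 2 * i.+1%:R :> R by rewrite -doubleS -mul2n natrM.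
  ring.
have -> : \sum_(k < i.*2.+2) cell (k%:R / i.*2.+2%:R) (k.+1%:R / i.*2.+2%:R) *
    (bernstein k./2 i x * bernstein k./2 i x) =
  \sum_(j < i.+1) cell (j%:R / i.+1%:R) (j.+1%:R / i.+1%:R) * (bernstein j i x * bernstein j i x).
  apply: (etrans (big_pairs i.+1 (fun k => cell (k%:R / i.*2.+2%:R) (k.+1%:R / i.*2.+2%:R) *
    (bernstein k./2 i x * bernstein k./2 i x)))).
  apply: eq_bigr => j _; rewrite [in RHS]coarse ?leq_ord//= doubleK uphalf_double; ring.
have -> : (Num.sqrt i.*2.+2%:R)^-1 = (Num.sqrt 2)^-1 * (Num.sqrt i.+1%:R)^-1 :> R.
  by rewrite -doubleS -mul2n natrM sqrtrM// invfM.
ring.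
Unshelve. all: by end_near. Qed.

End second_moment.

(** * Taylor expansion relative to the unit interval *)

Section taylor_within.
Context {R : realType}.
Implicit Types (g : R -> R) (y l : R) (A : set R).

Lemma derivative_within_near A g y l : derivative_within A g y l ->
  forall e, 0 < e -> exists2 dl, 0 < dl & forall z, `|z - y| < dl -> A z -> z != y ->
    `|(g z - g y) / (z - y) - l| <= e.
Proof.
move=> /cvgrPdist_le h e e0; have [dl dl0 hd] := h _ e0.
exists dl => // z zy Az zny; rewrite distrC; apply: (hd z) => //=.
by rewrite distrC.
Qed.

Lemma derivative_within_lipschitz A g y l : derivative_within A g y l ->
  exists2 dl, 0 < dl & forall z, `|z - y| < dl -> A z ->
    `|g z - g y| <= (`|l| + 1) * `|z - y|.
Proof.
move=> /derivative_within_near /(_ 1 ltr01) [dl dl0 hd]; exists dl => // z zy Az.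
have [->|zny] := eqVneq z y; first by rewrite !subrr normr0 mulr0.
have zy0 : 0 < `|z - y| by rewrite normr_gt0 subr_eq0.
have := hd z zy Az zny => h.
rewrite -ler_pdivrMr// -[X in _ / X]normr_id -normfV -normrM.
have -> : (g z - g y) / `|z - y| = (g z - g y) / (z - y) * ((z - y) / `|z - y|).
  by field; rewrite gt_eqF// subr_eq0.
rewrite normrM [X in _ * X]normf_div normr_id divff ?gt_eqF// mulr1.
have := ler_normD ((g z - g y) / (z - y) - l) l; rewrite subrK; lra.
Qed.

Lemma derivative_within_continuous A g (g' : R -> R) :
  (forall y, A y -> derivative_within A g y (g' y)) -> {within A, continuous g}.
Proof.
move=> hg; apply/subspace_continuousP => y Ay; apply/cvgrPdist_le => e e0.
have [dl dl0 hd] := derivative_within_lipschitz (hg y Ay).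
have l0 : 0 < `|g' y| + 1 by rewrite ltr_wpDl.
exists (Num.min dl (e / (`|g' y| + 1))).
  by rewrite /= lt_min dl0 divr_gt0.
move=> z /=; rewrite distrC lt_min => /andP[zy zy2] Az.
rewrite distrC (le_trans (hd z zy Az))// mulrC -ler_pdivlMr//; exact: ltW.
Qed.

(** Once a ball around y lies in A, restricting to A changes nothing near y. *)
Lemma derivative_within_is_derive A g y l (r : R) : 0 < r ->
  (forall z, `|z - y| < r -> A z) -> derivative_within A g y l ->
  is_derive y (1 : R) g l.
Proof.
move=> r0 hA hg.
have H : h^-1 *: (g (h *: 1 + y) - g y) @[h --> 0^'] --> l.
  apply/cvgrPdist_le => e e0.
  have [dl dl0 hd] := derivative_within_near hg e0.
  exists (Num.min r dl); first by rewrite /= lt_min r0 dl0.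
  move=> h /=; rewrite sub0r normrN lt_min => /andP[hr hdl] h0.
  rewrite /GRing.scale/= mulr1 distrC mulrC.
  have -> : h^-1 = (h + y - y)^-1 by rewrite addrK.
  apply: hd; rewrite ?addrK//; first by apply: hA; rewrite addrK.
  by rewrite -subr_eq0 addrK.
by apply: DeriveDef; [apply/cvg_ex; exists l|apply: cvg_lim].
Qed.

(** Mean value theorem on the segment between x and y, in either order. The factor 1 / (k + 1) of
    exact integration is given up. *)
Lemma mvt_power_bound g (g' : R -> R) (x r e : R) k : 0 < r -> 0 <= e -> g x = 0 ->
  (forall y, `|y - x| < r -> is_derive y (1 : R) g (g' y)) ->
  (forall y, `|y - x| < r -> `|g' y| <= e * `|y - x| ^+ k) ->
  forall y, `|y - x| < r -> `|g y| <= e * `|y - x| ^+ k.+1.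
Proof.
move=> r0 e0 gx dg bg y yr.
have cg z : `|z - x| < r -> {for z, continuous g}.
  by move=> zr; apply/differentiable_continuous/derivable1_diffP; case: (dg z zr).
have [c cr ->] : exists2 c, `|c - x| <= `|y - x| & g y = g' c * (y - x).
  have [xy|yx] := leP x y.
  - have ball c : x <= c <= y -> `|c - x| <= `|y - x|.
      move=> /andP[h1 h2]; rewrite !ger0_norm ?subr_ge0//; lra.
    have [||c ci E] := @MVT_segment R g g' x y xy.
    + move=> z; rewrite in_itv/= => /andP[h1 h2].
      by apply: dg; apply: le_lt_trans yr; apply: ball; rewrite !ltW.
    + apply: continuous_in_subspaceT => z; rewrite inE/= in_itv/= => h.
      by apply: cg; apply: le_lt_trans yr; apply: ball.
    + exists c; first by apply: ball; rewrite in_itv/= in ci.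
      by rewrite -E gx subr0.
  - have ball c : y <= c <= x -> `|c - x| <= `|y - x|.
      move=> /andP[h1 h2]; rewrite ler0_norm ?subr_le0// ltr0_norm ?subr_lt0//; lra.
    have [||c ci E] := @MVT_segment R g g' y x (ltW yx).
    + move=> z; rewrite in_itv/= => /andP[h1 h2].
      by apply: dg; apply: le_lt_trans yr; apply: ball; rewrite !ltW.
    + apply: continuous_in_subspaceT => z; rewrite inE/= in_itv/= => h.
      by apply: cg; apply: le_lt_trans yr; apply: ball.
    + exists c; first by apply: ball; rewrite in_itv/= in ci.
      by move: E; rewrite gx; lra.
rewrite normrM exprSr mulrA; apply: ler_wpM2r => //.
apply: (le_trans (bg c (le_lt_trans cr yr))); rewrite ler_wpM2l//.
by rewrite lerXn2r ?nnegrE.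
Qed.

Variables (f : R -> R) (d : nat -> R -> R) (x : R).
Hypothesis x01 : 0 < x < 1.
Hypothesis d0f : forall y, `[0, 1]%classic y -> d 0%N y = f y.
Hypothesis dd : forall j, (j < 4)%N -> forall y, `[0, 1]%classic y ->
  derivative_within `[0, 1]%classic (d j) y (d j.+1 y).
Hypothesis cd4 : {within `[0, 1]%classic, continuous (d 4)}.

Let in01 (y : R) : (`[0, 1]%classic y) = (0 <= y <= 1 :> Prop).
Proof. by rewrite /= in_itv. Qed.

Let rad (y : R) := Num.min y (1 - y).
Let rad_gt0 y : 0 < y < 1 -> 0 < rad y.
Proof. by move=> /andP[y0 y1]; rewrite /rad lt_min y0 subr_gt0. Qed.
Let rad_sub y z : `|z - y| < rad y -> 0 < z < 1.
Proof. by rewrite /rad lt_min !ltr_norml => /andP[]; lra. Qed.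

Lemma is_derive_within y j : 0 < y < 1 -> (j < 4)%N ->
  is_derive y (1 : R) (d j) (d j.+1 y).
Proof.
move=> y01 j4; apply: (@derivative_within_is_derive `[0, 1]%classic _ _ _ (rad y)).
- exact: rad_gt0.
- by move=> z /rad_sub /andP[? ?]; rewrite in01 !ltW.
- by apply: dd => //; rewrite in01; case/andP: y01 => ? ?; rewrite !ltW.
Qed.

(** [derive1n] differentiates f on the whole line, whereas [d] describes it relative to [0, 1]. The
    induction runs on the open interval, where derivatives are local. *)
Lemma derive1n_within j y : (j <= 4)%N -> 0 < y < 1 -> derive1n j f y = d j y.
Proof.
elim: j y => [|j IH] y j4 y01.
  by rewrite derive1n0 d0f// in01; case/andP: y01 => ? ?; rewrite !ltW.
rewrite derive1nS derive1E.
have H : is_derive y (1 : R) (d j) (d j.+1 y) by exact: is_derive_within.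
rewrite -(@derive_val _ _ _ _ _ _ _ H); apply: near_eq_derive.
exists (rad y); first exact: rad_gt0.
move=> z /=; rewrite distrC => /rad_sub z01; apply: IH => //; exact: ltnW.
Qed.

Definition taylor_poly (y : R) := \sum_(j < 5) (d j x / j`!%:R) * (y - x) ^+ j.

(** Among the remainders [r4], [r3], [r2], [r1'], [r0'], each is the derivative of the next.
    Continuity of the fourth derivative at x bounds [r4] by e, and four uses of the mean value bound
    raise the power to 4. *)
Lemma taylor_local e : 0 < e -> exists2 r, 0 < r & forall y, `|y - x| < r ->
  `|f y - taylor_poly y| <= e * (y - x) ^+ 4.
Proof.
move=> e0; have x01' : `[0, 1]%classic x by rewrite in01; case/andP: x01 => ? ?; rewrite !ltW.
have /subspace_continuousP/(_ x x01')/cvgrPdist_le/(_ e e0) [r1 /= r10 hr1] := cd4.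
pose r := Num.min r1 (rad x).
have r0 : 0 < r by rewrite lt_min r10 rad_gt0.
have rr y : `|y - x| < r -> 0 < y < 1 by rewrite lt_min => /andP[_ /rad_sub].
pose r4 y := d 4 y - d 4 x.
pose r3 y := d 3 y - (d 3 x + d 4 x * (y - x)).
pose r2 y := d 2 y - (d 2 x + d 3 x * (y - x) + d 4 x / 2 * (y - x) ^+ 2).
pose r1' y := d 1%N y - (d 1%N x + d 2 x * (y - x) + d 3 x / 2 * (y - x) ^+ 2 +
  d 4 x / 6 * (y - x) ^+ 3).
pose r0' y := d 0%N y - (d 0%N x + d 1%N x * (y - x) + d 2 x / 2 * (y - x) ^+ 2 +
  d 3 x / 6 * (y - x) ^+ 3 + d 4 x / 24 * (y - x) ^+ 4).
have h4 y : `|y - x| < r -> `|r4 y| <= e * `|y - x| ^+ 0.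
  move=> yr; rewrite expr0 mulr1 distrC.
  apply: hr1 => /=; first by move: yr; rewrite lt_min distrC => /andP[].
  by rewrite in_itv/=; case/andP: (rr y yr) => ? ?; rewrite !ltW.
have e0' := ltW e0.
have h3 : forall y, `|y - x| < r -> `|r3 y| <= e * `|y - x| ^+ 1.
  apply: (@mvt_power_bound _ r4) => //; first by rewrite /r3; ring.
  move=> y /rr y01; have H := is_derive_within y01 (isT : 3 < 4)%N.
  by apply: is_derive_eq; rewrite /GRing.scale/= /r4; ring.
have h2 : forall y, `|y - x| < r -> `|r2 y| <= e * `|y - x| ^+ 2.
  apply: (@mvt_power_bound _ r3) => //; first by rewrite /r2; ring.
  move=> y /rr y01; have H := is_derive_within y01 (isT : 2 < 4)%N.
  by apply: is_derive_eq; rewrite /GRing.scale/= /r3; field.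
have h1 : forall y, `|y - x| < r -> `|r1' y| <= e * `|y - x| ^+ 3.
  apply: (@mvt_power_bound _ r2) => //; first by rewrite /r1'; ring.
  move=> y /rr y01; have H := is_derive_within y01 (isT : 1 < 4)%N.
  by apply: is_derive_eq; rewrite /GRing.scale/= /r2; field.
have h0 : forall y, `|y - x| < r -> `|r0' y| <= e * `|y - x| ^+ 4.
  apply: (@mvt_power_bound _ r1') => //; first by rewrite /r0'; ring.
  move=> y /rr y01; have H := is_derive_within y01 (isT : 0 < 4)%N.
  by apply: is_derive_eq; rewrite /GRing.scale/= /r1'; field.
exists r => // y yr; have y01 := rr y yr.
have -> : f y - taylor_poly y = r0' y.
  rewrite /r0' d0f; last by rewrite in01; case/andP: y01 => ? ?; rewrite !ltW.
  by rewrite /taylor_poly !big_ord_recr big_ord0 /= add0r !factS fact0 !muln1; field.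
rewrite (le_trans (h0 y yr))//.
by rewrite -[4%N]/(2 * 2)%N exprM real_normK ?num_real// -exprM.
Qed.

Lemma f_bounded : exists2 B, 0 <= B & forall y, 0 <= y <= 1 -> `|f y| <= B.
Proof.
have cd0 : {within `[0, 1]%classic, continuous (d 0%N)}.
  by apply: (derivative_within_continuous (dd (isT : 0 < 4)%N)).
have [c1 _ h1] := EVT_max (@ler01 R) cd0.
have [c2 _ h2] := EVT_min (@ler01 R) cd0.
exists (`|d 0%N c1| + `|d 0%N c2|); first by rewrite addr_ge0.
move=> y y01; rewrite -d0f ?in01//.
have := h1 y; have := h2 y; rewrite in_itv/= => /(_ y01) k2 /(_ y01) k1.
rewrite ler_norml; have := ler_norm (d 0%N c1); have := ler_norm (- d 0%N c2).
rewrite normrN; have := normr_ge0 (d 0%N c1); have := normr_ge0 (d 0%N c2); lra.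
Qed.

(** Beyond the radius r the difference is at most [B + Bq] and (|y - x| / r)^n >= 1, so C = (B + Bq)
    / r^n absorbs it. *)
Lemma local_to_global (q : R -> R) (Bq : R) (k n : nat) :
  (forall y, 0 <= y <= 1 -> `|q y| <= Bq) ->
  (forall e, 0 < e -> exists2 r, 0 < r & forall y, `|y - x| < r -> 0 <= y <= 1 ->
     `|f y - q y| <= e * `|y - x| ^+ k) ->
  forall e, 0 < e -> exists2 C, 0 <= C & forall y, 0 <= y <= 1 ->
     `|f y - q y| <= e * `|y - x| ^+ k + C * `|y - x| ^+ n.
Proof.
move=> hq hl e e0; have [r r0 hr] := hl e e0; have [B B0 hB] := f_bounded.
have Bq0 : 0 <= Bq.
  apply: (le_trans (normr_ge0 (q x))); apply: hq.
  by case/andP: x01 => ? ?; rewrite !ltW.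
have rn : 0 < r ^+ n by rewrite exprn_gt0.
exists ((B + Bq) / r ^+ n); first by rewrite divr_ge0 ?addr_ge0 ?(ltW rn).
move=> y y01.
have p1 : 0 <= e * `|y - x| ^+ k by rewrite mulr_ge0 ?exprn_ge0// ltW.
have [yr|yr] := ltP `|y - x| r.
  apply: (le_trans (hr y yr y01)); rewrite lerDl mulr_ge0 ?exprn_ge0//.
  by rewrite divr_ge0 ?addr_ge0 ?(ltW rn).
apply: (@le_trans _ _ (B + Bq)).
  by rewrite (le_trans (ler_normB _ _))// lerD ?hB ?hq.
rewrite (@le_trans _ _ ((B + Bq) / r ^+ n * `|y - x| ^+ n)) ?lerDr//.
rewrite mulrAC -mulrA ler_peMr ?addr_ge0// ler_pdivlMr// mul1r.
by rewrite lerXn2r ?nnegrE// ltW.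
Qed.

Lemma taylor_global e : 0 < e -> exists2 C, 0 <= C & forall y, 0 <= y <= 1 ->
  `|f y - taylor_poly y| <= e * (y - x) ^+ 4 + C * (y - x) ^+ 6.
Proof.
have E4 (y : R) : `|y - x| ^+ 4 = (y - x) ^+ 4.
  by rewrite -[4%N]/(2 * 2)%N exprM real_normK ?num_real// -exprM.
have E6 (y : R) : `|y - x| ^+ 6 = (y - x) ^+ 6.
  by rewrite -[6%N]/(2 * 3)%N exprM real_normK ?num_real// -exprM.
move=> e0; have [||C C0 hC] := @local_to_global taylor_poly
  (\sum_(j < 5) `|d j x / j`!%:R|) 4 6 _ _ e e0.
- move=> y y01; rewrite /taylor_poly (le_trans (ler_norm_sum _ _ _))// ler_sum// => j _.
  rewrite normrM ler_piMr// normrX exprn_ile1//.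
  by rewrite ler_norml; have /andP[] := x01; have /andP[] := y01; lra.
- move=> e' e'0; have [r r0 hr] := taylor_local e'0.
  by exists r => // y yr _; rewrite E4; exact: hr.
- by exists C => // y y01; rewrite -E4 -E6; exact: hC.
Qed.

(** The same passage with k = 0 and n = 2, starting from continuity of f at x. *)
Lemma quadratic_global e : 0 < e -> exists2 C, 0 <= C & forall y, 0 <= y <= 1 ->
  `|f y - f x| <= e + C * (y - x) ^+ 2.
Proof.
move=> e0; have x01' : 0 <= x <= 1 by case/andP: x01 => ? ?; rewrite !ltW.
have [||C C0 hC] := @local_to_global (fun=> f x) `|f x| 0 2 _ _ e e0.
- by [].
- move=> e' e'0.
  have cd0 : {within `[0, 1]%classic, continuous (d 0%N)}.
    by apply: (derivative_within_continuous (dd (isT : 0 < 4)%N)).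
  have Ax : `[0, 1]%classic x by rewrite in01.
  have /subspace_continuousP/(_ x Ax)/cvgrPdist_le/(_ e' e'0) [r /= r0 hr] := cd0.
  exists r => // y yr y01; rewrite expr0 mulr1 -!d0f ?in01// distrC.
  by apply: hr => /=; rewrite ?in_itv//= distrC.
- exists C => // y y01; have := hC y y01.
  by rewrite expr0 mulr1 real_normK ?num_real.
Qed.

End taylor_within.

(** * Moments of the estimator *)

Section bounded_random_variables.
Context (d : measure_display) (T : measurableType d) (R : realType).
Variable P : probability T R.
Implicit Types Y : T -> R.

(** Boundedness gives integrability and, unlike it, is stable under products. *)
Definition bounded_rv Y := measurable_fun [set: T] Y /\ exists K, forall w, `|Y w| <= K.

Lemma bounded_rv_integrable Y : bounded_rv Y -> P.-integrable [set: T] (EFin \o Y).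
Proof.
move=> [mY [K hK]]; apply: measurable_bounded_integrable => //.
  by apply: (le_lt_trans (probability_le1 P _)) => //; exact: ltry.
exists K; split; first exact: num_real.
by move=> r Kr w _ /=; rewrite (le_trans (hK w))// ltW.
Qed.

Lemma bounded_rv_cst (c : R) : bounded_rv (fun=> c).
Proof. by split; [exact: measurable_cst|exists `|c|]. Qed.

Lemma bounded_rvM Y1 Y2 : bounded_rv Y1 -> bounded_rv Y2 ->
  bounded_rv (fun w => Y1 w * Y2 w).
Proof.
move=> [m1 [K1 h1]] [m2 [K2 h2]]; split; first exact: measurable_funM.
by exists (K1 * K2) => w; rewrite normrM ler_pM.
Qed.

Lemma bounded_rvD Y1 Y2 : bounded_rv Y1 -> bounded_rv Y2 ->
  bounded_rv (fun w => Y1 w + Y2 w).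
Proof.
move=> [m1 [K1 h1]] [m2 [K2 h2]]; split; first exact: measurable_funD.
by exists (K1 + K2) => w; rewrite (le_trans (ler_normD _ _))// lerD.
Qed.

Lemma bounded_rvZ (c : R) Y : bounded_rv Y -> bounded_rv (fun w => c * Y w).
Proof. exact: bounded_rvM (bounded_rv_cst c). Qed.

Lemma bounded_rv_sum (I : finType) (Y : I -> T -> R) :
  (forall i, bounded_rv (Y i)) -> bounded_rv (fun w => \sum_i Y i w).
Proof.
move=> hY; elim: (index_enum I) => [|i s IH].
  by under eq_fun do rewrite big_nil; exact: bounded_rv_cst.
by under eq_fun do rewrite big_cons; exact: bounded_rvD.
Qed.

Lemma bounded_rv_indic (A : set T) : measurable A -> bounded_rv (\1_A : T -> R).
Proof.
move=> mA; split; first exact: measurable_indic.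
by exists 1 => w; rewrite indicE normr_nat lern1 leq_b1.
Qed.

Lemma measurable_rv_preimage (Z : {RV P >-> R}) (B : set R) : measurable B ->
  measurable (Z @^-1` B).
Proof. by move=> mB; rewrite -[X in measurable X]setTI; exact: measurable_funP. Qed.

Lemma indic_rv_preimage (Z : {RV P >-> R}) (B : set R) :
  (fun w => \1_B (Z w)) = \1_(Z @^-1` B) :> (T -> R).
Proof. by apply/funext => w; rewrite !indicE. Qed.

Lemma bounded_rv_indic_comp (Z : {RV P >-> R}) (B : set R) : measurable B ->
  bounded_rv (fun w => \1_B (Z w) : R).
Proof.
move=> mB; rewrite indic_rv_preimage.
by apply: bounded_rv_indic; exact: measurable_rv_preimage.
Qed.

Definition rexp Y : R := fine ('E_P[Y])%E.

Lemma rexpE Y : rexp Y = \int[P]_w Y w.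
Proof. by rewrite /rexp expectation.unlock. Qed.

Lemma rexp_cst (c : R) : rexp (fun=> c) = c.
Proof. by rewrite /rexp (expectation_cst P c). Qed.

Lemma rexpD Y1 Y2 : bounded_rv Y1 -> bounded_rv Y2 ->
  rexp (fun w => Y1 w + Y2 w) = rexp Y1 + rexp Y2.
Proof.
by move=> b1 b2; rewrite !rexpE RintegralD//; exact: bounded_rv_integrable.
Qed.

Lemma rexpZ (c : R) Y : bounded_rv Y -> rexp (fun w => c * Y w) = c * rexp Y.
Proof.
by move=> b1; rewrite !rexpE RintegralZl//; exact: bounded_rv_integrable.
Qed.

Lemma rexp_sum (I : finType) (Y : I -> T -> R) : (forall i, bounded_rv (Y i)) ->
  rexp (fun w => \sum_i Y i w) = \sum_i rexp (Y i).
Proof.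
move=> hY; elim: (index_enum I) => [|i s IH].
  by rewrite big_nil; under eq_fun do rewrite big_nil; exact: rexp_cst.
rewrite big_cons -IH; under eq_fun do rewrite big_cons.
rewrite rexpD//; elim: s {IH} => [|j s IH].
  by under eq_fun do rewrite big_nil; exact: bounded_rv_cst.
by under eq_fun do rewrite big_cons; exact: bounded_rvD.
Qed.

Lemma rexp_indic (A : set T) : measurable A -> rexp (\1_A : T -> R) = fine (P A).
Proof. by move=> mA; rewrite /rexp expectation_indic. Qed.

Lemma rexp_quadratic Y (c : R) : bounded_rv Y ->
  rexp (fun w => (Y w - c) ^+ 2) = rexp (fun w => Y w * Y w) - 2 * c * rexp Y + c ^+ 2.
Proof.
move=> bY; have -> : (fun w => (Y w - c) ^+ 2) =
    (fun w => (Y w * Y w + (- 2 * c) * Y w) + c ^+ 2).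
  by apply/funext => w; ring.
have bYY := bounded_rvM bY bY; have bcY := bounded_rvZ (- 2 * c) bY.
rewrite (rexpD (bounded_rvD bYY bcY) (bounded_rv_cst _)) (rexpD bYY bcY) rexpZ//.
by rewrite rexp_cst; ring.
Qed.

Lemma varE Y : bounded_rv Y -> var P Y = rexp (fun w => Y w * Y w) - rexp Y ^+ 2.
Proof.
move=> bY; transitivity (rexp (fun w => (Y w - rexp Y) ^+ 2)).
  rewrite /var /variance covariance.unlock /rexp; apply: congr1.
  apply: (congr1 (fun Z : T -> R => 'E_P[Z])%E).
  by apply/funext => w /=; rewrite expr2.
by rewrite rexp_quadratic//; ring.
Qed.

Lemma mseE Y (t : R) : bounded_rv Y -> mse P Y t = var P Y + bias P Y t ^+ 2.
Proof.
move=> bY; rewrite varE// /bias -/(rexp Y).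
transitivity (rexp (fun w => (Y w - t) ^+ 2)); first by [].
by rewrite rexp_quadratic//; ring.
Qed.

End bounded_random_variables.

(** * Z as a step function of the observation *)

Section grid_functions.
Context {R : realType}.

Definition grid_cell (N k : nat) : set R := `]k%:R / N%:R, k.+1%:R / N%:R]%classic.

Definition grid_fun (N : nat) (c : nat -> R) (y : R) : R :=
  \sum_(k < N) c k * \1_(grid_cell N k) y.

Lemma grid_cell_disjoint N j k : j != k -> grid_cell N j `&` grid_cell N k = set0.
Proof.
move=> jk; have [->|N0] := posnP N.
  by rewrite /grid_cell invr0 !mulr0 set_itvoc0// set0I.
have N0' : 0 < N%:R :> R by rewrite ltr0n.
wlog ltjk : j k jk / (j < k)%N.
  move=> h; have [lt|lt] : (j < k)%N \/ (k < j)%N by lia.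
    exact: h.
  by rewrite setIC; apply: h => //; rewrite eq_sym.
rewrite -subset0 /grid_cell => y []/=; rewrite !in_itv/= => /andP[_ h1] /andP[h2 _].
have := lt_le_trans h2 h1; rewrite ltr_pM2r ?invr_gt0// ltr_nat; lia.
Qed.

Lemma indic_grid_mul N j k (y : R) : \1_(grid_cell N j) y * \1_(grid_cell N k) y =
  (j == k)%:R * \1_(grid_cell N j) y :> R.
Proof.
have [->|jk] := eqVneq j k; first by rewrite mul1r !indicE -natrM mulnb andbb.
rewrite mul0r -[LHS]/((\1_(grid_cell N j) \* \1_(grid_cell N k)) y) -indicI.
by rewrite grid_cell_disjoint// indic0.
Qed.

(** The cells are disjoint, so the cross products vanish. *)
Lemma grid_fun_sqr N c y : grid_fun N c y * grid_fun N c y =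
  grid_fun N (fun k => c k ^+ 2) y.
Proof.
rewrite /grid_fun mulr_suml; apply: eq_bigr => j _; rewrite mulr_sumr (bigD1 j)//= big1 ?addr0.
  by rewrite mulrACA indic_grid_mul eqxx mul1r expr2.
move=> k kj; rewrite mulrACA indic_grid_mul.
have -> : (j == k :> nat) = false by apply/negbTE; rewrite eq_sym.
by rewrite mul0r mulr0.
Qed.

Lemma bernstein_TE m (x y : R) :
  bernstein_T m x y = grid_fun m (fun k => m%:R * bernstein k m.-1 x) y.
Proof. by rewrite /bernstein_T mulr_sumr; apply: eq_bigr => k _; ring. Qed.

Lemma grid_cell_half i j : grid_cell i.+1 j =
  grid_cell i.*2.+2 j.*2 `|` grid_cell i.*2.+2 j.*2.+1.
Proof.
have E (a : nat) : a%:R / i.+1%:R = a.*2%:R / i.*2.+2%:R :> R.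
  rewrite -doubleS -!muln2 !natrM; field.
  by rewrite nat1r pnatr_eq0.
rewrite /grid_cell !E -itv_bndbnd_setU// bnd_simp ler_pM2r ?invr_gt0// ler_nat; lia.
Qed.

(** Each coarse cell is the union of two fine ones, so both terms of Z are step functions on the
    fine grid and Z can be squared coefficientwise. *)
Lemma bernstein_ZE i (x y : R) : bernstein_Z i.*2.+2 x y =
  grid_fun i.*2.+2 (fun k => 2 * (i.*2.+2%:R * bernstein k i.*2.+1 x) -
                             i.+1%:R * bernstein k./2 i x) y.
Proof.
rewrite /bernstein_Z !bernstein_TE /= doubleK /grid_fun.
have -> : \sum_(k < i.+1) i.+1%:R * bernstein k i x * \1_(grid_cell i.+1 k) y =
  \sum_(k < i.*2.+2) i.+1%:R * bernstein k./2 i x * \1_(grid_cell i.*2.+2 k) y.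
  apply/esym/(etrans (big_pairs i.+1 (fun k => i.+1%:R * bernstein k./2 i x *
     \1_(grid_cell i.*2.+2 k) y))); apply: eq_bigr => j _.
  rewrite doubleK /= uphalf_double -mulrDr; congr (_ * _).
  rewrite (grid_cell_half i j) !indicE in_setU.
  have := indic_grid_mul i.*2.+2 j.*2 j.*2.+1 y.
  rewrite !indicE (_ : j.*2 == j.*2.+1 = false) ?mul0r; last by apply/eqP; lia.
  case: (_ \in _); case: (_ \in _); rewrite /= ?addr0 ?add0r ?mulr1//.
  by move=> /eqP; rewrite oner_eq0.
by rewrite mulr_sumr -sumrB; apply: eq_bigr => k _; ring.
Qed.

End grid_functions.

(** * Masses that an observation gives to cells *)

Section observation_law.
Context (d : measure_display) (T : measurableType d) (R : realType).
Variables (P : probability T R) (X : nat -> {RV P >-> R}) (f : R -> R).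
Hypothesis hX : iid_sample X f.

(** Taken from the first observation; every X_n with n >= 1 gives the same value, the density being
    common. *)
Definition obs_cell (a b : R) : R := fine (P (X 1%N @^-1` `]a, b]%classic)).

Let dens n : (0 < n)%N -> has_density (X n) f.
Proof. by case: hX => _ + _; exact. Qed.

Let law n (B : set R) : (0 < n)%N -> measurable B ->
  P (X n @^-1` B) = (\int[lebesgue_measure]_(y in B) (f y)%:E)%E.
Proof. by move=> n0 mB; have [_ _ <-] := dens n0. Qed.

Lemma obs_cellE n a b : (0 < n)%N -> fine (P (X n @^-1` `]a, b]%classic)) = obs_cell a b.
Proof. by move=> n0; rewrite /obs_cell !law. Qed.

Lemma obs_cell_integral : cell_integral f obs_cell.
Proof.
move=> a b g G ab a0 b1 cg dG.
have [mf f0 _] := dens (isT : 0 < 1)%N.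
have If : lebesgue_measure.-integrable `]a, b]%classic (EFin \o f).
  apply/integrableP; split; first by apply/measurable_EFinP; exact: measurable_funTS.
  under eq_integral do rewrite /= ger0_norm//.
  by rewrite -(@law 1%N)//; apply: (le_lt_trans (probability_le1 P _)); rewrite ?ltry//; exact: measurable_rv_preimage.
have Ig : lebesgue_measure.-integrable `]a, b]%classic (EFin \o g).
  apply: (integrableS _ _ _ (@continuous_integrable_segment R a b g cg)) => //.
  by move=> y; rewrite /= !in_itv/= => /andP[h1 ->]; rewrite ltW.
have Eg : \int[lebesgue_measure]_(y in `]a, b]) g y = G b - G a.
  by rewrite Rintegral_itv_obnd_cbnd// (segment_FTC2 ab cg dG).
have Ef : obs_cell a b = \int[lebesgue_measure]_(y in `]a, b]) f y.
  by rewrite /obs_cell law.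
by split=> fg; rewrite -Eg Ef; apply: le_Rintegral => // y /=; rewrite in_itv/= => /andP[h1 h2];
  apply: fg; rewrite h2 ltW.
Qed.

Lemma obs_cellD a b c : a < b -> b < c -> obs_cell a c = obs_cell a b + obs_cell b c.
Proof.
move=> ab bc; rewrite /obs_cell.
have -> : X 1%N @^-1` `]a, c]%classic =
    X 1%N @^-1` `]a, b]%classic `|` X 1%N @^-1` `]b, c]%classic.
  by rewrite -preimage_setU -itv_bndbnd_setU// bnd_simp ltW.
rewrite measureU ?fineD ?fin_num_measure//; try exact: measurable_rv_preimage.
rewrite -preimage_setI; apply/seteqP; split=> // w []/=; rewrite !in_itv/=.
by move=> /andP[_ h1] /andP[h2 _]; move: (lt_le_trans h2 h1); rewrite ltxx.
Qed.

Lemma measurable_grid_cell N k : measurable (grid_cell N k : set R).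
Proof. exact: measurable_itv. Qed.

Let bgrid_term n N (c : nat -> R) (k : 'I_N) :
  bounded_rv (fun w => c k * \1_(grid_cell N k) (X n w)).
Proof. by apply: bounded_rvZ; apply: bounded_rv_indic_comp; exact: measurable_grid_cell. Qed.

Lemma bounded_rv_grid n N c : bounded_rv (fun w => grid_fun N c (X n w)).
Proof. by apply: bounded_rv_sum => k; exact: bgrid_term. Qed.

Lemma rexp_grid n N c : (0 < n)%N -> rexp P (fun w => grid_fun N c (X n w)) =
  \sum_(k < N) obs_cell (k%:R / N%:R) (k.+1%:R / N%:R) * c k.
Proof.
move=> n0; rewrite /grid_fun rexp_sum; last by move=> k; exact: bgrid_term.
apply: eq_bigr => k _; rewrite rexpZ; last by apply: bounded_rv_indic_comp; exact: measurable_grid_cell.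
rewrite mulrC -(@obs_cellE n)//; congr (_ * _).
by rewrite indic_rv_preimage rexp_indic//; apply: measurable_rv_preimage; exact: measurable_grid_cell.
Qed.

End observation_law.

(** * Recursions for the mean and the variance of the estimator *)

Section estimator_moments.
Context (d : measure_display) (T : measurableType d) (R : realType).
Variables (P : probability T R) (X : nat -> {RV P >-> R}) (f : R -> R).
Hypothesis hX : iid_sample X f.
Variables (gamma : nat -> R) (M : nat -> nat) (x : R).
Hypothesis hM : forall n, (0 < n)%N -> (0 < M n)%N /\ ~~ odd (M n).

Lemma independent_pair i j (A B : set R) : (0 < i)%N -> (0 < j)%N -> i != j ->
  measurable A -> measurable B ->
  P (X i @^-1` A `&` X j @^-1` B) = (P (X i @^-1` A) * P (X j @^-1` B))%E.
Proof.
move=> i0 j0 ij mA mB; have [indep _ _] := hX.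
pose S k := if k == i then A else B.
have -> : X i @^-1` A `&` X j @^-1` B = \bigcap_(k in [set` [:: i; j]]) X k @^-1` S k.
  rewrite /S; apply/seteqP; split=> [w [h1 h2] k /=|w h].
    by rewrite !inE => /orP[] /eqP ->; [rewrite eqxx|rewrite eq_sym (negbTE ij)].
  split; first by have := h i; rewrite /= !inE !eqxx; exact.
  by have := h j; rewrite /= !inE !eqxx orbT eq_sym (negbTE ij); exact.
rewrite indep; last 3 first.
- by rewrite /= inE ij.
- by move=> k; rewrite !inE => /orP[] /eqP ->.
- by move=> k; rewrite /S; case: ifP.
by rewrite !big_cons big_nil mule1 /S eqxx eq_sym (negbTE ij).
Qed.

Lemma rexp_indic_pair i j (A B : set R) : (0 < i)%N -> (0 < j)%N -> i != j ->
  measurable A -> measurable B ->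
  rexp P (fun w => \1_A (X i w) * \1_B (X j w)) =
  rexp P (fun w => \1_A (X i w)) * rexp P (fun w => \1_B (X j w)).
Proof.
move=> i0 j0 ij mA mB.
rewrite [X in _ = rexp P X * _]indic_rv_preimage [X in _ = _ * rexp P X]indic_rv_preimage.
have -> : (fun w => \1_A (X i w) * \1_B (X j w)) = \1_(X i @^-1` A `&` X j @^-1` B) :> (T -> R).
  by rewrite indicI -!indic_rv_preimage.
have mi := measurable_rv_preimage (X i) mA; have mj := measurable_rv_preimage (X j) mB.
rewrite !rexp_indic//; last exact: measurableI.
by rewrite independent_pair// fineM// fin_num_measure.
Qed.

Let EST := estimator gamma M (fun n => X n : T -> R) x.

(** The index i for which M_n = 2 i + 2: the degree of the Bernstein weights on the coarse grid. *)
Definition half_order n := (M n)./2.-1.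

Lemma half_orderE n : (0 < n)%N -> M n = (half_order n).*2.+2.
Proof.
move=> /hM [M0 Modd]; rewrite -doubleS /half_order prednK ?even_halfK//; lia.
Qed.

Let coef n (k : nat) : R := 2 * ((M n)%:R * bernstein k (M n).-1 x) -
  (half_order n).+1%:R * bernstein k./2 (half_order n) x.

Let ZE n w : (0 < n)%N -> bernstein_Z (M n) x (X n w) = grid_fun (M n) (coef n) (X n w).
Proof. by move=> n0; rewrite /coef (half_orderE n0) bernstein_ZE. Qed.

Let estS n w : EST n.+1 w = (1 - gamma n.+1) * EST n w +
  gamma n.+1 * grid_fun (M n.+1) (coef n.+1) (X n.+1 w).
Proof. by rewrite -ZE. Qed.

Lemma bounded_rv_estimator n : bounded_rv (EST n).
Proof.
elim: n => [|n IH]; first exact: bounded_rv_cst.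
rewrite (_ : EST n.+1 = fun w => (1 - gamma n.+1) * EST n w +
  gamma n.+1 * grid_fun (M n.+1) (coef n.+1) (X n.+1 w)); last by apply/funext => w; exact: estS.
by apply: bounded_rvD; apply: bounded_rvZ => //; exact: bounded_rv_grid.
Qed.

(** The estimator is affine in its predecessor and in Z, and Z is a linear combination of indicators
    of one observation. Induction on k therefore reduces the claim to products of indicators of two
    distinct observations. *)
Lemma rexp_estimator_indic k n (B : set R) : (k < n)%N -> measurable B ->
  rexp P (fun w => EST k w * \1_B (X n w)) = rexp P (EST k) * rexp P (fun w => \1_B (X n w)).
Proof.
move=> + mB; elim: k => [|k IH] kn.
  rewrite [X in rexp P X = _](_ : _ = fun=> 0); last by apply/funext => w; rewrite mul0r.
  by rewrite [X in _ = rexp P X * _](_ : _ = fun=> 0)// rexp_cst mul0r.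
have bn := bounded_rv_indic_comp (X n) mB; have be := bounded_rv_estimator k.
have bg := bounded_rv_grid X k.+1 (M k.+1) (coef k.+1).
have n0 : (0 < n)%N by apply: leq_ltn_trans kn.
rewrite [X in rexp P X = _](_ : _ = fun w => (1 - gamma k.+1) * (EST k w * \1_B (X n w)) +
  gamma k.+1 * (grid_fun (M k.+1) (coef k.+1) (X k.+1 w) * \1_B (X n w))); last first.
  by apply/funext => w; rewrite estS; ring.
rewrite [X in _ = rexp P X * _](_ : _ = fun w => (1 - gamma k.+1) * EST k w +
  gamma k.+1 * grid_fun (M k.+1) (coef k.+1) (X k.+1 w)); last first.
  by apply/funext => w; rewrite estS.
rewrite rexpD ?rexpD; try by repeat (apply: bounded_rvZ || apply: bounded_rvM).
rewrite !rexpZ//; try exact: bounded_rvM.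
rewrite IH ?(ltnW kn)//.
have -> : rexp P (fun w => grid_fun (M k.+1) (coef k.+1) (X k.+1 w) * \1_B (X n w)) =
  rexp P (fun w => grid_fun (M k.+1) (coef k.+1) (X k.+1 w)) * rexp P (fun w => \1_B (X n w)).
  have bk j : bounded_rv (fun w => \1_(grid_cell (M k.+1) j) (X k.+1 w) : R).
    by apply: bounded_rv_indic_comp; exact: measurable_grid_cell.
  rewrite [X in rexp P X = _](_ : _ = fun w => \sum_(j < M k.+1) coef k.+1 j *
     (\1_(grid_cell (M k.+1) j) (X k.+1 w) * \1_B (X n w))); last first.
    by apply/funext => w; rewrite /grid_fun mulr_suml; apply: eq_bigr => j _; ring.
  rewrite rexp_sum; last by move=> j; apply: bounded_rvZ; exact: bounded_rvM.
  rewrite /grid_fun rexp_sum; last by move=> j; apply: bounded_rvZ.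
  rewrite mulr_suml; apply: eq_bigr => j _.
  rewrite rexpZ; last exact: bounded_rvM.
  rewrite rexpZ; last exact: bk.
  rewrite rexp_indic_pair//; [ring| |exact: measurable_grid_cell].
  by rewrite neq_ltn kn.
ring.
Qed.

Let Zmean n := rexp P (fun w => bernstein_Z (M n) x (X n w)).

Lemma rexp_estimator_Z n :
  rexp P (fun w => EST n w * bernstein_Z (M n.+1) x (X n.+1 w)) =
  rexp P (EST n) * rexp P (fun w => bernstein_Z (M n.+1) x (X n.+1 w)).
Proof.
under eq_fun do rewrite ZE//; under [in RHS]eq_fun do rewrite ZE//.
have be := bounded_rv_estimator n.
have bk j : bounded_rv (fun w => \1_(grid_cell (M n.+1) j) (X n.+1 w) : R).
  by apply: bounded_rv_indic_comp; exact: measurable_grid_cell.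
rewrite [X in rexp P X = _](_ : _ = fun w => \sum_(j < M n.+1) coef n.+1 j *
   (EST n w * \1_(grid_cell (M n.+1) j) (X n.+1 w))); last first.
  by apply/funext => w; rewrite /grid_fun mulr_sumr; apply: eq_bigr => j _; ring.
rewrite rexp_sum; last by move=> j; apply: bounded_rvZ; exact: bounded_rvM.
rewrite /grid_fun rexp_sum; last by move=> j; apply: bounded_rvZ.
rewrite mulr_sumr; apply: eq_bigr => j _.
rewrite rexpZ; last exact: bounded_rvM.
rewrite rexpZ; last exact: bk.
rewrite rexp_estimator_indic//; [ring|exact: measurable_grid_cell].
Qed.

Let bZ n : (0 < n)%N -> bounded_rv (fun w => bernstein_Z (M n) x (X n w)).
Proof. by move=> n0; under eq_fun do rewrite ZE//; exact: bounded_rv_grid. Qed.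

Lemma rexp_estimatorS n : rexp P (EST n.+1) =
  (1 - gamma n.+1) * rexp P (EST n) + gamma n.+1 * Zmean n.+1.
Proof.
have be := bounded_rv_estimator n; have bz := @bZ n.+1 isT.
by rewrite /EST /= -/EST rexpD ?rexpZ//; exact: bounded_rvZ.
Qed.

Lemma bias_estimatorS n t : bias P (EST n.+1) t =
  (1 - gamma n.+1) * bias P (EST n) t + gamma n.+1 * (Zmean n.+1 - t).
Proof. by rewrite /bias -!/(rexp P _) rexp_estimatorS; ring. Qed.

Lemma var_estimatorS n : var P (EST n.+1) = (1 - gamma n.+1) ^+ 2 * var P (EST n) +
  gamma n.+1 ^+ 2 * (rexp P (fun w => bernstein_Z (M n.+1) x (X n.+1 w) ^+ 2) - Zmean n.+1 ^+ 2).
Proof.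
have be := bounded_rv_estimator n; have bz := @bZ n.+1 isT.
have bee := bounded_rvM be be; have bzz := bounded_rvM bz bz; have bez := bounded_rvM be bz.
rewrite varE; last exact: bounded_rv_estimator.
rewrite varE// rexp_estimatorS.
rewrite [X in rexp P X - _](_ : _ = fun w => ((1 - gamma n.+1) ^+ 2 * (EST n w * EST n w) +
   (2 * (1 - gamma n.+1) * gamma n.+1) * (EST n w * bernstein_Z (M n.+1) x (X n.+1 w))) +
   gamma n.+1 ^+ 2 * (bernstein_Z (M n.+1) x (X n.+1 w) * bernstein_Z (M n.+1) x (X n.+1 w)));
  last by apply/funext => w; rewrite /EST /= -/EST; ring.
rewrite rexpD ?rexpD ?rexpZ//; try exact: bounded_rvZ.
  rewrite rexp_estimator_Z -/(Zmean _); under eq_fun do rewrite -expr2.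
  ring.
by apply: bounded_rvD; exact: bounded_rvZ.
Qed.

Lemma rexp_Z n : (0 < n)%N -> Zmean n =
  2 * cell_mean x (obs_cell X) (M n) - cell_mean x (obs_cell X) (half_order n).+1.
Proof.
move=> n0; rewrite /Zmean /bernstein_Z.
have -> : (M n)./2 = (half_order n).+1 by rewrite (half_orderE n0) /= doubleK.
have bT m : bounded_rv (fun w => bernstein_T m x (X n w)).
  by under eq_fun do rewrite bernstein_TE; exact: bounded_rv_grid.
have eT m : rexp P (fun w => bernstein_T m x (X n w)) = cell_mean x (obs_cell X) m.
  under eq_fun do rewrite bernstein_TE.
  rewrite (rexp_grid hX)// /cell_mean mulr_sumr; apply: eq_bigr => k _; ring.
under eq_fun do rewrite -mulN1r.
rewrite (rexpD P (bounded_rvZ 2 (bT _)) (bounded_rvZ (-1) (bT _))).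
rewrite (rexpZ P 2 (bT _)) (rexpZ P (-1) (bT _)) !eT.
by rewrite mulN1r.
Qed.

Lemma rexp_Z_sqr n : (0 < n)%N -> rexp P (fun w => bernstein_Z (M n) x (X n w) ^+ 2) =
  cell_sqr_mean x (obs_cell X) (half_order n).
Proof.
move=> n0; under eq_fun do rewrite ZE// expr2 grid_fun_sqr.
by rewrite (rexp_grid hX)// /cell_sqr_mean /coef (half_orderE n0).
Qed.

End estimator_moments.

(** * Rates *)

Section rates.
Context {R : realType}.
Variables (gamma m : nat -> R) (alpha a : R) (L : \bar R) (xi : R).
Hypothesis halpha : 1 / 2 < alpha <= 1.
Hypothesis hgamma : GS (- alpha) gamma.
Hypothesis ha : 0 < a < 1.
Hypothesis hm : GS a m.
Hypothesis hL : (n%:R * gamma n)%:E @[n --> \oo] --> L.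
Hypothesis hLmin : ((Num.min (2 * a) ((2 * alpha - a) / 4))%:E < L)%E.
Hypothesis hxi : (n%:R * gamma n)^-1 @[n --> \oo] --> xi.

Let al1 : 1 / 2 < alpha. Proof. by case/andP: halpha. Qed.
Let al2 : alpha <= 1. Proof. by case/andP: halpha. Qed.
Let a0 : 0 < a. Proof. by case/andP: ha. Qed.
Let a1 : a < 1. Proof. by case/andP: ha. Qed.

Ltac lra_par := have := al1; have := al2; have := a0; have := a1; lra.

Let gamma_gt0 n : (0 < n)%N -> 0 < gamma n. Proof. by case: hgamma => h _; exact: h. Qed.
Let m_gt0 n : (0 < n)%N -> 0 < m n. Proof. by case: hm => h _; exact: h. Qed.

Let gamma_cvg0 : gamma n @[n --> \oo] --> (0 : R).
Proof. apply: (GS_cvg0 _ hgamma); lra_par. Qed.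

Lemma stepsize_eventually_ge (t : R) : (t%:E < L)%E ->
  \forall n \near \oo, t <= n%:R * gamma n.
Proof.
case: L hL => [r hr|hy _|]; last by rewrite ltNge leNye.
  rewrite lte_fin => tr; have {}hr : n%:R * gamma n @[n --> \oo] --> r.
    by move/fine_cvgP : hr => [_].
  exact: (cvgr_ge _ hr).
by move/cvgeyPge : hy => /(_ t); apply: filterS => n; rewrite lee_fin.
Qed.

(** Some t' strictly between t and L is eventually below n gamma_n, so xi <= 1 / t' < 1 / t. The
    detour through t' keeps the inequality strict and covers L = +oo. *)
Lemma stepsize_limit_lt1 (t : R) : 0 < t -> (t%:E < L)%E -> t * xi < 1.
Proof.
move=> t0 tL; have [t' tt' tL'] : exists2 t', t < t' & (t'%:E < L)%E.
  case: L tL => [r| |//]; rewrite ?lte_fin => tr.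
    by exists ((t + r) / 2); rewrite ?lte_fin; lra_par.
  by exists (t + 1); rewrite ?ltry//; lra_par.
have t'0 : 0 < t' by exact: lt_trans tt'.
have xit : xi <= t'^-1.
  apply: (cvgr_to_le hxi); near=> n.
  have tn : t' <= n%:R * gamma n by near: n; exact: stepsize_eventually_ge.
  by rewrite lef_pV2 ?posrE// (lt_le_trans t'0).
apply: (@le_lt_trans _ _ (t * t'^-1)); first by rewrite ler_wpM2l// ltW.
by rewrite ltr_pdivrMr// mul1r.
Unshelve. all: by end_near. Qed.

Let c0 := Num.min (2 * a) ((2 * alpha - a) / 4).
Let c00 : 0 < c0.
Proof. by rewrite /c0 lt_min; apply/andP; split; lra_par. Qed.

Let stepsize_cvg kap u w v (c K s : R) :
  kap n / gamma n @[n --> \oo] --> K ->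
  GS c v -> 0 < K + c * xi ->
  (forall n, (0 < n)%N -> u n = (1 - kap n) * u n.-1 + gamma n * w n) ->
  w n / v n @[n --> \oo] --> s -> u n / v n @[n --> \oo] --> s / (K + c * xi).
Proof.
move=> hK Gv Kc hu hw.
exact: (GS_stepsize_cvg gamma_gt0 gamma_cvg0 c00 (stepsize_eventually_ge hLmin) hxi hK Gv Kc hu hw).
Qed.

Let kap1 : gamma n / gamma n @[n --> \oo] --> (1 : R).
Proof.
apply: (cvg_trans _ (@cvgn_cst R 1)); apply: near_eq_cvg; near=> n.
by rewrite divff// gt_eqF// gamma_gt0//; near: n; exact: nbhs_infty_gt.
Unshelve. all: by end_near. Qed.

Let kap2 : (1 - (1 - gamma n) ^+ 2) / gamma n @[n --> \oo] --> (2 : R).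
Proof.
have : 2 - gamma n @[n --> \oo] --> (2 - 0 : R) by apply: cvgB => //; exact: cvg_cst.
rewrite subr0; apply: cvg_trans; apply: near_eq_cvg; near=> n.
have g0 : 0 < gamma n by apply: gamma_gt0; near: n; exact: nbhs_infty_gt.
by field; rewrite gt_eqF.
Unshelve. all: by end_near. Qed.

Definition varscale n := gamma n * Num.sqrt (m n).

Lemma GS_varscale : GS (- alpha + a / 2) varscale.
Proof. exact: GS_mul hgamma (GS_sqrt hm). Qed.

Lemma min_small : a <= 2 / 9 * alpha -> ((2 * a)%:E < L)%E.
Proof. by move=> h; move: hLmin; rewrite min_l//; lra_par. Qed.

Lemma min_large : 2 / 9 * alpha <= a -> (((2 * alpha - a) / 4)%:E < L)%E.
Proof. by move=> h; move: hLmin; rewrite min_r//; lra_par. Qed.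

Lemma bias_factor_gt0 : ((2 * a)%:E < L)%E -> 0 < 1 - 2 * a * xi.
Proof. by move=> /stepsize_limit_lt1; rewrite subr_gt0; apply; lra_par. Qed.

Lemma var_factor_gt0 : (((2 * alpha - a) / 4)%:E < L)%E -> 0 < 4 - (2 * alpha - a) * xi.
Proof.
move=> /stepsize_limit_lt1 h.
have : (2 * alpha - a) / 4 * xi < 1 by apply: h; lra_par.
lra_par.
Qed.

Variables (Bias w Var v : nat -> R) (D C : R).
Hypothesis hBias : forall n, (0 < n)%N -> Bias n = (1 - gamma n) * Bias n.-1 + gamma n * w n.
Hypothesis hw : w n / m n ^- 2 @[n --> \oo] --> - (2 * D).
Hypothesis hVar : forall n, (0 < n)%N ->
  Var n = (1 - gamma n) ^+ 2 * Var n.-1 + gamma n ^+ 2 * v n.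
Hypothesis hv : v n / Num.sqrt (m n) @[n --> \oo] --> C.

(** The scale m^-2 has exponent - 2 a, and K = 1. *)
Lemma bias_rate : ((2 * a)%:E < L)%E ->
  Bias n / m n ^- 2 @[n --> \oo] --> - (2 * D) / (1 - 2 * a * xi).
Proof.
move=> hl; have h0 := bias_factor_gt0 hl.
have -> : 1 - 2 * a * xi = 1 + - (a *+ 2) * xi by rewrite mulr2n; ring.
apply: (stepsize_cvg kap1 (GS_inv (GS_exp 2 hm)) _ hBias hw).
by move: h0; rewrite mulr2n; lra_par.
Qed.

(** The scale has exponent - (2 alpha - a) / 4, so K + c xi is a quarter of 4 - (2 alpha - a) xi.
    The source relative to it has exponent alpha / 2 - 9 a / 4, negative exactly when a > 2 alpha /
    9. *)
Lemma bias_negligible : 2 / 9 * alpha < a ->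
  Bias n / Num.sqrt (varscale n) @[n --> \oo] --> (0 : R).
Proof.
move=> al; have h0 := var_factor_gt0 (min_large (ltW al)).
have Gs := GS_sqrt GS_varscale.
rewrite -[X in _ --> X](mul0r (1 + (- alpha + a / 2) / 2 * xi)^-1).
apply: (stepsize_cvg kap1 Gs _ hBias); first by lra_par.
have hz : m n ^- 2 / Num.sqrt (varscale n) @[n --> \oo] --> (0 : R).
  apply: (GS_cvg0 _ (GS_mul (GS_inv (GS_exp 2 hm)) (GS_inv Gs))).
  rewrite mulr2n; lra_par.
have := cvgn_mul hw hz; rewrite mulr0; apply: cvg_trans; apply: near_eq_cvg; near=> n.
have m0 : 0 < m n by apply: m_gt0; near: n; exact: nbhs_infty_gt.
by rewrite mulrA divfK// gt_eqF// invr_gt0 exprn_gt0.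
Unshelve. all: by end_near. Qed.

Let hVar' (z : nat -> R) : (forall n, gamma n * z n = gamma n ^+ 2 * v n) ->
  forall n, (0 < n)%N -> Var n = (1 - (1 - (1 - gamma n) ^+ 2)) * Var n.-1 + gamma n * z n.
Proof. by move=> hz n n0; rewrite hz hVar// subKr. Qed.

(** Here K = 2 and c = - alpha + a / 2, so K + c xi is half of 4 - (2 alpha - a) xi, whence the
    factor 2 in the limit. *)
Lemma var_rate : (((2 * alpha - a) / 4)%:E < L)%E ->
  Var n / varscale n @[n --> \oo] --> C * (2 / (4 - (2 * alpha - a) * xi)).
Proof.
move=> hl; have h0 := var_factor_gt0 hl.
have -> : C * (2 / (4 - (2 * alpha - a) * xi)) = C / (2 + (- alpha + a / 2) * xi).
  by field; rewrite !gt_eqF//; lra_par.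
apply: (stepsize_cvg kap2 GS_varscale _ (@hVar' (fun n => gamma n * v n) _)).
- lra_par.
- by move=> n; ring.
apply: cvg_trans hv; apply: near_eq_cvg; near=> n.
have n0 : (0 < n)%N by near: n; exact: nbhs_infty_gt.
rewrite /varscale; field.
by rewrite !gt_eqF ?sqrtr_gt0 ?m_gt0 ?gamma_gt0.
Unshelve. all: by end_near. Qed.

(** On the scale m^-4, K + c xi = 2 (1 - 2 a xi). The source relative to it has exponent - alpha + 9
    a / 2, negative exactly when a < 2 alpha / 9. *)
Lemma var_negligible : a < 2 / 9 * alpha -> Var n / m n ^- 4 @[n --> \oo] --> (0 : R).
Proof.
move=> al; have h0 := bias_factor_gt0 (min_small (ltW al)).
rewrite -[X in _ --> X](mul0r (2 + - (a *+ 4) * xi)^-1).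
apply: (stepsize_cvg kap2 (GS_inv (GS_exp 4 hm)) _ (@hVar' (fun n => gamma n * v n) _)).
- by rewrite -mulr_natl; lra_par.
- by move=> n; ring.
have hz : varscale n * m n ^+ 4 @[n --> \oo] --> (0 : R).
  apply: (GS_cvg0 _ (GS_mul GS_varscale (GS_exp 4 hm))).
  rewrite -mulr_natl; lra_par.
have := cvgn_mul hv hz; rewrite mulr0; apply: cvg_trans; apply: near_eq_cvg; near=> n.
have n0 : (0 < n)%N by near: n; exact: nbhs_infty_gt.
rewrite /varscale invrK; field.
by rewrite !gt_eqF ?sqrtr_gt0 ?m_gt0.
Unshelve. all: by end_near. Qed.

End rates.

(** * From limits of ratios to Landau notation *)

Section landau.
Context {R : realType}.
Implicit Types f g e : nat -> R.

Lemma eqaddo_of_near f g e :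
  (forall eps, 0 < eps -> \forall n \near \oo, `|f n - g n| <= eps * e n) ->
  f = g +o_\oo e.
Proof.
move=> h; apply/eqaddoP => eps eps0; have := h _ eps0; apply: filterS => n /= hn.
by apply: (le_trans hn); rewrite ler_wpM2l ?ler_norm// ltW.
Qed.

Lemma near_of_cvg f e (l : R) : (forall n, (0 < n)%N -> 0 < e n) ->
  f n / e n @[n --> \oo] --> l ->
  forall eps, 0 < eps -> \forall n \near \oo, `|f n - l * e n| <= eps * e n.
Proof.
move=> e0 /cvgrPdist_le hf eps eps0; near=> n.
have en0 : 0 < e n by apply: e0; near: n; exact: nbhs_infty_gt.
have -> : f n - l * e n = (f n / e n - l) * e n by field; rewrite gt_eqF.
rewrite normrM (gtr0_norm en0) ler_pM2r// distrC.
by near: n; exact: hf.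
Unshelve. all: by end_near. Qed.

Lemma eqaddo_of_cvg f g e (l : R) : (forall n, (0 < n)%N -> 0 < e n) ->
  (forall n, g n = l * e n) -> f n / e n @[n --> \oo] --> l -> f = g +o_\oo e.
Proof.
move=> e0 hg hf; apply: eqaddo_of_near => eps eps0.
by have := near_of_cvg e0 hf eps0; apply: filterS => n; rewrite hg.
Qed.

Lemma eqo_of_cvg f e : (forall n, (0 < n)%N -> 0 < e n) ->
  f n / e n @[n --> \oo] --> (0 : R) -> f =o_\oo e.
Proof.
move=> e0 hf; apply/eqoP => eps eps0; have := near_of_cvg e0 hf eps0.
apply: filterS => n; rewrite mul0r subr0 => hn.
by apply: (le_trans hn); rewrite ler_wpM2l ?ler_norm// ltW.
Qed.

End landau.

(** * Passage from the real orders m_n to the integer orders M_n *)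

Section orders.
Context {R : realType}.
Variables (m : nat -> R) (M : nat -> nat) (a : R).
Hypothesis a0 : 0 < a.
Hypothesis hm : GS a m.
Hypothesis hM : bernstein_orders m M.

Lemma cvg_inv_order : (M n)%:R^-1 @[n --> \oo] --> (0 : R).
Proof.
have hm0 : (m n)^-1 @[n --> \oo] --> (0 : R) by apply: (GS_cvg0 _ (GS_inv hm)); rewrite oppr_lt0.
have hr : ((M n)%:R / m n)^-1 @[n --> \oo] --> (1^-1 : R).
  by apply: cvgV; [exact: oner_neq0|exact: hM.2].
have := cvgn_mul hr hm0; rewrite mulr0; apply: cvg_trans; apply: near_eq_cvg; near=> n.
have n0 : (0 < n)%N by near: n; exact: nbhs_infty_gt.
have m0 : m n != 0 by rewrite gt_eqF// hm.1.
have M0 : (M n)%:R != 0 :> R by rewrite pnatr_eq0 -lt0n; case: (hM.1 n n0).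
by field; rewrite m0 M0.
Unshelve. all: by end_near. Qed.

Lemma cvg_half_order : half_order M n @[n --> \oo] --> \oo.
Proof.
apply/cvgnyPge => A; near=> n.
have n0 : (0 < n)%N by near: n; exact: nbhs_infty_gt.
have h : (M n)%:R^-1 <= (A.*2.+2)%:R^-1 :> R.
  by near: n; apply: (cvgr_le _ cvg_inv_order); rewrite invr_gt0.
have [M0 _] := hM.1 n n0.
move: h; rewrite lef_pV2 ?posrE ?ltr0n// ler_nat /half_order; lia.
Unshelve. all: by end_near. Qed.

Lemma cvg_order_comp (u : nat -> R) (l : R) : u i @[i --> \oo] --> l ->
  u (half_order M n) @[n --> \oo] --> l.
Proof. by move=> hu; apply: cvg_comp hu; exact: cvg_half_order. Qed.

End orders.

Section cell_asymptotics.
Context {R : realType}.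
Variables (x : R) (f : R -> R) (cell : R -> R -> R).
Hypothesis x01 : 0 < x < 1.
Hypothesis hcell : cell_integral f cell.

Lemma extrapolated_mean_cvg (q : nat -> R) :
  (forall e, 0 < e -> exists2 C, 0 <= C & forall y, 0 <= y <= 1 ->
     `|f y - \sum_(j < 5) q j * (y - x) ^+ j| <= e * (y - x) ^+ 4 + C * (y - x) ^+ 6) ->
  i.*2.+2%:R ^+ 2 * (2 * cell_mean x cell i.*2.+2 - cell_mean x cell i.+1 - q 0%N)
    @[i --> \oo] --> - (2 * second_order x (q 2) (q 3) (q 4)).
Proof.
move=> hq; have h := cell_mean_cvg x01 hcell hq.
have h2 := cvg_subsequence (nu := fun i => i.*2.+1) (fun i => ltac:(lia)) h.
(* Since m^2 = 4 (m / 2)^2, the coarse mean enters with weight - 4 and the fine one with weight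
   2. *)
have := cvgn_add (cvgn_mul (@cvgn_cst _ 2) h2) (cvgn_mul (@cvgn_cst _ (- 4)) h).
have -> : 2 * second_order x (q 2) (q 3) (q 4) + - 4 * second_order x (q 2) (q 3) (q 4) =
  - (2 * second_order x (q 2) (q 3) (q 4)) by ring.
apply: cvg_trans; apply: near_eq_cvg; near=> i.
have -> : i.*2.+2%:R = 2 * i.+1%:R :> R by rewrite -doubleS -mul2n natrM.
by field; rewrite nat1r pnatr_eq0.
Unshelve. all: by end_near. Qed.

End cell_asymptotics.

Theorem proposition1 (d : measure_display) (T : measurableType d)
    (R : realType) (P : probability T R) (X : nat -> {RV P >-> R}) (f : R -> R)
    (gamma m : nat -> R) (M : nat -> nat) (alpha a : R) (L : \bar R) (xi : R)
    (hX : iid_sample X f)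
    (hf : Ck_within 4 `[0, 1]%classic f)
    (halpha : 1 / 2 < alpha <= 1) (hgamma : GS (- alpha) gamma)
    (ha : 0 < a < 1) (hm : GS a m) (hM : bernstein_orders m M)
    (hL : (n%:R * gamma n)%:E @[n --> \oo] --> L)
    (hLmin : ((Num.min (2 * a) ((2 * alpha - a) / 4))%:E < L)%E)
    (hxi : (n%:R * gamma n)^-1 @[n --> \oo] --> xi)
    (x : R) (hx : 0 < x < 1) :
  let fn := estimator gamma M X x in
  let Bias := fun n => bias P (fn n) (f x) in
  let Var := fun n => var P (fn n) in
  let MSE := fun n => mse P (fn n) (f x) in
  let B :=
    Bias = (fun n => - (m n ^- 2 * (2 / (1 - 2 * a * xi)) * Delta2 f x))
           +o_\oo (fun n => m n ^- 2) in
  let V :=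
    Var = (fun n => C3 R * gamma n * Num.sqrt (m n) *
                    (2 / (4 - (2 * alpha - a) * xi)) * f x * psi x)
          +o_\oo (fun n => gamma n * Num.sqrt (m n)) in
  (* 1 *)
  ((a <= 2 / 9 * alpha -> B) /\
   (2 / 9 * alpha < a ->
      Bias =o_\oo (fun n => Num.sqrt (gamma n * Num.sqrt (m n))))) /\
  (* 2 *)
  ((2 / 9 * alpha <= a -> V) /\
   (a < 2 / 9 * alpha -> Var =o_\oo (fun n => m n ^- 4))) /\
  (* 3 *)
  (((Num.max (2 * a) ((2 * alpha - a) / 4))%:E < L)%E ->
     [/\ 0 < 1 - 2 * a * xi, 0 < 4 - (2 * alpha - a) * xi, B & V]) /\
  (* 4 *)
  [/\ a < 2 / 9 * alpha ->
        MSE = (fun n => Delta2 f x ^+ 2 * m n ^- 4 *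
                        (4 / (1 - 2 * a * xi) ^+ 2))
              +o_\oo (fun n => m n ^- 4),
      a = 2 / 9 * alpha ->
        MSE = (fun n => Delta2 f x ^+ 2 * m n ^- 4 *
                        (4 / (1 - 2 * a * xi) ^+ 2) +
                        C3 R * f x * psi x * gamma n * Num.sqrt (m n) *
                        (2 / (4 - (2 * alpha - a) * xi)))
              +o_\oo (fun n => m n ^- 4 + gamma n * Num.sqrt (m n))
    & 2 / 9 * alpha < a ->
        MSE = (fun n => C3 R * f x * psi x * gamma n * Num.sqrt (m n) *
                        (2 / (4 - (2 * alpha - a) * xi)))
              +o_\oo (fun n => gamma n * Num.sqrt (m n))].
Proof.
move=> fn Bias Var MSE B V.
have [a0 a1] := andP ha; have [al0 al1] := andP halpha.
have [dv [d0f dd cd4]] := hf.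
have hMp : forall n, (0 < n)%N -> (0 < M n)%N /\ ~~ odd (M n) := hM.1.
have m0 n : (0 < n)%N -> 0 < m n by exact: hm.1.
have g0 n : (0 < n)%N -> 0 < gamma n by exact: hgamma.1.
have M0 n : (0 < n)%N -> (M n)%:R != 0 :> R.
  by move=> n0; rewrite pnatr_eq0 -lt0n; case: (hMp n n0).
pose cell := obs_cell X.
have hcell : cell_integral f cell := obs_cell_integral hX.
have hcellD r s t : 0 <= r -> r < s -> s < t -> t <= 1 -> cell r t = cell r s + cell s t.
  by move=> _ rs st _; exact: obs_cellD.
have fx : dv 0%N x = f x by apply: d0f; rewrite /= in_itv/=; case/andP: hx => ? ?; rewrite !ltW.
have Mm : (M n)%:R / m n @[n --> \oo] --> (1 : R) := hM.2.
have mM : m n / (M n)%:R @[n --> \oo] --> (1 : R).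
  have : ((M n)%:R / m n)^-1 @[n --> \oo] --> (1^-1 : R).
    by apply: cvgV => //; exact: oner_neq0.
  rewrite invr1; apply: cvg_trans; apply: near_eq_cvg.
  by near=> n; rewrite /= invf_div.
pose Z n := rexp P (fun w => bernstein_Z (M n) x (X n w)).
pose Z2 n := rexp P (fun w => bernstein_Z (M n) x (X n w) ^+ 2).
have D2 : second_order x (dv 2 x / 2`!%:R) (dv 3 x / 3`!%:R) (dv 4 x / 4`!%:R) = Delta2 f x.
  rewrite /second_order /Delta2 !(derive1n_within d0f dd)//.
  by rewrite !factS fact0 !muln1; field.
(* Rates are obtained in terms of the integer order M_n, to which the cell estimates apply; M_n /
   m_n -> 1 then converts them to m_n. *)
have hw0 : (M n)%:R ^+ 2 * (Z n - f x) @[n --> \oo] --> - (2 * Delta2 f x).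
  have h := extrapolated_mean_cvg (q := fun j => dv j x / j`!%:R) hx hcell
    (taylor_global hx d0f dd cd4).
  rewrite /= D2 fact0 divr1 fx in h.
  have := cvg_order_comp a0 hm hM h; apply: cvg_trans; apply: near_eq_cvg; near=> n.
  have n0 : (0 < n)%N by near: n; exact: nbhs_infty_gt.
  by rewrite /Z (rexp_Z hX)// -/cell -(half_orderE hMp n0).
have hw : (Z n - f x) / m n ^- 2 @[n --> \oo] --> - (2 * Delta2 f x).
  have := cvgn_mul hw0 (cvgn_mul mM mM); rewrite !mulr1; apply: cvg_trans.
  apply: near_eq_cvg; near=> n; have n0 : (0 < n)%N by near: n; exact: nbhs_infty_gt.
  by rewrite invrK; field; rewrite M0.
have M1 := cvg_inv_order a0 hm hM.
have hZ : Z n @[n --> \oo] --> f x.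
  have := cvgn_add (cvgn_mul hw0 (cvgn_mul M1 M1)) (@cvgn_cst _ (f x)).
  rewrite !mulr0 add0r; apply: cvg_trans; apply: near_eq_cvg; near=> n.
  have n0 : (0 < n)%N by near: n; exact: nbhs_infty_gt.
  by field; rewrite M0.
have sM1 : (Num.sqrt (M n)%:R)^-1 @[n --> \oo] --> (0 : R).
  have := cvg_order_comp a0 hm hM
    (cvg_subsequence (nu := fun i => i.*2.+2) (fun i => ltac:(lia)) (@cvg_inv_sqrtn R)).
  apply: cvg_trans; apply: near_eq_cvg; near=> n.
  have n0 : (0 < n)%N by near: n; exact: nbhs_infty_gt.
  by rewrite -(half_orderE hMp n0).
have hv : (Z2 n - Z n ^+ 2) / Num.sqrt (m n) @[n --> \oo] --> C3 R * f x * psi x.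
  have h1 := cvg_order_comp a0 hm hM (cell_sqr_mean_cvg hx hcell hcellD
    (quadratic_global hx d0f dd)).
  have h2 : Num.sqrt ((M n)%:R / m n) @[n --> \oo] --> (1 : R).
    rewrite -[X in _ --> X]sqrtr1.
    by apply: (continuous_cvg _ _ Mm); exact: sqrt_continuous.
  (* The mean of Z converges, so its square vanishes after division by sqrt M_n and the second
     moment alone determines the limit. *)
  have := cvgn_mul (cvgn_add h1 (cvgn_mul (@cvgn_cst _ (- 1)) (cvgn_mul sM1 (cvgn_mul hZ hZ)))) h2.
  rewrite mul0r mulr0 addr0 mulr1; apply: cvg_trans; apply: near_eq_cvg; near=> n.
  have n0 : (0 < n)%N by near: n; exact: nbhs_infty_gt.
  rewrite /Z2 (rexp_Z_sqr hX)// -/cell -(half_orderE hMp n0).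
  rewrite sqrtrM ?ler0n// sqrtrV ?(ltW (m0 n n0))//.
  have sM0 : Num.sqrt (M n)%:R != 0 :> R.
    by rewrite gt_eqF// sqrtr_gt0 lt_neqAle eq_sym M0 ?ler0n.
  have sm0 : Num.sqrt (m n) != 0 by rewrite gt_eqF// sqrtr_gt0 m0.
  by field; rewrite sM0 sm0.
have hBias n : (0 < n)%N -> Bias n = (1 - gamma n) * Bias n.-1 + gamma n * (Z n - f x).
  by case: n => // n _; exact: (bias_estimatorS X gamma x hMp).
have hVar n : (0 < n)%N -> Var n = (1 - gamma n) ^+ 2 * Var n.-1 +
    gamma n ^+ 2 * (Z2 n - Z n ^+ 2).
  by case: n => // n _; exact: (var_estimatorS hX gamma x hMp).
have hMSE n : MSE n = Var n + Bias n ^+ 2.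
  by rewrite /MSE mseE//; exact: (bounded_rv_estimator X gamma x hMp).
have em2 n : (0 < n)%N -> 0 < m n ^- 2 by move=> n0; rewrite invr_gt0 exprn_gt0// m0.
have em4 n : (0 < n)%N -> 0 < m n ^- 4 by move=> n0; rewrite invr_gt0 exprn_gt0// m0.
have ev n : (0 < n)%N -> 0 < varscale gamma m n.
  by move=> n0; rewrite mulr_gt0 ?g0// sqrtr_gt0 m0.
have es n : (0 < n)%N -> 0 < Num.sqrt (varscale gamma m n).
  by move=> n0; rewrite sqrtr_gt0 ev.
have bB := bias_rate halpha hgamma ha hm hL hLmin hxi hBias hw.
have bV := var_rate halpha hgamma ha hm hL hLmin hxi hVar hv.
have bB0 := bias_negligible halpha hgamma ha hm hL hLmin hxi hBias hw.
have bV0 := var_negligible halpha hgamma ha hm hL hLmin hxi hVar hv.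
have toB : ((2 * a)%:E < L)%E -> B.
  by move=> h; apply: (eqaddo_of_cvg em2 _ (bB h)) => n; ring.
have toV : (((2 * alpha - a) / 4)%:E < L)%E -> V.
  by move=> h; apply: (eqaddo_of_cvg ev _ (bV h)) => n; rewrite /varscale; ring.
have small := min_small halpha ha hLmin; have large := min_large halpha ha hLmin.
have sqB : ((2 * a)%:E < L)%E ->
  Bias n ^+ 2 / m n ^- 4 @[n --> \oo] --> Delta2 f x ^+ 2 * (4 / (1 - 2 * a * xi) ^+ 2).
  move=> h; have := cvgn_mul (bB h) (bB h).
  have -> : - (2 * Delta2 f x) / (1 - 2 * a * xi) * (- (2 * Delta2 f x) / (1 - 2 * a * xi)) =
      Delta2 f x ^+ 2 * (4 / (1 - 2 * a * xi) ^+ 2).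
    by field; rewrite gt_eqF// (bias_factor_gt0 halpha ha hL hxi).
  apply: cvg_trans; apply: near_eq_cvg; near=> n.
  have n0 : (0 < n)%N by near: n; exact: nbhs_infty_gt.
  by field; rewrite gt_eqF// m0.
split; [split=> [h|h]|split; [split=> h|split; [move=> h|split=> h]]].
- exact/toB/small.
- exact: eqo_of_cvg es (bB0 h).
- exact/toV/large.
- exact: eqo_of_cvg em4 (bV0 h).
- have [h1 h2] : ((2 * a)%:E < L)%E /\ (((2 * alpha - a) / 4)%:E < L)%E.
    by split; apply: le_lt_trans h; rewrite lee_fin le_max lexx ?orbT.
  split; [exact: (bias_factor_gt0 halpha ha hL hxi)|exact: (var_factor_gt0 halpha ha hL hxi)|
    exact: toB|exact: toV].
- have h1 := small (ltW h).
  have := cvgn_add (bV0 h) (sqB h1); rewrite add0r => hc.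
  apply: (eqaddo_of_cvg em4 (l := Delta2 f x ^+ 2 * (4 / (1 - 2 * a * xi) ^+ 2))) => [n|]; first ring.
  by under eq_fun do rewrite hMSE mulrDl.
- have h1 : ((2 * a)%:E < L)%E by apply: small; rewrite h.
  have h2 : (((2 * alpha - a) / 4)%:E < L)%E by apply: large; rewrite h.
  (* On the boundary the two scales have the same exponent but their ratio may have no limit, so
     each term is estimated on its own scale and the bounds are added. *)
  apply: eqaddo_of_near => eps eps0.
  have n1 := near_of_cvg em4 (sqB h1) eps0; have n2 := near_of_cvg ev (bV h2) eps0.
  near=> n; rewrite hMSE.
  have k1 : `|Bias n ^+ 2 - Delta2 f x ^+ 2 * (4 / (1 - 2 * a * xi) ^+ 2) * m n ^- 4| <= eps * m n ^- 4.
    by near: n.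
  have k2 : `|Var n - C3 R * f x * psi x * (2 / (4 - (2 * alpha - a) * xi)) * varscale gamma m n|
     <= eps * varscale gamma m n by near: n.
  rewrite mulrDr; apply: le_trans (lerD k1 k2); apply: le_trans (ler_normD _ _).
  by rewrite le_eqVlt; apply/orP; left; apply/eqP; congr `|_|; rewrite /varscale; ring.
(* The bias is negligible on the square root of the variance scale, so its square is negligible on
   that scale. *)
- have := cvgn_add (bV (large (ltW h))) (cvgn_mul (bB0 h) (bB0 h)); rewrite mulr0 addr0 => hc.
  apply: (eqaddo_of_cvg ev (l := C3 R * f x * psi x * (2 / (4 - (2 * alpha - a) * xi)))) => [n|].
    by rewrite /varscale; ring.
  apply: cvg_trans hc; apply: near_eq_cvg; near=> n.
  have n0 : (0 < n)%N by near: n; exact: nbhs_infty_gt.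
  rewrite hMSE [in RHS]mulrDl; congr (_ + _).
  have : varscale gamma m n = Num.sqrt (varscale gamma m n) * Num.sqrt (varscale gamma m n).
    by rewrite -expr2 sqr_sqrtr// ltW// ev.
  move: (varscale gamma m n) (Num.sqrt (varscale gamma m n)) => v s ->.
  by rewrite [in RHS]expr2 invfM mulrACA.
Unshelve. all: by end_near. Qed.
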